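(* There exists a compactly supported smooth function $g_0:\mathbb R^2\to\mathbb R$ such that for every $\beta\in(1,\infty)$ and every $T>0$ the following holds. Let $w(x,t)$ be the unique solution of the 2D Euler equation with initial vorticity $w_0(x)=w_s(x)+g_0(x)$, which can be written in the form $$w(x,t)=w_s(x-\phi^*(t))+g(x,t)$$ with $g\in L^\infty([0,T];L^\infty)$ and $\phi^*:[0,\infty)\to\mathbb R^2$ the particle trajectory of the origin. Then $$\sup_{t\in[0,T]}\|g(\cdot,t)\|_{C^{\phi_\beta}}=\infty .$$
   Context: All function spaces are over $\mathbb R^2$ unless stated otherwise. 2D Euler equation in vorticity form: $w_t+u\cdot\nabla w=0$, $w(\cdot,0)=w_0$, where $u=\nabla^\perp\Delta^{-1}w$ is given by the Biot–Savart law $u(x,t)=\frac1{2\pi}\int_{\mathbb R^2}\frac{(x-y)^\perp}{|x-y|^2}w(y,t)\,dy$, $(a,b)^\perp:=(-b,a)$. Loglog vortex: $w_s:\mathbb R^2\setminus\{0\}\to\mathbb R$ is the radial function $w_s(x)=\log\log\frac1{|x|}$ for $0<|x|<e^{-2}$, $w_s(x)=s(|x|)$ for $e^{-2}\le|x|\le e^{-1}$, $w_s(x)=0$ for $|x|>e^{-1}$, where $s$ is any fixed function making $w_s$ smooth on $\mathbb R^2\setminus\{0\}$ (with bounded support). Solutions: for every bounded compactly supported $g_0$, it is known that there is a unique global weak solution (in the distributional sense) with initial vorticity $w_0=w_s+g_0$, and it is Lagrangian: $w(x,t)=w_0(\Phi_t^{-1}(x))$, where $\Phi(x,t)=\Phi_t(x)$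 is the flow map of $u$ (i.e. $\frac{d}{dt}\Phi(x,t)=u(\Phi(x,t),t)$, $\Phi(x,0)=x$). ''The unique solution'' means this one. The particle trajectory of the origin is $\phi^*(t)=\Phi(0,t)$. Modulus of continuity spaces: for a non-decreasing continuous $\mu:[0,c]\to[0,\infty)$ with $\mu(0)=0$, $$\|f\|_{C^\mu}:=\|f\|_\infty+\sup_{0<|x-y|<c}\frac{|f(x)-f(y)|}{\mu(|x-y|)},\qquad C^\mu:=\{f\in L^\infty:\|f\|_{C^\mu}<\infty\},$$ with $\|f\|_{C^\mu}=\infty$ if $f\notin C^\mu$. Here $\phi_\beta(r)=\left(\log\frac1r\right)^{-\beta}$, $\phi_\beta(0)=0$, with $c=e^{-1}$. *)

(* Defs.v *)
From HB Require Import structures.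
From mathcomp Require Import all_boot all_order all_algebra.
From mathcomp Require Import all_classical all_reals all_analysis.

Set Implicit Arguments.
Unset Strict Implicit.
Unset Printing Implicit Defensive.

Import Order.TTheory GRing.Theory Num.Theory.
Import numFieldNormedType.Exports.

Local Open Scope classical_set_scope.
Local Open Scope ring_scope.

(* The plane is R * R.  The library norm on R * R is the sup norm, hence the
   separate Euclidean norm below; both induce the same topology. *)
Definition enorm (R : realType) (x : R * R) : R :=
  Num.sqrt (x.1 ^+ 2 + x.2 ^+ 2).

Definition leb2 (R : realType) :=
  ((@lebesgue_measure R) \x (@lebesgue_measure R))%E.

(* R, R * R and R * (R * R) with their Borel sigma-algebras *)
Local Notation mR R := (measurableTypeR R).
Local Notation mRxR2 R := (mR R * (mR R * mR R))%type.

Definition perp (R : realType) (a : R * R) : R * R := (- a.2, a.1).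

Section Smoothness.
Variables (R : realType) (V : normedModType R).

(* D_{v1} (D_{v2} (... f)) for vs = [:: v1; v2; ...] *)
Definition iter_derive (vs : seq V) (f : V -> R) : V -> R :=
  foldr (fun v h => 'D_v h) f vs.

(* C^oo on A; meant for open A, where the iterated directional derivatives
   at a point of A only depend on the restriction of f to A. *)
Definition smooth_on (A : set V) (f : V -> R) : Prop :=
  forall (vs : seq V) (x : V), A x -> differentiable (iter_derive vs f) x.

Definition compactly_supported (f : V -> R) : Prop :=
  compact (closure [set x | f x != 0]).

End Smoothness.

Section Euler.
Variable R : realType.
Implicit Types (v : R * R -> R) (w g : R -> R * R -> R)
               (Phi : R -> R * R -> R * R).

(* The value at the origin, where the vortex is undefined, is the junk value
   ln (ln 0^-1) = 0. *)
Definition loglog_vortex (s : R -> R) (x : R * R) : R :=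
  let r := enorm x in
  if r < expR (- 2) then ln (ln r^-1)
  else if r <= expR (- 1) then s r
  else 0.

(* Velocity nabla^perp Delta^-1 v at x.  The integrand at y = x is 0 by the
   convention 0^-1 = 0. *)
Definition biot_savart v (x : R * R) : R * R :=
  let K y := (enorm (x - y) ^+ 2)^-1 *: perp (x - y) in
  (2 * pi)^-1 *:
    (\int[@leb2 R]_y ((K y).1 * v y), \int[@leb2 R]_y ((K y).2 * v y)).

(* Yudovich's class for p-norms growing like log p, which contains log log
   singularities and in which weak solutions are unique. *)
Definition yudovich_class w : Prop :=
  @measurable_fun _ _ (mRxR2 R) (mR R) (`[0, +oo[ `*` setT)
    (fun z => w z.1 z.2) /\
  forall T : R, 0 < T -> exists C : R,
    forall t p : R, 0 <= t <= T -> 1 <= p ->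
      (Lnorm (@leb2 R) p%:E (EFin \o w t) <= (C * (1 + ln p))%:E)%E.

(* w_t + u . nabla w = 0 and w(., 0) = w0 in the sense of distributions on
   [0, +oo[ * R^2 (using div u = 0), with u = biot_savart w. *)
Definition distributional_solution v w : Prop :=
  forall psi : R * (R * R) -> R,
    smooth_on setT psi -> compactly_supported psi ->
    \int[@lebesgue_measure R]_(t in `[0, +oo[)
      (\int[@leb2 R]_x
        (let u := biot_savart (w t) x in
         w t x * ('D_((1, (0, 0)) : R * (R * R)) psi (t, x)
                  + u.1 * 'D_((0, (1, 0)) : R * (R * R)) psi (t, x)
                  + u.2 * 'D_((0, (0, 1)) : R * (R * R)) psi (t, x))))
    + \int[@leb2 R]_x (v x * psi (0, x)) = 0.

(* Phi t x is Phi_t(x); only times t >= 0 are meaningful. *)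
Definition flow_map w Phi : Prop :=
  forall x : R * R,
    [/\ Phi 0 x = x,
        {within `[0, +oo[, continuous (fun t => Phi t x)} &
        forall t : R, 0 < t ->
          is_derive t 1 (fun r : R => Phi r x) (biot_savart (w t) (Phi t x))].

(* w(., t) = v o Phi_t^-1 as an equality of Lebesgue classes. *)
Definition transported v w Phi : Prop :=
  forall t : R, 0 <= t -> exists Psi : R * R -> R * R,
    [/\ cancel (Phi t) Psi, cancel Psi (Phi t) &
        {ae @leb2 R, forall x, w t x = v (Psi x)}].

(* w is the (Lagrangian) weak solution with initial vorticity v, and Phi is
   the flow map of its velocity. *)
Definition euler_solution v w Phi : Prop :=
  [/\ yudovich_class w, distributional_solution v w,
      flow_map w Phi & transported v w Phi].

(* Membership in L^oo([0,T]; L^oo). *)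
Definition Linfty_Linfty (T : R) g : Prop :=
  @measurable_fun _ _ (mRxR2 R) (mR R) (`[0, T] `*` setT)
    (fun z => g z.1 z.2) /\
  exists M : R, {ae @lebesgue_measure R, forall t, t \in `[0, T] ->
    (Lnorm (@leb2 R) +oo (EFin \o g t) <= M%:E)%E}.

(* w(x,t) = w_s(x - phi(t)) + g(x,t) on [0,T], with g in L^oo([0,T]; L^oo) and
   phi the trajectory of the origin.  As w(., t) is a Lebesgue class, g ranges
   over all functions whose time slices represent w(., t) - w_s(. - phi(t)). *)
Definition vortex_decomposition (s : R -> R) (T : R) w Phi g : Prop :=
  (forall t : R, 0 <= t <= T ->
    {ae @leb2 R, forall x, w t x = loglog_vortex s (x - Phi t 0) + g t x}) /\
  Linfty_Linfty T g.

(* Norm of C^mu for a modulus mu on [0, c] which is positive on ]0, c[.  It is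
   +oo outside L^oo: a finite second term forces f to be continuous, hence
   measurable. *)
Definition Cmod_norm (mu : R -> R) (c : R) (f : R * R -> R) : \bar R :=
  (Lnorm (@leb2 R) +oo (EFin \o f) +
   ereal_sup [set (`|f z.1 - f z.2| / mu (enorm (z.1 - z.2)))%:E
             | z in [set z : (R * R) * (R * R) |
                      (0 < enorm (z.1 - z.2) < c)%R]])%E.

Definition log_modulus (beta r : R) : R :=
  if r == 0 then 0 else (ln r^-1) `^ (- beta).

End Euler.

(* Main.v *)
Require Import Defs.
From HB Require Import structures.
From mathcomp Require Import all_boot all_order all_algebra.
From mathcomp Require Import all_classical all_reals all_analysis.
From mathcomp Require Import measurable_realfun ess_sup_inf ring lra.

Set Implicit Arguments.
Unset Strict Implicit.
Unset Printing Implicit Defensive.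

Import Order.TTheory GRing.Theory Num.Theory.
Import numFieldNormedType.Exports.

Local Open Scope classical_set_scope.
Local Open Scope ring_scope.

(* Let X be the position of a particle relative to the trajectory of the origin
   and K the Biot-Savart kernel.  Then (|X|^2)' is 1/pi times the integral of
   Jker X y = X.(K(X - y) - K(-y)) against the vorticity in the moving frame,
   and this integral vanishes for every radial vorticity, in particular for the
   vortex itself.  So only the perturbation g moves particles radially.

   Boundedness of g.  Where the vortex is singular, g is governed by the change
   of ln Z(|X|), Z(r) = 1 + ln(1 + r^-2)/2.  The Yudovich bounds give an a priori
   drift controlled by L = 1 + ln Z; feeding a bound A + B L on the drift back
   into the velocity halves B, and iterating leaves a constant.

   Loss of the modulus.  The initial perturbation is a bump in the first quadrant,
   whose strain at the origin stretches the first axis and contracts the second.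
   If g(t) had modulus M phi_beta with beta > 1 uniformly in t, then the Dini
   condition would make all other contributions to the strain negligible near the
   origin.  Following back two particles that sit at distance r on the two axes at
   a time t ~ 1/L(r), during which directions and distances barely change, one gets
   |g(x1) - g(x2)| >= c t / ln(1/r) ~ 1/(ln(1/r) ln ln(1/r)), which is larger than
   M phi_beta(r) for small r. *)

(** * Differentiation on the line *)

(** The vortex turns particles around the origin at a rate of order L, unbounded near the origin, so
    only distances can be followed over a fixed time. Directions are under control for a time c/L
    only, and the last argument has to be carried out within such a time. There ln(1/|X|) gains
    about c/L, hence ln ln(1/|X|) gains about c/(L ln(1/r)).

    The iteration for the drift meets two obstacles. The velocity sees the drift at the present
    position of a particle, while the drift is measured from its initial position; a Gronwall bound
    for ln L makes the two weights comparable up to a factor [kap]. And one feedback gains only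
    after a short time; the weight exp(lam t) with large lam makes it a contraction on all of [0,T].

    Polar coordinates are avoided throughout: plane integrals of radial functions are compared with
    integrals over squares and computed by one-dimensional antiderivatives, and the invariances of
    the measure all come from shears and one flip. Kernel bounds are pointwise majorizations by a
    few integrable model functions. *)

Section Deriv.
Variable R : realType.
Implicit Types (f g : R -> R) (x a b : R).

Lemma deq f x a b : is_derive x 1 f a -> a = b -> is_derive x 1 f b.
Proof. by move=> + <-. Qed.

Lemma dcont f x a : is_derive x 1 f a -> {for x, continuous f}.
Proof. by case=> + _; move=> /derivable1_diffP/differentiable_continuous. Qed.

Lemma did x : is_derive x 1 (fun t : R => t) 1.
Proof. exact: is_derive_id. Qed.

Lemma dcst x c : is_derive x 1 (fun=> c : R) 0.
Proof. exact: is_derive_cst. Qed.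

Lemma dD f g x a b : is_derive x 1 f a -> is_derive x 1 g b ->
  is_derive x 1 (fun t => f t + g t) (a + b).
Proof. by move=> df dg; exact: is_deriveD. Qed.

Lemma dN f x a : is_derive x 1 f a -> is_derive x 1 (fun t => - f t) (- a).
Proof. by move=> df; exact: is_deriveN. Qed.

Lemma dM f g x a b : is_derive x 1 f a -> is_derive x 1 g b ->
  is_derive x 1 (fun t => f t * g t) (f x * b + g x * a).
Proof. by move=> df dg; exact: is_deriveM. Qed.

Lemma dX f n x a : is_derive x 1 f a ->
  is_derive x 1 (fun t => f t ^+ n.+1) (n.+1%:R * f x ^+ n * a).
Proof.
move=> df; elim: n => [|n IH]; first by apply: (deq df); rewrite expr0; ring.
rewrite (_ : (fun t => _) = fun t => f t * f t ^+ n.+1); last first.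
  by apply/funext => t; rewrite exprS.
apply: (deq (dM df IH)); rewrite -[n.+2%:R]natr1 exprS; ring.
Qed.

Lemma dV f x a : f x != 0 -> is_derive x 1 f a ->
  is_derive x 1 (fun t => (f t)^-1) (- a / f x ^+ 2).
Proof.
move=> f0 df; apply: (deq (is_deriveV f0 df)).
by rewrite /GRing.scale/= mulNr mulrC -mulNr.
Qed.

Lemma dcomp f g x a b : is_derive (g x) 1 f a -> is_derive x 1 g b ->
  is_derive x 1 (fun t => f (g t)) (a * b).
Proof. by move=> df dg; exact: (is_derive1_comp df dg). Qed.

Lemma dsqrt f x a : 0 < f x -> is_derive x 1 f a ->
  is_derive x 1 (fun t => Num.sqrt (f t)) ((2 * Num.sqrt (f x))^-1 * a).
Proof. by move=> f0 df; exact: (dcomp (is_derive1_sqrt f0) df). Qed.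

Lemma dln f x a : 0 < f x -> is_derive x 1 f a ->
  is_derive x 1 (fun t => ln (f t)) ((f x)^-1 * a).
Proof. by move=> f0 df; exact: (dcomp (is_derive1_ln f0) df). Qed.

Lemma dexp f x a : is_derive x 1 f a ->
  is_derive x 1 (fun t => expR (f t)) (expR (f x) * a).
Proof. by move=> df; exact: (dcomp (is_derive_expR _) df). Qed.

Lemma dpow f x a p : 0 < f x -> is_derive x 1 f a ->
  is_derive x 1 (fun t => (f t) `^ p) (p * f x `^ (p - 1) * a).
Proof. by move=> f0 df; exact: (dcomp (is_derive1_powR p f0) df). Qed.

End Deriv.

(** Syntax-directed differentiation. The derivative is left as an existential variable, and the
    nonvanishing and positivity conditions remain as goals; the constant clause comes early so that
    subterms independent of the variable are not unfolded further. *)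
Ltac dstep :=
  match goal with
  | |- is_derive _ _ (fun t => t) _ => eapply did
  | |- is_derive _ _ (fun t => ?c) _ => eapply dcst
  | |- is_derive _ _ (fun t => @?f t + @?g t) _ => eapply (@dD _ f g)
  | |- is_derive _ _ (fun t => @?f t * @?g t) _ => eapply (@dM _ f g)
  | |- is_derive _ _ (fun t => - @?f t) _ => eapply (@dN _ f)
  | |- is_derive _ _ (fun t => @?f t ^+ (S ?n)) _ => eapply (@dX _ f n)
  | |- is_derive _ _ (fun t => (@?f t)^-1) _ => eapply (@dV _ f)
  | |- is_derive _ _ (fun t => Num.sqrt (@?f t)) _ => eapply (@dsqrt _ f)
  | |- is_derive _ _ (fun t => ln (@?f t)) _ => eapply (@dln _ f)
  | |- is_derive _ _ (fun t => expR (@?f t)) _ => eapply (@dexp _ f)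
  | |- is_derive _ _ (fun t => (@?f t) `^ ?p) _ => eapply (@dpow _ f)
  | H : is_derive _ _ ?f _ |- is_derive _ _ ?f _ => exact H
  end.
Ltac dauto := repeat (dstep; cbv beta).

(** * Measure-preserving maps of the plane *)

Section Toolkit.
Variable R : realType.
Local Notation mR := (measurableTypeR R).
Local Notation mR2 := (mR * mR)%type.
Local Notation mu := (@lebesgue_measure R).
Local Notation mu2 := (@leb2 R).

(** The power function inverts nonnegative bases only, hence the detour through [x ^+ 2]; the factor
    [x] gives the right value at 0. *)
Lemma measurable_inv : measurable_fun [set: mR] (fun x : mR => x^-1 : mR).
Proof.
have -> : (fun x : mR => x^-1 : mR) = (fun x => x * (x ^+ 2) `^ (-1)).
  apply/funext => x; rewrite powR_inv1 ?sqr_ge0// expr2.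
  by have [->|x0] := eqVneq x 0; [rewrite invr0 mul0r|field].
apply: measurable_funM => //.
by apply: measurableT_comp (measurable_powR _) _; exact: exprn_measurable.
Qed.

Lemma measurable_sqrt : measurable_fun [set: mR] (fun x : mR => Num.sqrt x : mR).
Proof. apply: continuous_measurable_fun; exact: sqrt_continuous. Qed.

Section Comb.
Context d (T : measurableType d).
Implicit Types f g : T -> R.

Lemma measurable_funV (D : set T) f : measurable_fun D f -> measurable_fun D (fun x => (f x)^-1).
Proof. exact: measurableT_comp measurable_inv. Qed.

Lemma measurable_funsqrt D f : measurable_fun D f ->
  measurable_fun D (fun x => Num.sqrt (f x)).
Proof. exact: measurableT_comp measurable_sqrt. Qed.

Lemma measurable_funln D f : measurable_fun D f -> measurable_fun D (fun x => ln (f x)).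
Proof. exact: measurableT_comp (@measurable_ln R). Qed.

End Comb.

Lemma measurable_fst2 : measurable_fun [set: mR2] (fun x : mR2 => x.1).
Proof. exact: measurable_fst. Qed.

Lemma measurable_snd2 : measurable_fun [set: mR2] (fun x : mR2 => x.2).
Proof. exact: measurable_snd. Qed.

Lemma measurable_enorm : measurable_fun [set: mR2] (fun x : mR2 => enorm (x : R * R)).
Proof.
rewrite /enorm; apply: measurable_funsqrt; apply: measurable_funD.
  by apply: measurable_funX; exact: measurable_fst2.
by apply: measurable_funX; exact: measurable_snd2.
Qed.

(** Only shears and one flip are shown to have this property directly; translations, quarter turns
    and reflections are obtained as compositions. *)
Definition mpres (T : R * R -> R * R) :=
  measurable_fun [set: mR2] (T : mR2 -> mR2) /\
  forall E : set mR2, measurable E -> mu2 (T @^-1` E) = mu2 E.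

Lemma mpres_comp S T : mpres S -> mpres T -> mpres (S \o T).
Proof.
move=> [mS pS] [mT pT]; split; first exact: measurableT_comp mS mT.
move=> E mE; rewrite comp_preimage pT ?pS//.
by rewrite -[X in measurable X]setTI; exact: mS.
Qed.

Lemma lebesgue_measure_shift (c : R) (A : set mR) : measurable A ->
  mu ((fun x => x + c) @^-1` A) = mu A.
Proof.
move=> mA.
have mc : measurable_fun [set: mR] ((fun x => x + c) : mR -> mR).
  by apply: measurable_funD.
pose phi : mR -> mR := fun x => x + c.
pose mm : {mfun mR >-> mR} := HB.pack phi (isMeasurableFun.Build _ _ _ _ phi mc).
rewrite -[LHS]/(pushforward mu mm A).
apply/esym/lebesgue_measure_unique => //= _ [[a b]] _ <-.
rewrite /pushforward.
have -> : mm @^-1` `]a, b] = [set` `](a - c), (b - c)]].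
  apply/seteqP; split=> x /=; rewrite /phi !in_itv/= ltrBlDr lerBrDr//.
rewrite !lebesgue_measure_itv/= !lte_fin ltrBlDr subrK.
by case: ifP => // _; rewrite -!EFinB; congr EFin; ring.
Qed.

(** Each vertical section of the preimage is a translate of the corresponding section of the set. *)
Lemma mpres_shear2 (phi : R -> R) : measurable_fun [set: mR] (phi : mR -> mR) ->
  mpres (fun z => (z.1, z.2 + phi z.1)).
Proof.
move=> mphi.
have mT : measurable_fun [set: mR2] ((fun z => (z.1, z.2 + phi z.1)) : mR2 -> mR2).
  apply/measurable_fun_pairP; split; first exact: measurable_fst2.
  apply: measurable_funD; first exact: measurable_snd2.
  by apply: measurableT_comp mphi _; exact: measurable_fst2.
split=> // E mE.
rewrite /leb2 /= /product_measure1; apply: eq_integral => x _ /=.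
rewrite -[RHS](lebesgue_measure_shift (phi x)); last exact: measurable_xsection.
by congr (mu _); apply/seteqP; split => y /=; rewrite /xsection/= !inE.
Qed.

(** Gives access to horizontal sections, which the other shear translates. *)
Lemma leb2_swapE (E : set mR2) : measurable E -> mu2 E = (mu \x^ mu)%E E.
Proof.
move=> mE; apply: product_measure_unique => // A B mA mB.
exact: product_measure2E.
Qed.

Lemma mpres_shear1 (phi : R -> R) : measurable_fun [set: mR] (phi : mR -> mR) ->
  mpres (fun z => (z.1 + phi z.2, z.2)).
Proof.
move=> mphi.
have mT : measurable_fun [set: mR2] ((fun z => (z.1 + phi z.2, z.2)) : mR2 -> mR2).
  apply/measurable_fun_pairP; split; last exact: measurable_snd2.
  apply: measurable_funD; first exact: measurable_fst2.
  by apply: measurableT_comp mphi _; exact: measurable_snd2.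
split=> // E mE.
rewrite !leb2_swapE//; last by rewrite -[X in measurable X]setTI; exact: mT.
rewrite /= /product_measure2; apply: eq_integral => x _ /=.
rewrite -[RHS](lebesgue_measure_shift (phi x)); last exact: measurable_ysection.
by congr (mu _); apply/seteqP; split => y /=; rewrite /ysection/= !inE.
Qed.

Lemma mpres_flip : mpres (fun z => (z.1, - z.2)).
Proof.
split.
  apply/measurable_fun_pairP; split; first exact: measurable_fst2.
  by apply: measurable_funN; exact: measurable_snd2.
move=> E mE.
rewrite /leb2 /= /product_measure1; apply: eq_integral => x _ /=.
rewrite -[RHS]lebesgue_measureN; last exact: measurable_xsection.
by congr (mu _); apply/seteqP; split => y /=; rewrite /xsection/= !inE.
Qed.

Lemma mpres_ge0 T (f : R * R -> \bar R) : mpres T ->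
  measurable_fun [set: mR2] (f : mR2 -> \bar R) -> (forall x, 0 <= f x)%E ->
  (\int[mu2]_x f (T x) = \int[mu2]_x f x)%E.
Proof.
move=> [mT pT] mf f0.
pose m2 : {measure set mR2 -> \bar R} := (mu \x mu)%E.
pose mm : {mfun mR2 >-> mR2} := HB.pack (T : mR2 -> mR2) (isMeasurableFun.Build _ _ _ _ (T : mR2 -> mR2) mT).
have h := @ge0_integral_pushforward _ _ mR2 mR2 R mm mT m2 setT f measurableT mf
  (fun x _ => f0 x).
refine (eq_trans (esym h) _).
by apply: (@eq_measure_integral _ mR2 R setT m2 (pushforward m2 mm)) => A mA _; exact: pT.
Qed.

(** Integrability is not asked for: the integrals of the positive and of the negative part are
    preserved separately, infinite or not. *)
Lemma mpres_Rint T (f : R * R -> R) : mpres T ->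
  measurable_fun [set: mR2] (f : mR2 -> R) ->
  \int[mu2]_x f (T x) = \int[mu2]_x f x.
Proof.
move=> pT mf; rewrite /Rintegral; congr fine.
rewrite integralE [RHS]integralE.
have mE : measurable_fun [set: mR2] (EFin \o f) by exact/measurable_EFinP.
rewrite -(mpres_ge0 pT (measurable_funepos mE)); last by move=> x; exact: funepos_ge0.
rewrite -(mpres_ge0 pT (measurable_funeneg mE)); last by move=> x; exact: funeneg_ge0.
by congr (_ - _)%E; apply: eq_integral => x _; rewrite ?funeposE ?funenegE.
Qed.

End Toolkit.

(** * Integral bounds *)

Section Bounds.
Variable R : realType.
Local Notation mR := (measurableTypeR R).
Local Notation mR2 := (mR * mR)%type.
Local Notation mu := (@lebesgue_measure R).
Local Notation mu2 := (@leb2 R).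

(** The fundamental theorem on each compact interval, then monotone convergence; the antiderivative
    may be singular at the ends of [D]. *)
Lemma integral_exhaust_le (f F : R -> R) (D : set R) (a b : nat -> R) (C : R) :
  (forall n, 0 < a n) -> (forall n, a n < b n) ->
  (forall n m, (n <= m)%N -> a m <= a n) ->
  (forall n m, (n <= m)%N -> b n <= b m) ->
  D = \bigcup_n `[a n, b n]%classic ->
  (forall x : R, D x -> is_derive x 1 F (f x)) ->
  (forall x : R, D x -> {for x, continuous f}) ->
  (forall x : R, D x -> 0 <= f x) ->
  (forall n, F (b n) - F (a n) <= C) ->
  (\int[mu]_(x in D) (f x)%:E <= C%:E)%E.
Proof.
move=> a0 ab amono bmono DE dF cf f0 FC.
have Dn n x : a n <= x <= b n -> D x.
  by move=> axb; rewrite DE; exists n => //=; rewrite in_itv.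
have cw n : {within `[a n, b n], continuous f}.
  apply: continuous_in_subspaceT => x; rewrite inE/= in_itv/= => axb.
  exact: cf (Dn _ _ axb).
have nd : nondecreasing_seq (fun n => [set` `[a n, b n]] : set mR).
  move=> n m nm; rewrite subsetEset => x /=; rewrite !in_itv/= => /andP[ax xb].
  by rewrite (le_trans (amono _ _ nm) ax) (le_trans xb (bmono _ _ nm)).
have mf n : measurable_fun ([set` `[a n, b n]] : set mR) (EFin \o f).
  apply/measurable_EFinP; apply: subspace_continuous_measurable_fun; first exact: measurable_itv.
  exact: (cw n).
have h := @ge0_nondecreasing_set_cvg_integral _ mR R _ (EFin \o f) mu nd _ mf _.
have {}h := h (fun n => measurable_itv _) _.
have h0 : forall i x, ([set` `[a i, b i]] : set mR) x -> (0 <= (EFin \o f) x)%E.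
  move=> i x /=; rewrite in_itv/= => axb; rewrite lee_fin f0//.
  exact: Dn axb.
have {h h0} h := h h0.
rewrite DE -(cvg_lim _ h)//.
apply: lime_le.
  by apply/cvg_ex; eexists; exact: h.
apply: nearW => n /=.
rewrite (continuous_FTC2 (ab n) (cw n) (F := F)).
- by rewrite -EFinB lee_fin.
- split.
  + move=> x; rewrite in_itv/= => /andP[ax xb].
    have axb : a n <= x <= b n by rewrite !ltW.
    by have [] := dF x (Dn n x axb).
  + apply: cvg_at_right_filter; have axb : a n <= a n <= b n by rewrite lexx ltW.
    have [+ _] := dF _ (Dn n (a n) axb).
    by move=> /derivable1_diffP/differentiable_continuous.
  + apply: cvg_at_left_filter; have axb : a n <= b n <= b n by rewrite lexx andbT ltW.
    have [+ _] := dF _ (Dn n (b n) axb).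
    by move=> /derivable1_diffP/differentiable_continuous.
- move=> x; rewrite in_itv/= => /andP[ax xb].
  have axb : a n <= x <= b n by rewrite !ltW.
  by rewrite derive1E; have dFx := dF x (Dn _ _ axb); rewrite derive_val.
Qed.

Lemma integral_oy_le (f F : R -> R) (C : R) :
  (forall x : R, 0 < x -> is_derive x 1 F (f x)) ->
  (forall x : R, 0 < x -> {for x, continuous f}) ->
  (forall x : R, 0 < x -> 0 <= f x) ->
  (forall x y, 0 < x -> x < y -> F y - F x <= C) ->
  (\int[mu]_(x in `]0%R, +oo[) (f x)%:E <= C%:E)%E.
Proof.
move=> dF cf f0 FC.
have n1 (n : nat) : 1 <= n.+1%:R :> R by rewrite ler1n.
have n0 (n : nat) : 0 < n.+1%:R :> R by rewrite ltr0n.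
apply: (@integral_exhaust_le f F _ (fun n => n.+1%:R^-1 / 2) (fun n => n.+1%:R)); cbv beta.
- by move=> n; rewrite divr_gt0// invr_gt0.
- move=> n; rewrite ltr_pdivrMr// (@le_lt_trans _ _ 1)//.
    by rewrite invf_le1.
  by have := n1 n; lra.
- by move=> n m nm; rewrite ler_pM2r// lef_pV2 ?posrE// ler_nat.
- by move=> n m nm; rewrite ler_nat.
- apply/seteqP; split => x /=.
    rewrite in_itv/= andbT => x0.
    have [N xN] : exists N, x <= N.+1%:R /\ x^-1 <= N.+1%:R.
      pose y := Num.max x x^-1; exists (Num.truncn y).
      have y0 : 0 <= y by rewrite /y le_max (ltW x0).
      have := truncnS_gt y => /ltW yl.
      by split; apply: le_trans yl; rewrite /y le_max lexx ?orbT.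
    exists N => //=; rewrite in_itv/= xN.1 andbT.
    rewrite ler_pdivrMr// (@le_trans _ _ x)//; last by rewrite ler_peMr ?ler1n// ltW.
    by rewrite invf_ple ?posrE//; exact: xN.2.
  case=> n _ /=; rewrite !in_itv/= andbT => /andP[+ _].
  by apply: lt_le_trans; rewrite divr_gt0// invr_gt0.
- by move=> x /=; rewrite in_itv/= andbT; exact: dF.
- by move=> x /=; rewrite in_itv/= andbT; exact: cf.
- by move=> x /=; rewrite in_itv/= andbT; exact: f0.
- move=> n; apply: FC; first by rewrite divr_gt0// invr_gt0.
  rewrite ltr_pdivrMr// (@le_lt_trans _ _ 1)//.
    by rewrite invf_le1.
  by have := n1 n; lra.
Qed.

Lemma integral_oc_le (f F : R -> R) (b C : R) : 0 < b ->
  (forall x : R, 0 < x <= b -> is_derive x 1 F (f x)) ->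
  (forall x : R, 0 < x <= b -> {for x, continuous f}) ->
  (forall x : R, 0 < x <= b -> 0 <= f x) ->
  (forall x, 0 < x -> x < b -> F b - F x <= C) ->
  (\int[mu]_(x in `]0%R, b]) (f x)%:E <= C%:E)%E.
Proof.
move=> b0 dF cf f0 FC.
have n0 (n : nat) : 0 < n.+2%:R :> R by rewrite ltr0n.
have abn (n : nat) : b / n.+2%:R < b.
  by rewrite ltr_pdivrMr// ltr_pMr// ltr1n.
apply: (@integral_exhaust_le f F _ (fun n => b / n.+2%:R) (fun=> b)); cbv beta.
- by move=> n; rewrite divr_gt0.
- by [].
- by move=> n m nm; rewrite ler_pM2l// lef_pV2 ?posrE// ler_nat.
- by [].
- apply/seteqP; split => x /=.
    rewrite in_itv/= => /andP[x0 xb].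
    exists (Num.truncn (b / x)) => //=; rewrite in_itv/= xb andbT.
    rewrite ler_pdivrMr// mulrC -ler_pdivrMr//.
    by rewrite (le_trans (ltW (truncnS_gt _)))// ler_nat.
  case=> n _ /=; rewrite !in_itv/= => /andP[+ ->]; rewrite andbT.
  by apply: lt_le_trans; rewrite divr_gt0.
- by move=> x /=; rewrite in_itv/=; exact: cf.
- by move=> x /=; rewrite in_itv/=; exact: f0.
- by move=> n; apply: FC => //; rewrite divr_gt0.
Qed.

(** All kernel estimates are pointwise majorizations by sums of functions with a known constant
    here; [ib_Rint] then yields integrability and the bound together. *)
Definition ib (f : R * R -> R) (C : R) :=
  [/\ measurable_fun [set: mR2] (f : mR2 -> R), (forall y, 0 <= f y) &
      (\int[mu2]_y (f y)%:E <= C%:E)%E].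

Lemma ib_ge0 f C : ib f C -> 0 <= C.
Proof.
case=> _ f0 fC; rewrite -lee_fin; apply: le_trans fC.
by apply: integral_ge0 => y _; rewrite lee_fin.
Qed.

Lemma ib_ae f g C : measurable_fun [set: mR2] (f : mR2 -> R) ->
  (forall y, 0 <= f y) -> {ae mu2, forall y, f y <= g y} -> ib g C -> ib f C.
Proof.
move=> mf f0 fg [mg g0 gC]; split => //; apply: le_trans gC.
apply: ae_ge0_le_integral => //.
- by move=> x _; rewrite lee_fin.
- exact/measurable_EFinP.
- by move=> x _; rewrite lee_fin.
- exact/measurable_EFinP.
- by apply: filterS fg => x fgx _; rewrite lee_fin.
Qed.

Lemma ib_le f g C : measurable_fun [set: mR2] (f : mR2 -> R) ->
  (forall y, 0 <= f y) -> (forall y, f y <= g y) -> ib g C -> ib f C.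
Proof. by move=> mf f0 fg; apply: ib_ae => //; exact: aeW. Qed.

Lemma ib_weak f C C' : C <= C' -> ib f C -> ib f C'.
Proof. by move=> CC' [mf f0 fC]; split => //; rewrite (le_trans fC)// lee_fin. Qed.

Lemma ib_add f g C C' : ib f C -> ib g C' -> ib (fun y => f y + g y) (C + C').
Proof.
move=> [mf f0 fC] [mg g0 gC]; split.
- exact: measurable_funD.
- by move=> y; rewrite addr_ge0.
- under eq_integral do rewrite EFinD.
  rewrite ge0_integralD//; first by rewrite EFinD leeD.
  + by move=> x _; rewrite lee_fin.
  + exact/measurable_EFinP.
  + by move=> x _; rewrite lee_fin.
  + exact/measurable_EFinP.
Qed.

Lemma ib_scale f C k : 0 <= k -> ib f C -> ib (fun y => k * f y) (k * C).
Proof.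
move=> k0 [mf f0 fC]; split.
- exact: measurable_funM.
- by move=> y; rewrite mulr_ge0.
- under eq_integral do rewrite EFinM.
  rewrite ge0_integralZl_EFin//.
  + by rewrite EFinM lee_wpmul2l.
  + by move=> x _; rewrite lee_fin.
  + exact/measurable_EFinP.
Qed.

Lemma ib_mpres T f C : mpres T -> ib f C -> ib (f \o T) C.
Proof.
move=> pT [mf f0 fC]; split => //.
- by apply: measurableT_comp mf _; have [] := pT.
- by move=> y; exact: f0.
- apply: (le_trans _ fC); rewrite le_eqVlt; apply/orP; left; apply/eqP.
  apply: (mpres_ge0 (f := fun y => (f y)%:E) pT) => //.
  exact/measurable_EFinP.
Qed.

Lemma ib_Rint f g C : measurable_fun [set: mR2] (f : mR2 -> R) ->
  {ae mu2, forall y, `|f y| <= g y} -> ib g C ->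
  mu2.-integrable setT (EFin \o f) /\ `|\int[mu2]_y f y| <= C.
Proof.
move=> mf fg ibg.
have [mf' f'0 ibf] : ib (fun y => `|f y|) C.
  by apply: ib_ae fg ibg => //; exact: measurableT_comp.
have fi : mu2.-integrable setT (EFin \o f).
  apply/integrableP; split; first exact/measurable_EFinP.
  by apply: le_lt_trans ibf _; rewrite ltry.
split=> //; rewrite -lee_fin; apply: le_trans ibf.
rewrite EFin_normr_Rintegral//.
by apply: le_abse_integral => //; exact/measurable_EFinP.
Qed.

(** Replaces polar coordinates, with squares instead of circles: 8 x is the perimeter of the square
    of half-side x. The plane is split according to which coordinate is larger, and Tonelli on each
    half leaves an inner interval of length 2 |x|. *)
Lemma ib_sup (h : R -> R) (C : R) : measurable_fun [set: mR] (h : mR -> R) ->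
  (forall x, 0 <= h x) ->
  (\int[mu]_(x in `]0%R, +oo[) (x * h x)%:E <= C%:E)%E ->
  ib (fun y => h (Num.max `|y.1| `|y.2|)) (8 * C).
Proof.
move=> mh h0 hC.
have mabs : measurable_fun [set: mR] (fun x : mR => h `|x|).
  by apply: measurableT_comp mh _; exact: normr_measurable.
have m1 : measurable_fun [set: mR2] (fun y : mR2 => `|y.1|).
  by apply: measurableT_comp; [exact: normr_measurable|exact: measurable_fst2].
have m2 : measurable_fun [set: mR2] (fun y : mR2 => `|y.2|).
  by apply: measurableT_comp; [exact: normr_measurable|exact: measurable_snd2].
have iR : (\int[mu]_x (h `|x| * (2 * `|x|))%:E <= (4 * C)%:E)%E.
  have mg : measurable_fun [set: mR] (fun x : mR => (h `|x| * (2 * `|x|))%:E).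
    apply/measurable_EFinP; apply: measurable_funM => //.
    by apply: measurable_funM => //; exact: normr_measurable.
  have g0 (x : R) : (0 <= (h `|x| * (2 * `|x|))%:E)%E by rewrite lee_fin mulr_ge0.
  have hh : (\int[mu]_(x in `[0%R, +oo[) (h `|x| * (2 * `|x|))%:E <= (2 * C)%:E)%E.
    rewrite -integral_itv_obnd_cbnd; last exact: measurable_funS mg.
    rewrite (eq_integral (fun x : mR => 2%:E * (x * h x)%:E)%E); last first.
      move=> x; rewrite inE/= in_itv/= andbT => x0.
      by rewrite gtr0_norm// -EFinM; congr EFin; ring.
    rewrite ge0_integralZl_EFin//.
    + by rewrite EFinM lee_wpmul2l.
    + move=> x; rewrite /= in_itv/= andbT => x0.
      by rewrite lee_fin mulr_ge0// ltW.
    + apply/measurable_EFinP; apply: measurable_funTS.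
      by apply: measurable_funM.
  rewrite -(setUv ([set` `[0%R, +oo[] : set mR)) ge0_integral_setU//=.
  - rewrite (_ : 4 * C = 2 * C + 2 * C); last by ring.
    rewrite EFinD leeD// setCitvr.
    rewrite integral_itv_bndo_bndc; last exact: measurable_funS mg.
    apply: le_trans hh.
    rewrite (ge0_integration_by_substitution0 mg)//.
    by under [leRHS]eq_integral do rewrite normrN.
  - exact: measurableC.
  - by rewrite setUv.
  - exact/disj_setPCl.
have bound A B : {ae mu2, forall y : mR2, h (Num.max `|y.1| `|y.2|) <= A y + B y} ->
   ib A (4 * C) -> ib B (4 * C) -> ib (fun y => h (Num.max `|y.1| `|y.2|)) (8 * C).
  move=> hAB iA iB; have := ib_add iA iB.
  rewrite (_ : 4 * C + 4 * C = 8 * C); last by ring.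
  apply: ib_ae => //.
  by apply: measurableT_comp mh _; exact: measurable_maxr.
have ind (x y : R) : 0 <= h `|x| * (`|y| <= `|x|)%R%:R by rewrite mulr_ge0.
have mind : measurable_fun [set: mR2] (fun y : mR2 => h `|y.1| * (`|y.2| <= `|y.1|)%R%:R).
  apply: measurable_funM; first exact: measurableT_comp mh m1.
  have -> : (fun x : mR2 => (`|x.2| <= `|x.1|)%R%:R) =
    (fun x => if `|x.2| <= `|x.1| then 1 else 0 : R).
    by apply/funext => x; case: ifP.
  by apply: measurable_fun_ifT => //; exact: measurable_fun_ler.
have inner (x : R) : (\int[mu]_y (h `|x| * (`|y| <= `|x|)%R%:R)%:E =
   (h `|x| * (2 * `|x|))%:E)%E.
  have -> : (fun y : R => (h `|x| * (`|y| <= `|x|)%R%:R)%:E)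
      = (fun y => (h `|x|)%:E * (\1_([set` `[(- `|x|), `|x|]] : set R) y)%:E)%E.
    apply/funext => y; rewrite -EFinM indicE mem_setE in_itv/=.
    by rewrite ler_norml.
  rewrite ge0_integralZl_EFin//; last exact/measurable_EFinP/measurable_indic.
  rewrite integral_indic// setIT [X in (_ * X)%E](lebesgue_measure_itv `[(- `|x|), `|x|])/= lte_fin.
  rewrite EFinM; congr (_ * _)%E.
  case: ltP => [_|]; first by rewrite -EFinB; congr EFin; ring.
  move=> xx; suff -> : `|x| = 0 by rewrite mulr0.
  by apply/eqP; rewrite eq_le normr_ge0 andbT; have := normr_ge0 x; lra.
apply: (bound (fun y => h `|y.1| * (`|y.2| <= `|y.1|)%R%:R)
              (fun y => h `|y.2| * (`|y.1| <= `|y.2|)%R%:R)).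
- apply: aeW => y; have [xy|/ltW xy] := leP `|y.1| `|y.2|.
  + by rewrite mulr1 lerDr.
  + by rewrite xy mulr1 lerDl mulr_ge0.
- split=> //.
  pose f1 (y : mR2) : \bar R := (h `|y.1| * ((`|y.2| <= `|y.1|)%R)%:R)%:E.
  have mE : measurable_fun [set: mR2] f1 by exact/measurable_EFinP.
  have f0 y : (0 <= f1 y)%E by rewrite lee_fin.
  have := @fubini_tonelli1 _ _ mR mR R mu mu f1 mE f0.
  rewrite /fubini_F /f1 /= => e; rewrite [leLHS]e.
  by under eq_integral do rewrite inner.
- have mind2 : measurable_fun [set: mR2] (fun y : mR2 => h `|y.2| * ((`|y.1| <= `|y.2|)%R)%:R).
    have msw : measurable_fun [set: mR2] (fun y : mR2 => (y.2, y.1) : mR2).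
      by apply: measurable_fun_pair; [exact: measurable_snd2|exact: measurable_fst2].
    exact: measurableT_comp mind msw.
  split=> //.
  pose f1 (y : mR2) : \bar R := (h `|y.2| * ((`|y.1| <= `|y.2|)%R)%:R)%:E.
  have mE : measurable_fun [set: mR2] f1 by exact/measurable_EFinP.
  have f0 y : (0 <= f1 y)%E by rewrite lee_fin.
  have := @fubini_tonelli2 _ _ mR mR R mu mu f1 mE f0.
  rewrite /fubini_G /f1 /= => e; rewrite [leLHS]e.
  by under eq_integral do rewrite inner.
Qed.

End Bounds.

(** * Radial weights *)

Section Radial.
Variable R : realType.
Local Notation mR := (measurableTypeR R).
Local Notation mR2 := (mR * mR)%type.
Local Notation mu := (@lebesgue_measure R).
Local Notation mu2 := (@leb2 R).
Implicit Types (x y z X : R * R) (r a b : R).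

Lemma enorm_ge0 x : 0 <= enorm x.
Proof. exact: sqrtr_ge0. Qed.

Lemma enorm_sq x : enorm x ^+ 2 = x.1 ^+ 2 + x.2 ^+ 2.
Proof. by rewrite sqr_sqrtr// addr_ge0 ?sqr_ge0. Qed.

Lemma enorm0 : enorm (0 : R * R) = 0.
Proof. by rewrite /enorm /= !expr0n/= addr0 sqrtr0. Qed.

Lemma enorm_eq0 x : (enorm x == 0) = (x == 0).
Proof.
apply/idP/eqP => [|->]; last by rewrite enorm0.
rewrite /enorm sqrtr_eq0 => h.
have h1 := sqr_ge0 x.1; have h2 := sqr_ge0 x.2.
have e1 : x.1 ^+ 2 = 0 by lra.
have e2 : x.2 ^+ 2 = 0 by lra.
move/eqP: e1; move/eqP: e2; rewrite !sqrf_eq0 => /eqP e2 /eqP e1.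
by rewrite [x]surjective_pairing e1 e2.
Qed.

Lemma enorm_gt0 x : (0 < enorm x) = (x != 0).
Proof. by rewrite lt_def enorm_eq0 enorm_ge0 andbT. Qed.

Lemma enormN x : enorm (- x) = enorm x.
Proof. by rewrite /enorm /= !sqrrN. Qed.

Lemma enormB x y : enorm (x - y) = enorm (y - x).
Proof. by rewrite -enormN opprB. Qed.

Lemma sup_le_enorm x : Num.max `|x.1| `|x.2| <= enorm x.
Proof.
rewrite ge_max; apply/andP; split; rewrite -sqrtr_sqr ler_wsqrtr//.
  by rewrite lerDl sqr_ge0.
by rewrite lerDr sqr_ge0.
Qed.

Lemma enorm_le_sup x : enorm x <= 2 * Num.max `|x.1| `|x.2|.
Proof.
have m0 : 0 <= Num.max `|x.1| `|x.2| by rewrite le_max normr_ge0.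
rewrite -(ler_pXn2r (n := 2)) ?nnegrE ?enorm_ge0 ?mulr_ge0// enorm_sq.
have h1 : `|x.1| <= Num.max `|x.1| `|x.2| by rewrite le_max lexx.
have h2 : `|x.2| <= Num.max `|x.1| `|x.2| by rewrite le_max lexx orbT.
rewrite -(real_normK (num_real x.1)) -(real_normK (num_real x.2)).
have a1 := normr_ge0 x.1; have a2 := normr_ge0 x.2.
by nra.
Qed.

Lemma enorm_triangle x y : enorm (x + y) <= enorm x + enorm y.
Proof.
have := enorm_ge0 x; have := enorm_ge0 y; have := enorm_sq x; have := enorm_sq y.
move=> sy sx y0 x0.
rewrite -(ler_pXn2r (n := 2)) ?nnegrE ?enorm_ge0 ?addr_ge0// enorm_sq /=.
have cs : x.1 * y.1 + x.2 * y.2 <= enorm x * enorm y.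
  have [h|h] := leP (x.1 * y.1 + x.2 * y.2) 0; first by rewrite (le_trans h)// mulr_ge0.
  rewrite -(ler_pXn2r (n := 2)) ?nnegrE ?mulr_ge0// ?(ltW h)// exprMn sx sy.
  by have := sqr_ge0 (x.1 * y.2 - x.2 * y.1); nra.
by nra.
Qed.

Lemma ib_radial (h : R -> R) (C : R) : measurable_fun [set: mR] (h : mR -> R) ->
  (forall a, 0 <= h a) -> (forall a b, 0 < a -> a <= b -> h b <= h a) ->
  (\int[mu]_(x in `]0%R, +oo[) (x * h x)%:E <= C%:E)%E ->
  ib (fun y => h (enorm y)) (8 * C).
Proof.
move=> mh h0 hmono hC; apply: ib_le (ib_sup mh h0 hC) => //.
  by apply: measurableT_comp mh _; exact: measurable_enorm.
move=> y; have m0 : 0 <= Num.max `|y.1| `|y.2| by rewrite le_max normr_ge0.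
move: m0; rewrite le_eqVlt => /predU1P[m0|m0].
  by have := enorm_le_sup y; rewrite -m0 mulr0 => n0;
    rewrite (_ : enorm y = 0)//; apply/eqP; rewrite eq_le n0 enorm_ge0.
by apply: hmono => //; exact: sup_le_enorm.
Qed.

(** Like 1/(r a) below the scale r and like a^-2 above it, so its plane integral diverges only
    logarithmically at infinity. The power 3/2, [k32], is integrable both at 0 and at infinity, with
    integral of order 1/r. *)
Definition kr r a := (a * (a + r))^-1.
Definition k32 r a := kr r a * Num.sqrt (kr r a).

Lemma kr_ge0 r a : 0 < r -> 0 <= a -> 0 <= kr r a.
Proof. by move=> r0 a0; rewrite invr_ge0 mulr_ge0// addr_ge0// ltW. Qed.

Lemma kr_gt0 r a : 0 < r -> 0 < a -> 0 < kr r a.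
Proof. by move=> r0 a0; rewrite invr_gt0 mulr_gt0// addr_gt0. Qed.

Lemma kr_mono r a b : 0 < r -> 0 < a -> a <= b -> kr r b <= kr r a.
Proof.
move=> r0 a0 ab; have b0 := lt_le_trans a0 ab.
rewrite lef_pV2 ?posrE ?mulr_gt0 ?addr_gt0//; nra.
Qed.

Lemma k32_ge0 r a : 0 <= k32 r a.
Proof.
rewrite /k32; have [h|/ltW h] := leP 0 (kr r a); first by rewrite mulr_ge0// sqrtr_ge0.
by rewrite ler0_sqrtr// mulr0.
Qed.

Lemma k32_mono r a b : 0 < r -> 0 < a -> a <= b -> k32 r b <= k32 r a.
Proof.
move=> r0 a0 ab; have b0 := lt_le_trans a0 ab.
rewrite ler_pM ?sqrtr_ge0 ?kr_ge0 ?(ltW b0)//; first exact: kr_mono.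
by rewrite ler_wsqrtr//; exact: kr_mono.
Qed.

Lemma measurable_kr r : measurable_fun [set: mR] (fun a : mR => kr r a).
Proof.
apply: measurable_funV; apply: measurable_funM => //.
by apply: measurable_funD.
Qed.

Lemma measurable_k32 r : measurable_fun [set: mR] (fun a : mR => k32 r a).
Proof.
apply: measurable_funM; first exact: measurable_kr.
by apply: measurable_funsqrt; exact: measurable_kr.
Qed.

Lemma ib_k32 r : 0 < r -> ib (fun y => k32 r (enorm y)) (16 / r).
Proof.
move=> r0; rewrite (_ : 16 / r = 8 * (2 / r)); last by field; rewrite gt_eqF.
apply: ib_radial; [exact: measurable_k32|exact: k32_ge0| |].
  by move=> a b; exact: k32_mono.
(* An antiderivative of x^(-1/2) (x + r)^(-3/2), which is [x * k32 r x]; it increases from 0 to 2 /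
   r. *)
pose F (x : R) := 2 / r * Num.sqrt (x * (x + r)^-1).
pose f (x : R) := (x + r)^-1 * (Num.sqrt (x * (x + r)))^-1.
have P (x : R) : 0 < x -> 0 < x + r by move=> x0; rewrite addr_gt0.
have fE (x : R) : 0 < x -> x * k32 r x = f x.
  move=> x0; have xr := P x x0; rewrite /k32 /kr /f sqrtrV ?mulr_ge0 ?ltW// mulrA.
  by congr (_ * _); field; rewrite !gt_eqF.
rewrite (eq_integral (fun x : mR => (f x)%:E)); last first.
  by move=> x; rewrite inE/= in_itv/= andbT => x0; rewrite fE.
have df (x : R) : 0 < x -> exists d, is_derive x 1 f d.
  move=> x0; have xr := P x x0; rewrite /f; eexists.
  by dauto; rewrite ?gt_eqF ?sqrtr_gt0 ?mulr_gt0.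
have dF (x : R) : 0 < x -> is_derive x 1 F (f x).
  move=> x0; have xr := P x x0.
  have xr0 : x + r != 0 by rewrite gt_eqF.
  have q0 : 0 < x * (x + r)^-1 by rewrite divr_gt0.
  eapply deq; first by rewrite /F; dauto => //; exact: q0.
  rewrite /f (_ : x * (x + r) = (x + r) ^+ 2 * (x / (x + r))); last by field.
  rewrite [in RHS]sqrtrM ?sqr_ge0// sqrtr_sqr gtr0_norm//.
  have := sqr_sqrtr (ltW q0).
  have : 0 < Num.sqrt (x / (x + r)) by rewrite sqrtr_gt0.
  set q := Num.sqrt _ => {}q0 _.
  by field; rewrite xr0 !gt_eqF.
apply: (integral_oy_le dF).
- by move=> x x0; have [d dd] := df x x0; exact: dcont dd.
- by move=> x x0; rewrite /f mulr_ge0// ?invr_ge0 ?sqrtr_ge0// ltW// P.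
- move=> x y x0 xy; have y0 := lt_trans x0 xy.
  have F0 : 0 <= F x by rewrite /F mulr_ge0 ?sqrtr_ge0// divr_ge0// ltW.
  suff : F y <= 2 / r by lra.
  rewrite /F ler_piMr ?divr_ge0 ?(ltW r0)//.
  rewrite -[leRHS]sqrtr1 ler_wsqrtr// ler_pdivrMr ?P// mul1r lerDl ltW//.
Qed.

Lemma integral_trunc (h f : R -> R) (b C : R) : 0 < b ->
  measurable_fun [set: mR] (h : mR -> R) -> measurable_fun [set: mR] (f : mR -> R) ->
  (forall x : R, 0 <= h x) -> (forall x : R, b < x -> h x = 0) ->
  (forall x : R, 0 < x <= b -> x * h x <= f x) ->
  (\int[mu]_(x in `]0%R, b]) (f x)%:E <= C%:E)%E ->
  (\int[mu]_(x in `]0%R, +oo[) (x * h x)%:E <= C%:E)%E.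
Proof.
move=> b0 mh mf h0 hb hf fC.
have -> : ([set` `]0%R, +oo[] : set mR) = [set` `]0%R, b]] `|` [set` `]b, +oo[].
  apply/seteqP; split => x /=; rewrite !in_itv/= !andbT.
    by move=> x0; rewrite x0; have [?|?] := leP x b; [left|right].
  by case=> [/andP[]//|]; exact: lt_trans.
have mxh : measurable_fun [set: mR] (fun x : mR => (x * h x)%:E).
  by apply/measurable_EFinP; exact: measurable_funM.
have xh0 (x : R) : 0 < x <= b -> 0 <= x * h x by case/andP => x0 _; rewrite mulr_ge0// ltW.
rewrite ge0_integral_setU//=; last 3 first.
- exact: measurable_funS mxh.
- move=> x [|]; rewrite in_itv/= ?andbT; first by move=> ?; rewrite lee_fin xh0.
  by move=> bx; rewrite lee_fin mulr_ge0// ltW// (lt_trans b0).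
- apply/disj_setPS => x [/=]; rewrite !in_itv/= andbT => /andP[_ xb] bx.
  by have := le_lt_trans xb bx; rewrite ltxx.
rewrite [X in (_ + X)%E](_ : _ = 0%E) ?adde0; last first.
  rewrite (eq_integral (fun=> 0%E)) ?integral0// => x.
  by rewrite inE/= in_itv/= andbT => bx; rewrite hb ?mulr0.
apply: le_trans fC.
apply: ge0_le_integral => //.
- exact: measurable_funS mxh.
- by apply/measurable_EFinP; apply: measurable_funTS.
Qed.

Lemma ib_kr r b : 0 < r -> 0 < b ->
  ib (fun y => if enorm y < b then kr r (enorm y) else 0) (8 * ln (1 + b / r)).
Proof.
move=> r0 b0.
have P (x : R) : 0 < x -> 0 < x + r by move=> x0; rewrite addr_gt0.
pose h (a : R) := if a < b then (if 0 <= a then kr r a else 0) else 0.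
have mh : measurable_fun [set: mR] (h : mR -> R).
  apply: measurable_fun_ifT => //; first exact: measurable_fun_ltr.
  by apply: measurable_fun_ifT => //; [exact: measurable_fun_ler|exact: measurable_kr].
have h0 a : 0 <= h a by rewrite /h; case: ifP => // _; case: ifP => // ?; rewrite kr_ge0.
have -> : (fun y => if enorm y < b then kr r (enorm y) else 0) = (fun y => h (enorm y)).
  by apply/funext => y; rewrite /h enorm_ge0.
apply: ib_radial => //.
  move=> a c a0 ac; rewrite /h; have c0 := lt_le_trans a0 ac; rewrite !(ltW a0, ltW c0).
  case: ifP => cb; case: ifP => ab //.
  - exact: kr_mono.
  - by move: ab; rewrite (le_lt_trans ac cb).
  - by rewrite kr_ge0// ltW.
have df (x : R) : 0 < x -> exists d, is_derive x 1 (fun x : R => (x + r)^-1) d.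
  by move=> x0; eexists; dauto; rewrite gt_eqF// P.
have dF (x : R) : 0 < x <= b -> is_derive x 1 (fun x : R => ln (x + r)) (x + r)^-1.
  move=> /andP[x0 _]; eapply deq; first by dauto; exact: P.
  by rewrite addr0 mulr1.
apply: (@integral_trunc h (fun x : R => (x + r)^-1) b) => //.
- by apply: measurable_funV; apply: measurable_funD.
- by move=> x bx; rewrite /h ltNge ltW.
- move=> x /andP[x0 xb]; rewrite /h (ltW x0).
  have xr := P x x0; case: ifP => _; last by rewrite mulr0 invr_ge0 ltW.
  by rewrite /kr le_eqVlt; apply/orP; left; apply/eqP; field; rewrite !gt_eqF.
apply: (integral_oc_le b0 dF).
- by move=> x /andP[x0 _]; have [d dd] := df x x0; exact: dcont dd.
- by move=> x /andP[x0 _]; rewrite invr_ge0 ltW// P.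
- move=> x x0 xb; rewrite (_ : 1 + b / r = (b + r) / r); last by field; rewrite gt_eqF.
  rewrite ln_div ?posrE ?P// lerB// ler_ln ?posrE ?P//.
  by rewrite lerDr ltW.
Qed.

(** The Dini integral of the modulus, convergent because beta > 1. The logarithmic factor increases
    with |y| while |y|^-2 decreases, so they are compared with the sup norm m in opposite
    directions, |y| <= 2 m and |y| >= m; hence the argument 2 x of the logarithm. *)
Lemma ib_dini (beta b : R) : 1 < beta -> 0 < b -> 2 * b < 1 ->
  ib (fun y => if enorm y < b then (ln (enorm y)^-1) `^ (- beta) / enorm y ^+ 2 else 0)
     (8 * ((ln (2 * b)^-1) `^ (1 - beta) / (beta - 1))).
Proof.
move=> beta1 b0 b1.
pose f (x : R) := (ln (2 * x)^-1) `^ (- beta) / x.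
pose F (x : R) := (ln (2 * x)^-1) `^ (1 - beta) / (beta - 1).
pose h (x : R) := if x < b then (if 0 < x then (ln (2 * x)^-1) `^ (- beta) / x ^+ 2 else 0) else 0.
have lpos (x : R) : 0 < x <= b -> 0 < ln (2 * x)^-1.
  move=> /andP[x0 xb]; rewrite ln_gt0// invf_gt1 ?mulr_gt0//; lra.
have mln : measurable_fun [set: mR] (fun x : mR => (ln (2 * x)^-1) `^ (- beta)).
  apply: (measurableT_comp (measurable_powR (- beta))).
  by apply: measurable_funln; apply: measurable_funV; exact: measurable_funM.
have mh : measurable_fun [set: mR] (h : mR -> R).
  apply: measurable_fun_ifT => //; first exact: measurable_fun_ltr.
  apply: measurable_fun_ifT => //; first exact: measurable_fun_ltr.
  by apply: measurable_funM => //; apply: measurable_funV; exact: measurable_funX.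
have h0 (x : R) : 0 <= h x.
  by rewrite /h; case: ifP => // _; case: ifP => // ?; rewrite divr_ge0 ?powR_ge0 ?sqr_ge0.
have mf : measurable_fun [set: mR] (f : mR -> R).
  by apply: measurable_funM => //; exact: measurable_inv.
have dF (x : R) : 0 < x <= b -> is_derive x 1 F (f x).
  move=> xb; have l0 := lpos x xb; case/andP: xb => x0 xb.
  have x20 : 0 < 2 * x by rewrite mulr_gt0.
  eapply deq.
    rewrite /F; dauto; [exact: l0|by rewrite invr_gt0|by rewrite gt_eqF].
  rewrite /f (_ : 1 - beta - 1 = - beta); last by ring.
  have b10 : beta - 1 != 0 by rewrite subr_eq0 gt_eqF.
  have x10 : x != 0 by rewrite gt_eqF.
  by set q := _ `^ _; field; rewrite ?b10 ?x10.
have df (x : R) : 0 < x <= b -> exists d, is_derive x 1 f d.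
  move=> xb; have l0 := lpos x xb; case/andP: xb => x0 xb.
  have x20 : 0 < 2 * x by rewrite mulr_gt0.
  eexists; rewrite /f; dauto; rewrite ?gt_eqF ?invr_gt0//.
have fi : (\int[mu]_(x in `]0%R, b]) (f x)%:E <= (F b)%:E)%E.
  apply: (integral_oc_le b0 dF).
  - by move=> x /df[d dd]; exact: dcont dd.
  - by move=> x /andP[x0 _]; rewrite /f divr_ge0 ?powR_ge0 ?ltW.
  - move=> x x0 xb; have : 0 <= F x; last by lra.
    by rewrite /F divr_ge0 ?powR_ge0// subr_ge0 ltW.
apply: ib_le (ib_sup (h := h) mh h0 _).
- apply: measurable_fun_ifT => //.
    by apply: measurable_fun_ltr => //; exact: measurable_enorm.
  apply: measurable_funM.
    apply: (measurableT_comp (measurable_powR (- beta))).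
    by apply: measurable_funln; apply: measurable_funV; exact: measurable_enorm.
  by apply: measurable_funV; apply: measurable_funX; exact: measurable_enorm.
- by move=> y; case: ifP => // _; rewrite divr_ge0 ?powR_ge0 ?sqr_ge0.
- move=> y; case: ifP => // yb.
  have m0 : 0 <= Num.max `|y.1| `|y.2| by rewrite le_max normr_ge0.
  have my := sup_le_enorm y; have ym := enorm_le_sup y.
  move: m0; rewrite le_eqVlt => /predU1P[m0|m0].
    have -> : enorm y = 0 by apply/eqP; rewrite eq_le enorm_ge0 andbT; rewrite -m0 mulr0 in ym.
    by rewrite expr0n/= invr0 mulr0.
  have y0 := lt_le_trans m0 my.
  rewrite /h m0 (le_lt_trans my yb).
  rewrite ler_pM ?powR_ge0 ?invr_ge0 ?sqr_ge0//; last first.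
    by rewrite lef_pV2 ?posrE ?exprn_gt0// lerXn2r ?nnegrE ?(ltW m0) ?(ltW y0).
  have l0 := lpos (Num.max `|y.1| `|y.2|); have {}l0 : 0 < ln (2 * Num.max `|y.1| `|y.2|)^-1.
    by apply: l0; rewrite m0 (le_trans my) ?ltW.
  rewrite !powRN lef_pV2 ?posrE ?powR_gt0//; last first.
    by rewrite ln_gt0// invf_gt1//; lra.
  rewrite ge0_ler_powR ?nnegrE ?(ltW l0)//; [lra| |].
    by rewrite ln_ge0// invf_ge1//; lra.
  rewrite ler_ln ?posrE ?invr_gt0 ?mulr_gt0// lef_pV2 ?posrE ?mulr_gt0//.
- apply: (integral_trunc b0 mh mf h0 _ _ fi).
  + by move=> x bx; rewrite /h ltNge ltW.
  + move=> x /andP[x0 xb]; rewrite /h x0; case: ifP => _.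
      by rewrite /f le_eqVlt; apply/orP; left; apply/eqP; field; rewrite gt_eqF.
    by rewrite mulr0 /f divr_ge0 ?powR_ge0 ?ltW.
Qed.

Lemma mpres_translate X : mpres (fun y => y - X).
Proof.
have h1 := @mpres_shear1 R (fun=> - X.1) (measurable_cst _).
have h2 := @mpres_shear2 R (fun=> - X.2) (measurable_cst _).
exact: mpres_comp h1 h2.
Qed.

Lemma ib_shift (f : R -> R) C X : ib (fun y => f (enorm y)) C ->
  ib (fun y => f (enorm (X - y))) C.
Proof.
move=> /(ib_mpres (mpres_translate X)); congr ib.
by apply/funext => y /=; rewrite enormB.
Qed.

(** Times |X|, this is the length of K(X - y) - K(-y) for the unnormalized kernel: with complex
    numbers, 1/(z - c) + 1/c = z / (c (z - c)). *)
Definition Pker X y := (enorm y * enorm (X - y))^-1.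

Lemma Pker_ge0 X y : 0 <= Pker X y.
Proof. by rewrite invr_ge0 mulr_ge0 ?enorm_ge0. Qed.

Lemma measurable_sub X : measurable_fun [set: mR2] ((fun y => X - y) : mR2 -> mR2).
Proof.
apply: measurable_fun_pair.
  by apply: measurable_funB => //; exact: measurable_fst2.
by apply: measurable_funB => //; exact: measurable_snd2.
Qed.

Lemma measurable_enorm_sub X : measurable_fun [set: mR2] (fun y : mR2 => enorm (X - y)).
Proof. exact: measurableT_comp (@measurable_enorm R) (measurable_sub X). Qed.

Lemma measurable_Pker X : measurable_fun [set: mR2] (Pker X : mR2 -> R).
Proof.
apply: measurable_funV; apply: measurable_funM; first exact: measurable_enorm.
exact: measurable_enorm_sub.
Qed.

(** Partial fractions, 1/(a b) = 1/(a (a + b)) + 1/(b (a + b)), separate the two singularities; a +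
    b >= |X| by the triangle inequality. *)
Lemma Pker_le X y : X != 0 ->
  Pker X y <= 2 * (kr (enorm X) (enorm y) + kr (enorm X) (enorm (X - y))).
Proof.
move=> X0; rewrite /Pker /kr.
have r0 : 0 < enorm X by rewrite enorm_gt0.
have := enorm_triangle (X - y) y; rewrite subrK.
have := enorm_ge0 y; have := enorm_ge0 (X - y).
set a := enorm y; set b := enorm _; set r := enorm X => b0 a0 tri.
have pos : 0 <= (a * (a + r))^-1 + (b * (b + r))^-1.
  by rewrite addr_ge0// invr_ge0 mulr_ge0// addr_ge0// ltW.
move: a0; rewrite le_eqVlt => /predU1P[a0|a0].
  by rewrite -{1}a0 mul0r invr0 mulr_ge0.
move: b0; rewrite le_eqVlt => /predU1P[b0|b0].
  by rewrite -{1}b0 mulr0 invr0 mulr_ge0.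
have -> : (a * b)^-1 = (a * (a + b))^-1 + (b * (a + b))^-1.
  by field; rewrite !gt_eqF ?addr_gt0.
have l (c : R) : 0 < c -> c <= a + b -> (c * (a + b))^-1 <= 2 * (c * (c + r))^-1.
  move=> c0 cab; have e : 2 * (c * (c + r))^-1 = (c * ((c + r) / 2))^-1.
    by field; rewrite !gt_eqF ?addr_gt0.
  rewrite e lef_pV2 ?posrE ?mulr_gt0 ?addr_gt0 ?invr_gt0//.
  by rewrite ler_pM2l//; lra.
have h1 : a <= a + b by lra.
have h2 : b <= a + b by lra.
by have := l a a0 h1; have := l b b0 h2; lra.
Qed.

Lemma ib_Pker X b : X != 0 -> 0 < b ->
  ib (fun y => if enorm y < b then Pker X y else 0) (32 * ln (2 + b / enorm X)).
Proof.
move=> X0 b0; have r0 : 0 < enorm X by rewrite enorm_gt0.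
have br : 0 < b + enorm X by rewrite addr_gt0.
have i1 := ib_kr r0 b0; have i2 := ib_shift X (f := fun a => if a < _ then kr _ a else 0) (ib_kr r0 br).
have q0 : 0 < b / enorm X by rewrite divr_gt0.
have lnm : ln (1 + b / enorm X) <= ln (2 + b / enorm X).
  by rewrite ler_ln ?posrE; lra.
have le2 : 1 + (b + enorm X) / enorm X = 2 + b / enorm X by field; rewrite gt_eqF.
rewrite le2 in i2.
apply: (ib_weak _ (ib_le _ _ _ (ib_scale (_ : 0 <= 2) (ib_add i1 i2)))) => //.
- by lra.
- apply: measurable_fun_ifT => //; last exact: measurable_Pker.
  by apply: measurable_fun_ltr => //; exact: measurable_enorm.
- by move=> y; case: ifP => // _; exact: Pker_ge0.
- move=> y; case: ifP => yb.
    have -> : enorm (X - y) < b + enorm X.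
      by have := enorm_triangle X (- y); rewrite enormN; lra.
    exact: Pker_le.
  by rewrite add0r mulr_ge0//; case: ifP => // _; rewrite kr_ge0// enorm_ge0.
Qed.

Lemma k32_mix r a b : 0 <= kr r a -> 0 <= kr r b ->
  kr r b * Num.sqrt (kr r a) <= k32 r a + k32 r b.
Proof.
move=> ka kb; have [h|/ltW h] := leP (kr r a) (kr r b).
  by rewrite ler_wpDl ?k32_ge0// /k32 ler_wpM2l// ler_wsqrtr.
by rewrite ler_wpDr ?k32_ge0// /k32 ler_wpM2r// sqrtr_ge0.
Qed.

Lemma ib_k32_pair X : X != 0 ->
  ib (fun y => enorm X * (k32 (enorm X) (enorm y) + k32 (enorm X) (enorm (X - y)))) 32.
Proof.
move=> X0; have r0 : 0 < enorm X by rewrite enorm_gt0.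
have i := ib_add (ib_k32 r0) (ib_shift X (ib_k32 r0)).
have {i} := ib_scale (ltW r0) i.
by rewrite (_ : _ * (_ + _) = 32)//; field; rewrite gt_eqF.
Qed.

(** The extra factor removes the logarithmic divergence: multiplied by |X|, the right side has an
    integral bounded independently of X ([ib_k32_pair]). *)
Lemma Pker_sqrt_le X y : X != 0 ->
  Pker X y * Num.sqrt (kr (enorm X) (enorm y)) <=
  4 * (k32 (enorm X) (enorm y) + k32 (enorm X) (enorm (X - y))).
Proof.
move=> X0; have r0 : 0 < enorm X by rewrite enorm_gt0.
have ka := kr_ge0 r0 (enorm_ge0 y); have kb := kr_ge0 r0 (enorm_ge0 (X - y)).
apply: (@le_trans _ _ (2 * (kr (enorm X) (enorm y) + kr (enorm X) (enorm (X - y))) *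
   Num.sqrt (kr (enorm X) (enorm y)))).
  by rewrite ler_wpM2r ?sqrtr_ge0//; exact: Pker_le.
have := k32_mix ka kb; have := k32_ge0 (enorm X) (enorm y).
have := k32_ge0 (enorm X) (enorm (X - y)).
have : kr (enorm X) (enorm y) * Num.sqrt (kr (enorm X) (enorm y)) =
  k32 (enorm X) (enorm y) by [].
set A := k32 _ _; set B := k32 _ _; set u := kr _ _; set v := kr _ _; set s := Num.sqrt _.
by move=> e B0 A0 m; rewrite mulrDr mulrDl -!mulrA e; lra.
Qed.

Lemma Pker_32_le X y : X != 0 ->
  Pker X y * Num.sqrt (Pker X y) <=
  8 * (k32 (enorm X) (enorm y) + k32 (enorm X) (enorm (X - y))).
Proof.
move=> X0; have r0 : 0 < enorm X by rewrite enorm_gt0.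
have := Pker_le y X0.
set ka := kr _ (enorm y); set kb := kr _ (enorm (X - y)) => Pk.
have ka0 : 0 <= ka := kr_ge0 r0 (enorm_ge0 y).
have kb0 : 0 <= kb := kr_ge0 r0 (enorm_ge0 (X - y)).
have H (k : R) : 0 <= k -> Pker X y <= 4 * k ->
    Pker X y * Num.sqrt (Pker X y) <= 8 * (k * Num.sqrt k).
  move=> k0 Pk4; apply: (@le_trans _ _ (4 * k * Num.sqrt (4 * k))).
    by rewrite ler_pM ?sqrtr_ge0 ?Pker_ge0// ler_wsqrtr.
  rewrite sqrtrM// (_ : 4 = 2 ^+ 2); last by rewrite -natrX.
  rewrite sqrtr_sqr gtr0_norm// -subr_ge0 (_ : _ - _ = 0)//; ring.
have := k32_ge0 (enorm X) (enorm y); have := k32_ge0 (enorm X) (enorm (X - y)).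
rewrite /k32 -/ka -/kb => h1 h2.
have [kk|/ltW kk] := leP ka kb.
  by have := H kb kb0; move=> /(_ ltac:(lra)); lra.
by have := H ka ka0; move=> /(_ ltac:(lra)); lra.
Qed.

End Radial.

(** * The Biot-Savart kernel *)

Section Kernel.
Variable R : realType.
Local Notation mR := (measurableTypeR R).
Local Notation mR2 := (mR * mR)%type.
Local Notation mu := (@lebesgue_measure R).
Local Notation mu2 := (@leb2 R).
Implicit Types (y z X : R * R) (r a b : R).

Lemma ib_norm (f : R * R -> R) C : measurable_fun [set: mR2] (f : mR2 -> R) ->
  ib (fun y => `|f y|) C ->
  mu2.-integrable setT (EFin \o f) /\ `|\int[mu2]_y f y| <= C.
Proof. by move=> mf; apply: ib_Rint => //; apply: aeW => y; exact: lexx. Qed.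

Definition Kbs z : R * R := (enorm z ^+ 2)^-1 *: perp z.

Lemma Kbs1 z : (Kbs z).1 = - (z.2 / enorm z ^+ 2).
Proof. by rewrite /Kbs /= /GRing.scale/= mulrN mulrC. Qed.

Lemma Kbs2 z : (Kbs z).2 = z.1 / enorm z ^+ 2.
Proof. by rewrite /Kbs /= /GRing.scale/= mulrC. Qed.

Definition Jker X y : R :=
  X.1 * ((Kbs (X - y)).1 - (Kbs (- y)).1) + X.2 * ((Kbs (X - y)).2 - (Kbs (- y)).2).

Lemma JkerE X y : Jker X y =
  (X.1 * y.2 - X.2 * y.1) * ((enorm (X - y) ^+ 2)^-1 - (enorm y ^+ 2)^-1).
Proof. by rewrite /Jker !Kbs1 !Kbs2 enormN /=; ring. Qed.

Lemma cross_le X y : `|X.1 * y.2 - X.2 * y.1| <= enorm X * enorm y.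
Proof.
rewrite -(ler_pXn2r (n := 2)) ?nnegrE ?mulr_ge0 ?enorm_ge0//.
rewrite real_normK ?num_real// exprMn !enorm_sq.
by have := sqr_ge0 (X.1 * y.1 + X.2 * y.2); nra.
Qed.

(** Holds at y = 0 and y = X too, where the cross product vanishes and the right side is 0 by the
    convention for inverses. The cross product of X with y equals that with y - X, so it is at most
    |X| times the smaller of |y| and |X - y|. *)
Lemma Jker_le X y : `|Jker X y| <= 2 * enorm X ^+ 2 * Pker X y.
Proof.
have c1 := cross_le X y; have c2 := cross_le X (y - X).
have e : X.1 * (y - X).2 - X.2 * (y - X).1 = X.1 * y.2 - X.2 * y.1 by rewrite /=; ring.
rewrite e enormB in c2 => {e}.
have t2 := enorm_triangle X (- y); rewrite enormN in t2.
have t3 := enorm_triangle (X - y) y; rewrite subrK in t3.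
have := enorm_triangle (y - X) X; rewrite subrK enormB => t4.
rewrite JkerE /Pker normrM.
move: c1 c2 t2 t3 t4 (enorm_ge0 X) (enorm_ge0 y) (enorm_ge0 (X - y)).
set c := `|_ - _|; set r := enorm X; set a := enorm y; set b := enorm _.
move=> c1 c2 t2 t3 t4 r0 a0 b0.
have c0 : 0 <= c by exact: normr_ge0.
have rhs0 : 0 <= 2 * r ^+ 2 / (a * b).
  by rewrite divr_ge0 ?mulr_ge0// sqr_ge0.
move: a0; rewrite le_eqVlt => /predU1P[a0|a0].
  rewrite (_ : c = 0) ?mul0r//; apply/eqP; rewrite eq_le c0 andbT.
  by rewrite (le_trans c1)// -a0 mulr0.
move: b0; rewrite le_eqVlt => /predU1P[b0|b0].
  rewrite (_ : c = 0) ?mul0r//; apply/eqP; rewrite eq_le c0 andbT.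
  by rewrite (le_trans c2)// -b0 mulr0.
have -> : (b ^+ 2)^-1 - (a ^+ 2)^-1 = (a - b) * (a + b) / (a ^+ 2 * b ^+ 2).
  by field; rewrite !gt_eqF.
rewrite normrM normfV [`|a ^+ 2 * _|]gtr0_norm ?mulr_gt0 ?exprn_gt0// normrM.
rewrite [`|a + b|]gtr0_norm ?addr_gt0// mulrA ler_pdivrMr ?mulr_gt0 ?exprn_gt0//.
have -> : 2 * r ^+ 2 / (a * b) * (a ^+ 2 * b ^+ 2) = 2 * r ^+ 2 * (a * b).
  by field; rewrite !gt_eqF.
have ab : `|a - b| <= r by rewrite ler_norml; apply/andP; split; lra.
have cab : c * (a + b) <= 2 * r * (a * b).
  have [h|/ltW h] := leP a b.
    by apply: (@le_trans _ _ (r * a * (2 * b))); [rewrite ler_pM//; lra|nra].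
  by apply: (@le_trans _ _ (r * b * (2 * a))); [rewrite ler_pM//; lra|nra].
rewrite mulrC mulrAC -mulrA mulrC.
rewrite [leRHS](_ : _ = (2 * r * (a * b)) * r); last by ring.
rewrite (_ : _ * _ = c * (a + b) * `|a - b|); last by ring.
by rewrite ler_pM// mulr_ge0// addr_ge0// ltW.
Qed.

Lemma measurable_Kbs1 : measurable_fun [set: mR2] (fun z : mR2 => (Kbs z).1).
Proof.
under eq_fun do rewrite Kbs1.
apply: measurable_funN; apply: measurable_funM; first exact: measurable_snd2.
by apply: measurable_funV; apply: measurable_funX; exact: measurable_enorm.
Qed.

Lemma measurable_Kbs2 : measurable_fun [set: mR2] (fun z : mR2 => (Kbs z).2).
Proof.
under eq_fun do rewrite Kbs2.
apply: measurable_funM; first exact: measurable_fst2.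
by apply: measurable_funV; apply: measurable_funX; exact: measurable_enorm.
Qed.

Lemma Kbs_le z : `|(Kbs z).1| <= (enorm z)^-1 /\ `|(Kbs z).2| <= (enorm z)^-1.
Proof.
have := enorm_ge0 z; rewrite le_eqVlt => /predU1P[z0|z0].
  by rewrite Kbs1 Kbs2 -z0 expr0n/= invr0 !mulr0 oppr0 !normr0.
have H (c : R) : `|c| <= enorm z -> `|c / enorm z ^+ 2| <= (enorm z)^-1.
  move=> h; rewrite normrM normfV [`|_ ^+ 2|]gtr0_norm ?exprn_gt0//.
  by rewrite ler_pdivrMr ?exprn_gt0// expr2 mulrA mulVf ?gt_eqF// mul1r.
have := sup_le_enorm z; rewrite ge_max => /andP[h1 h2].
by rewrite Kbs1 Kbs2 normrN; split; exact: H.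
Qed.

Lemma mpres_eq (S T : R * R -> R * R) : S =1 T -> mpres S -> mpres T.
Proof. by move=> /funext ->. Qed.

Lemma mpres_S1 (k : R) : mpres (fun z => (z.1 + k * z.2, z.2)).
Proof. by apply: (@mpres_shear1 R (fun t => k * t)); exact: mulrl_measurable. Qed.

Lemma mpres_S2 (k : R) : mpres (fun z => (z.1, z.2 + k * z.1)).
Proof. by apply: (@mpres_shear2 R (fun t => k * t)); exact: mulrl_measurable. Qed.

Definition qrot z : R * R := (- z.2, z.1).

Lemma mpres_qrot : mpres qrot.
Proof.
apply: mpres_eq (mpres_comp (mpres_S1 (-1)) (mpres_comp (mpres_S2 1) (mpres_S1 (-1)))).
by move=> z; rewrite /qrot /=; congr pair; ring.
Qed.

(** A flip followed by a rotation, the rotation being a product of three shears when q is nonzero.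
    For q = 0 the map is the flip or its conjugate by a quarter turn. *)
Lemma mpres_reflection (p q : R) : p ^+ 2 + q ^+ 2 = 1 ->
  mpres (fun z => (p * z.1 + q * z.2, q * z.1 - p * z.2)).
Proof.
move=> pq; have [q0|q0] := eqVneq q 0.
  have /eqP : p ^+ 2 = 1 by rewrite -pq q0 expr0n addr0.
  rewrite sqrf_eq1 => /orP[] /eqP ->; rewrite q0.
    by apply: mpres_eq (@mpres_flip R) => z; congr pair; rewrite /=; ring.
  have rr := mpres_comp mpres_qrot mpres_qrot.
  apply: mpres_eq (mpres_comp mpres_qrot (mpres_comp (@mpres_flip R) (mpres_comp mpres_qrot rr))).
  by move=> z; rewrite /qrot /=; congr pair; ring.
have h := mpres_comp (mpres_S1 ((p - 1) / q)) (mpres_comp (mpres_S2 q)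
  (mpres_comp (mpres_S1 ((p - 1) / q)) (@mpres_flip R))).
apply: mpres_eq h => z /=.
have e : q ^+ 2 = 1 - p ^+ 2 by rewrite -pq; ring.
congr pair; last by field.
apply: (mulfI q0).
rewrite (_ : q * (p * z.1 + q * z.2) = q * p * z.1 + q ^+ 2 * z.2); last by ring.
by rewrite e; field.
Qed.

Lemma measurable_Jker X : measurable_fun [set: mR2] (Jker X : mR2 -> R).
Proof.
rewrite (_ : Jker X = fun y => (X.1 * y.2 - X.2 * y.1) *
  ((enorm (X - y) ^+ 2)^-1 - (enorm y ^+ 2)^-1)); last by apply/funext => y; exact: JkerE.
apply: measurable_funM.
  by apply: measurable_funB; apply: measurable_funM.
by apply: measurable_funB; apply: measurable_funV; apply: measurable_funX;
  [exact: measurable_enorm_sub|exact: measurable_enorm].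
Qed.

(** The reflection in the line through X preserves |y| and |X - y| but reverses the sign of the
    cross product in [JkerE], so the integral equals its opposite. *)
Lemma Jker_radial X (F : R -> R) C : X != 0 ->
  measurable_fun [set: mR] (F : mR -> R) ->
  ib (fun y => `|Jker X y * F (enorm y)|) C ->
  \int[mu2]_y (Jker X y * F (enorm y)) = 0.
Proof.
move=> X0 mF iF; have r0 : 0 < enorm X by rewrite enorm_gt0.
have r2 : enorm X ^+ 2 != 0 by rewrite gt_eqF ?exprn_gt0.
(* Cosine and sine of twice the angle of X, so that the reflection fixes X. *)
pose p := (X.1 ^+ 2 - X.2 ^+ 2) / enorm X ^+ 2.
pose q := 2 * X.1 * X.2 / enorm X ^+ 2.
have pq : p ^+ 2 + q ^+ 2 = 1.
  rewrite (_ : p ^+ 2 + q ^+ 2 = (X.1 ^+ 2 + X.2 ^+ 2) ^+ 2 / (enorm X ^+ 2) ^+ 2).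
    by rewrite -enorm_sq divff// expf_neq0.
  by rewrite /p /q; field; rewrite gt_eqF.
have pT := mpres_reflection pq.
set T := (fun z => _) in pT.
have TX : X.1 = p * X.1 + q * X.2 /\ X.2 = q * X.1 - p * X.2.
  move: r2; rewrite /p /q enorm_sq => r2.
  by split; field.
have eT y : enorm (T y) = enorm y.
  rewrite /enorm /T /=; congr Num.sqrt.
  rewrite (_ : _ + _ = (p ^+ 2 + q ^+ 2) * (y.1 ^+ 2 + y.2 ^+ 2)); last by ring.
  by rewrite pq mul1r.
have eXT y : enorm (X - T y) = enorm (X - y).
  rewrite -(eT (X - y)); congr enorm; rewrite [LHS]surjective_pairing /T /=.
  by congr pair; [have := TX.1|have := TX.2]; lra.
have cT y : X.1 * (T y).2 - X.2 * (T y).1 = - (X.1 * y.2 - X.2 * y.1).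
  transitivity (X.1 * (T y).2 - X.2 * (T y).1 : R); first by [].
  rewrite [X in X * _ - _]TX.1 [X in _ - X * _]TX.2 /T /=.
  rewrite (_ : _ - _ = - ((p ^+ 2 + q ^+ 2) * (X.1 * y.2 - X.2 * y.1))); last by ring.
  by rewrite pq mul1r.
have mJ : measurable_fun [set: mR2] ((fun y => Jker X y * F (enorm y)) : mR2 -> R).
  apply: measurable_funM; first exact: measurable_Jker.
  exact: measurableT_comp mF (@measurable_enorm R).
have [iJ _] := ib_norm mJ iF.
have h := mpres_Rint pT mJ.
have {h} : \int[mu2]_y ((-1) * (Jker X y * F (enorm y))) =
           \int[mu2]_y (Jker X y * F (enorm y)).
  rewrite -[RHS]h; apply: eq_Rintegral => y _.
  by rewrite eT !JkerE eXT eT cT; ring.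
by rewrite RintegralZl// mulN1r; lra.
Qed.

(** Young's inequality with exponents 3 and 3/2, up to constants, by comparing k f with the square
    root of q. *)
Lemma young32 (f q k : R) : 0 <= f -> 0 <= q -> 0 < k ->
  f * q <= k ^+ 2 * f ^+ 3 + k^-1 * (q * Num.sqrt q).
Proof.
move=> f0 q0 k0; have s0 := sqrtr_ge0 q; have := sqr_sqrtr q0.
set s := Num.sqrt q in s0 *; move=> e; rewrite -{1 2}e.
have k1 : 0 < k^-1 by rewrite invr_gt0.
have kk : k * k^-1 = 1 by rewrite mulfV// gt_eqF.
have [h|/ltW h] := leP (k * f) s.
  have -> : f * s ^+ 2 = k^-1 * (s ^+ 2 * (k * f)).
    by field; rewrite gt_eqF.
  rewrite ler_wpDl ?mulr_ge0 ?exprn_ge0 ?(ltW k0)//.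
  by rewrite ler_pM2l// ler_wpM2l// sqr_ge0.
rewrite ler_wpDr//; first by rewrite mulr_ge0 ?(ltW k1)// mulr_ge0// sqr_ge0.
have : s ^+ 2 <= (k * f) ^+ 2 by rewrite lerXn2r ?nnegrE// mulr_ge0// ltW.
move=> h2; rewrite (_ : k ^+ 2 * f ^+ 3 = f * (k * f) ^+ 2); last by ring.
by rewrite ler_wpM2l.
Qed.

(** The kernel 1/a is locally in L^(3/2) and bounded far away, so L^3 and L^1 bounds on the
    vorticity suffice for a bounded velocity. *)
Lemma inv_le_k32 a f : 0 <= a -> 0 <= f -> a^-1 * f <= f + f ^+ 3 + 4 * k32 1 a.
Proof.
move=> a0 f0; have k0 := k32_ge0 1 a; have f3 : 0 <= f ^+ 3 by rewrite exprn_ge0.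
move: a0; rewrite le_eqVlt => /predU1P[a0|a0]; first by rewrite -a0 in k0 *; rewrite invr0 mul0r; lra.
have [h|h] := leP 1 a.
  have : a^-1 * f <= f by rewrite ler_piMl// invf_le1.
  by lra.
have ai0 : 0 <= a^-1 by rewrite invr_ge0 ltW.
have := young32 f0 ai0 (ltr01 : 0 < 1 :> R); rewrite expr1n mul1r invr1 mul1r mulrC.
have : a^-1 * Num.sqrt a^-1 <= 4 * k32 1 a; last by lra.
have kr0 : 0 <= kr 1 a by rewrite kr_ge0// ltW.
have ak : a^-1 <= 2 * kr 1 a.
  rewrite /kr; have -> : 2 * (a * (a + 1))^-1 = (a * ((a + 1) / 2))^-1.
    by field; rewrite !gt_eqF//; lra.
  rewrite lef_pV2 ?posrE ?mulr_gt0//; last by lra.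
  by rewrite ler_piMr ?ltW//; lra.
apply: (@le_trans _ _ (2 * kr 1 a * Num.sqrt (2 ^+ 2 * kr 1 a))).
  by rewrite ler_pM ?sqrtr_ge0// ler_wsqrtr// (le_trans ak)// ler_wpM2r// expr2; lra.
rewrite sqrtrM ?sqr_ge0// sqrtr_sqr gtr0_norm// /k32.
by rewrite le_eqVlt; apply/orP; left; apply/eqP; ring.
Qed.

End Kernel.

(** * Cancellation of the kernel over quarter turns *)

Section FourFold.
Variable R : realType.
Local Notation mR := (measurableTypeR R).
Local Notation mR2 := (mR * mR)%type.
Local Notation mu := (@lebesgue_measure R).
Local Notation mu2 := (@leb2 R).
Implicit Types (y z X : R * R) (r a b : R).

(* With z = x1 + i x2 and c = y1 + i y2 this is the identity
   sum_k 1 / (z - i^k c) = 4 z^3 / (z^4 - c^4). *)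
Lemma four_sum (x1 x2 y1 y2 : R) :
  let D0 := (x1 - y1) ^+ 2 + (x2 - y2) ^+ 2 in
  let D1 := (x1 + y2) ^+ 2 + (x2 - y1) ^+ 2 in
  let D2 := (x1 + y1) ^+ 2 + (x2 + y2) ^+ 2 in
  let D3 := (x1 - y2) ^+ 2 + (x2 + y1) ^+ 2 in
  D0 != 0 -> D1 != 0 -> D2 != 0 -> D3 != 0 ->
  ((x1 - y1) / D0 + (x1 + y2) / D1 + (x1 + y1) / D2 + (x1 - y2) / D3) ^+ 2 +
  ((x2 - y2) / D0 + (x2 - y1) / D1 + (x2 + y2) / D2 + (x2 + y1) / D3) ^+ 2 =
  16 * (x1 ^+ 2 + x2 ^+ 2) ^+ 3 / (D0 * D1 * D2 * D3).
Proof.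
move=> D0 D1 D2 D3 h0 h1 h2 h3.
pose a3 := x1 ^+ 3 - 3 * x1 * x2 ^+ 2; pose b3 := 3 * x1 ^+ 2 * x2 - x2 ^+ 3.
pose A := x1 ^+ 4 - 6 * x1 ^+ 2 * x2 ^+ 2 + x2 ^+ 4 -
         (y1 ^+ 4 - 6 * y1 ^+ 2 * y2 ^+ 2 + y2 ^+ 4).
pose B := 4 * x1 ^+ 3 * x2 - 4 * x1 * x2 ^+ 3 - (4 * y1 ^+ 3 * y2 - 4 * y1 * y2 ^+ 3).
have E : D0 * D1 * D2 * D3 = A ^+ 2 + B ^+ 2 by rewrite /D0 /D1 /D2 /D3 /A /B; ring.
have e1 : (x1 - y1) / D0 + (x1 + y2) / D1 + (x1 + y1) / D2 + (x1 - y2) / D3 =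
    4 * (a3 * A + b3 * B) / (D0 * D1 * D2 * D3).
  have n : (x1 - y1) * (D1 * D2 * D3) + (x1 + y2) * (D0 * D2 * D3) +
    (x1 + y1) * (D0 * D1 * D3) + (x1 - y2) * (D0 * D1 * D2) = 4 * (a3 * A + b3 * B).
    by rewrite /D0 /D1 /D2 /D3 /A /B /a3 /b3; ring.
  by rewrite -n; clearbody D0 D1 D2 D3; field; rewrite ?h0 ?h1 ?h2 ?h3.
have e2 : (x2 - y2) / D0 + (x2 - y1) / D1 + (x2 + y2) / D2 + (x2 + y1) / D3 =
    4 * (a3 * B - b3 * A) / (D0 * D1 * D2 * D3).
  have n : (x2 - y2) * (D1 * D2 * D3) + (x2 - y1) * (D0 * D2 * D3) +
    (x2 + y2) * (D0 * D1 * D3) + (x2 + y1) * (D0 * D1 * D2) = 4 * (a3 * B - b3 * A).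
    by rewrite /D0 /D1 /D2 /D3 /A /B /a3 /b3; ring.
  by rewrite -n; clearbody D0 D1 D2 D3; field; rewrite ?h0 ?h1 ?h2 ?h3.
rewrite e1 e2.
have r6 : (x1 ^+ 2 + x2 ^+ 2) ^+ 3 = a3 ^+ 2 + b3 ^+ 2 by rewrite /a3 /b3; ring.
have E0 : D0 * D1 * D2 * D3 != 0 by rewrite !mulf_neq0.
rewrite r6; move: E0 E; set P := D0 * D1 * D2 * D3 => P0 E.
rewrite (_ : 16 * _ / P = 16 * (a3 ^+ 2 + b3 ^+ 2) * P / P ^+ 2); last by field.
by rewrite {3}E; field.
Qed.

(** When |y| >= 2 |X|, each of the four rotated points stays at distance at least |y|/2 from X,
    which bounds the denominators in [four_sum] from below. *)
Lemma four_sum_le (x1 x2 y1 y2 r a : R) :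
  x1 ^+ 2 + x2 ^+ 2 = r ^+ 2 -> y1 ^+ 2 + y2 ^+ 2 = a ^+ 2 -> 0 < r -> 2 * r <= a ->
  let D0 := (x1 - y1) ^+ 2 + (x2 - y2) ^+ 2 in
  let D1 := (x1 + y2) ^+ 2 + (x2 - y1) ^+ 2 in
  let D2 := (x1 + y1) ^+ 2 + (x2 + y2) ^+ 2 in
  let D3 := (x1 - y2) ^+ 2 + (x2 + y1) ^+ 2 in
  `|(x1 - y1) / D0 + (x1 + y2) / D1 + (x1 + y1) / D2 + (x1 - y2) / D3| <=
    64 * r ^+ 3 / a ^+ 4 /\
  `|(x2 - y2) / D0 + (x2 - y1) / D1 + (x2 + y2) / D2 + (x2 + y1) / D3| <=
    64 * r ^+ 3 / a ^+ 4.
Proof.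
move=> hr ha r0 ra D0 D1 D2 D3.
have a0 : 0 < a by lra.
have cs (u1 u2 v1 v2 s b : R) : 0 <= s -> 0 <= b -> u1 ^+ 2 + u2 ^+ 2 = s ^+ 2 ->
   v1 ^+ 2 + v2 ^+ 2 = b ^+ 2 -> `|u1 * v1 + u2 * v2| <= s * b.
  move=> s0 b0 hu hv; rewrite -(ler_pXn2r (n := 2)) ?nnegrE ?mulr_ge0//.
  rewrite real_normK ?num_real// exprMn -hu -hv.
  by have := sqr_ge0 (u1 * v2 - u2 * v1); nra.
have D (v1 v2 : R) : v1 ^+ 2 + v2 ^+ 2 = a ^+ 2 ->
    a ^+ 2 / 4 <= (x1 - v1) ^+ 2 + (x2 - v2) ^+ 2.
  move=> hv; have := cs x1 x2 v1 v2 r a (ltW r0) (ltW a0) hr hv.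
  by rewrite ler_norml => /andP[_ h]; nra.
have d0 : a ^+ 2 / 4 <= D0 by apply: D.
have d1 : a ^+ 2 / 4 <= D1.
  by have := D (- y2) y1; rewrite opprK; apply; rewrite -ha; ring.
have d2 : a ^+ 2 / 4 <= D2.
  by have := D (- y1) (- y2); rewrite !opprK; apply; rewrite -ha; ring.
have d3 : a ^+ 2 / 4 <= D3.
  by have := D y2 (- y1); rewrite opprK; apply; rewrite -ha; ring.
have q0 : 0 < a ^+ 2 / 4 by rewrite divr_gt0// exprn_gt0.
have P (d : R) : a ^+ 2 / 4 <= d -> d != 0 by move=> h; rewrite gt_eqF//; lra.
have := @four_sum x1 x2 y1 y2 (P _ d0) (P _ d1) (P _ d2) (P _ d3).
rewrite -/D0 -/D1 -/D2 -/D3 hr.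
set S1 := _ + _ / D3; set S2 := _ + _ / D3 => S12.
have le : 16 * (r ^+ 2) ^+ 3 / (D0 * D1 * D2 * D3) <= (64 * r ^+ 3 / a ^+ 4) ^+ 2.
  rewrite (_ : (64 * r ^+ 3 / a ^+ 4) ^+ 2 =
      16 * (r ^+ 2) ^+ 3 / ((a ^+ 2 / 4) * (a ^+ 2 / 4) * (a ^+ 2 / 4) * (a ^+ 2 / 4))); last first.
    by field; rewrite gt_eqF.
  rewrite ler_wpM2l ?mulr_ge0 ?exprn_ge0 ?(ltW r0)//.
  have dp (d : R) : a ^+ 2 / 4 <= d -> 0 < d by lra.
  move: d0 d1 d2 d3 q0 dp; set q := a ^+ 2 / 4 => d0 d1 d2 d3 q0 dp.
  clearbody q; have q0' := ltW q0.
  have h1 : q * q <= D0 * D1 by apply: ler_pM.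
  have h2 : q * q * q <= D0 * D1 * D2 by apply: ler_pM => //; rewrite mulr_ge0.
  have h3 : q * q * q * q <= D0 * D1 * D2 * D3.
    by apply: ler_pM => //; rewrite !mulr_ge0.
  have p1 : 0 < q * q * q * q by rewrite !mulr_gt0//.
  by rewrite lef_pV2 ?posrE// (lt_le_trans p1).
have rhs0 : 0 <= 64 * r ^+ 3 / a ^+ 4 by rewrite divr_ge0 ?mulr_ge0 ?exprn_ge0// ltW.
by split; rewrite -(ler_pXn2r (n := 2)) ?nnegrE// real_normK ?num_real//;
  apply: le_trans le; rewrite -S12; [rewrite lerDl|rewrite lerDr]; exact: sqr_ge0.
Qed.

End FourFold.

Arguments Kbs : simpl never.

(** * Velocity differences *)

Section BiotSavart.
Variable R : realType.
Local Notation mR := (measurableTypeR R).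
Local Notation mR2 := (mR * mR)%type.
Local Notation mu := (@lebesgue_measure R).
Local Notation mu2 := (@leb2 R).
Implicit Types (y z X : R * R) (r a b : R).

(** The hypotheses under which [inv_le_k32] makes the Biot-Savart integral absolutely convergent;
    [N3] bounds the integral of the cube, not the L^3 norm. *)
Definition L13 (f : R * R -> R) (N1 N3 : R) :=
  [/\ measurable_fun [set: mR2] (f : mR2 -> R), ib (fun y => `|f y|) N1 &
      ib (fun y => `|f y| ^+ 3) N3].

Lemma ae_neq (p : R * R) : {ae mu2, forall y, y <> p}.
Proof.
have mp (c : R) : measurable ([set c] : set mR) by exact: measurable_set1.
exists ([set p.1] `*` [set p.2]); split.
- exact: measurableX.
- have := @product_measure1E _ _ mR mR R mu mu [set p.1] [set p.2] (mp _) (mp _).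
  by move=> e; rewrite [LHS]e [X in (X * _)%E](lebesgue_measure_set1 p.1) mul0e.
- by move=> y /= /contrapT ->.
Qed.

Lemma BS_ib f N1 N3 X (i : bool) : L13 f N1 N3 ->
  let K := fun z => if i then (Kbs z).1 else (Kbs z).2 in
  measurable_fun [set: mR2] ((fun y => K (X - y) * f y) : mR2 -> R) /\
  ib (fun y => `|K (X - y) * f y|) (N1 + N3 + 64).
Proof.
move=> [mf f1 f3] K.
have mK : measurable_fun [set: mR2] (K : mR2 -> R).
  by rewrite /K; case: i {K}; [exact: measurable_Kbs1|exact: measurable_Kbs2].
have mKX : measurable_fun [set: mR2] ((fun y => K (X - y) * f y) : mR2 -> R).
  apply: measurable_funM => //.
  exact: measurableT_comp mK (@measurable_sub R X).
split => //.
have i4 := ib_scale (ler0n R 4) (ib_shift X (ib_k32 (ltr01 : 0 < 1 :> R))).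
have := ib_add (ib_add f1 f3) i4; rewrite (_ : 4 * (16 / 1) = 64); last by field.
apply: ib_le.
- by apply: measurableT_comp => //; exact: normr_measurable.
- by move=> y; exact: normr_ge0.
- move=> y; rewrite normrM; apply: le_trans (inv_le_k32 (enorm_ge0 _) (normr_ge0 _)).
  by rewrite ler_wpM2r// /K; have [h1 h2] := Kbs_le (X - y); case: i {K mK mKX}.
Qed.

Lemma BS_int f N1 N3 X (i : bool) : L13 f N1 N3 ->
  let K := fun z => if i then (Kbs z).1 else (Kbs z).2 in
  mu2.-integrable setT (EFin \o (fun y => K (X - y) * f y)) /\
  `|\int[mu2]_y (K (X - y) * f y)| <= N1 + N3 + 64.
Proof. by move=> /BS_ib h K; have [mK iK] := h X i; exact: ib_norm iK. Qed.

Lemma sub_shift (p X y : R * R) : p + X - (y + p) = X - y.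
Proof. by congr pair; rewrite /=; ring. Qed.

Lemma mpres_add (p : R * R) : mpres (fun y => y + p).
Proof.
by apply: mpres_eq (mpres_translate (- p)) => y; rewrite opprK.
Qed.

Lemma BS_shift f N1 N3 p X (i : bool) : L13 f N1 N3 ->
  let K := fun z => if i then (Kbs z).1 else (Kbs z).2 in
  \int[mu2]_y (K (p + X - y) * f y) = \int[mu2]_y (K (X - y) * f (y + p)).
Proof.
move=> /BS_ib h K; have [mK _] := h (p + X) i.
rewrite -(mpres_Rint (mpres_add p) mK).
by apply: eq_Rintegral => y _; rewrite sub_shift.
Qed.

Lemma L13_shift f N1 N3 p : L13 f N1 N3 -> L13 (fun y => f (y + p)) N1 N3.
Proof.
move=> [mf f1 f3]; split.
- by apply: measurableT_comp mf _; have [] := mpres_add p.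
- exact: ib_mpres (mpres_add p) f1.
- exact: ib_mpres (mpres_add p) f3.
Qed.

Lemma biot_savart1 f X : (biot_savart f X).1 = (2 * pi)^-1 * \int[mu2]_y ((Kbs (X - y)).1 * f y).
Proof. by []. Qed.

Lemma biot_savart2 f X : (biot_savart f X).2 = (2 * pi)^-1 * \int[mu2]_y ((Kbs (X - y)).2 * f y).
Proof. by []. Qed.

Lemma pi2_inv : 0 < (2 * pi)^-1 :> R /\ (2 * pi)^-1 <= 1 :> R.
Proof.
have p2 := @pi_ge2 R; split; first by rewrite invr_gt0; lra.
by rewrite invf_le1; lra.
Qed.

Lemma BS_bound f N1 N3 X : L13 f N1 N3 ->
  `|(biot_savart f X).1| <= N1 + N3 + 64 /\ `|(biot_savart f X).2| <= N1 + N3 + 64.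
Proof.
move=> Lf; have [c0 c1] := pi2_inv.
have [_ b1] := BS_int X true Lf; have [_ b2] := BS_int X false Lf.
rewrite biot_savart1 biot_savart2 !normrM !(gtr0_norm c0).
by split; [apply: le_trans b1|apply: le_trans b2]; rewrite ler_piMl.
Qed.

(** The boolean selects the component, so that one proof serves both. *)
Definition DK (i : bool) X y : R :=
  let K := fun z => if i then (Kbs z).1 else (Kbs z).2 in K (X - y) - K (- y).

Lemma DK_ib f N1 N3 X i : L13 f N1 N3 ->
  measurable_fun [set: mR2] ((fun y => DK i X y * f y) : mR2 -> R) /\
  mu2.-integrable setT (EFin \o (fun y => DK i X y * f y)).
Proof.
move=> Lf; have [m1 i1] := BS_ib X i Lf; have [m2 i2] := BS_ib 0 i Lf.
have m : measurable_fun [set: mR2] ((fun y => DK i X y * f y) : mR2 -> R).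
  have := measurable_funB m1 m2; apply: eq_measurable_fun => y _ /=.
  by rewrite /DK/= !sub0r mulrBl.
split => //.
have ii := ib_add i1 i2.
apply: (ib_Rint m _ ii).1; apply: aeW => y.
by rewrite /DK !sub0r mulrBl (le_trans (ler_normB _ _)).
Qed.

Lemma Du_DK f N1 N3 p X : L13 f N1 N3 ->
  (biot_savart f (p + X)).1 - (biot_savart f p).1 =
    (2 * pi)^-1 * \int[mu2]_y (DK true X y * f (y + p)) /\
  (biot_savart f (p + X)).2 - (biot_savart f p).2 =
    (2 * pi)^-1 * \int[mu2]_y (DK false X y * f (y + p)).
Proof.
move=> Lf; have Lp := L13_shift p Lf.
have H i : let K := fun z => if i then (Kbs z).1 else (Kbs z).2 in
   \int[mu2]_y (K (p + X - y) * f y) - \int[mu2]_y (K (p - y) * f y) =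
   \int[mu2]_y (DK i X y * f (y + p)).
  move=> K; rewrite (BS_shift p X i Lf) -[p in X in _ - X]addr0 (BS_shift p 0 i Lf).
  have [i1 _] := BS_int X i Lp; have [i2 _] := BS_int 0 i Lp.
  rewrite -RintegralB//; apply: eq_Rintegral => y _.
  by rewrite /DK sub0r mulrBl.
by rewrite !biot_savart1 !biot_savart2 -!mulrBr (H true) (H false).
Qed.

Lemma Du_dot f N1 N3 p X : L13 f N1 N3 ->
  X.1 * ((biot_savart f (p + X)).1 - (biot_savart f p).1) +
  X.2 * ((biot_savart f (p + X)).2 - (biot_savart f p).2) =
    (2 * pi)^-1 * \int[mu2]_y (Jker X y * f (y + p)).
Proof.
move=> Lf; have Lp := L13_shift p Lf.
have [-> ->] := Du_DK p X Lf.
have [m1 i1] := DK_ib X true Lp; have [m2 i2] := DK_ib X false Lp.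
rewrite mulrCA [X.2 * _]mulrCA -mulrDr; congr (_ * _).
rewrite -!RintegralZl// -RintegralD//.
- by apply: eq_Rintegral => y _; rewrite /Jker /DK; ring.
- by apply: eq_integrable (integrableZl measurableT X.1 i1) => // y _; rewrite /= EFinM.
- by apply: eq_integrable (integrableZl measurableT X.2 i2) => // y _; rewrite /= EFinM.
Qed.

Lemma enorm_qrot y : enorm (qrot y) = enorm y.
Proof. by rewrite /enorm /qrot /= sqrrN addrC. Qed.

(** The four terms K(-y) cancel, and what remains is the sum of [four_sum_le] turned by a right
    angle. *)
Lemma Kbs_four X y : X != 0 -> 2 * enorm X <= enorm y ->
  let S i := DK i X y + DK i X (qrot y) + DK i X (qrot (qrot y)) + DK i X (qrot (qrot (qrot y))) in
  `|S true| <= 64 * enorm X ^+ 3 / enorm y ^+ 4 /\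
  `|S false| <= 64 * enorm X ^+ 3 / enorm y ^+ 4.
Proof.
move=> X0 Xy; have r0 : 0 < enorm X by rewrite enorm_gt0.
have hX := enorm_sq X; have hy := enorm_sq y.
have [h1 h2] := four_sum_le (esym hX) (esym hy) r0 Xy.
have e1 : enorm (X - y) ^+ 2 = (X.1 - y.1) ^+ 2 + (X.2 - y.2) ^+ 2 by rewrite enorm_sq.
have e2 : enorm (X - qrot y) ^+ 2 = (X.1 + y.2) ^+ 2 + (X.2 - y.1) ^+ 2.
  by rewrite enorm_sq /= opprK.
have e3 : enorm (X - qrot (qrot y)) ^+ 2 = (X.1 + y.1) ^+ 2 + (X.2 + y.2) ^+ 2.
  by rewrite enorm_sq /= !opprK.
have e4 : enorm (X - qrot (qrot (qrot y))) ^+ 2 = (X.1 - y.2) ^+ 2 + (X.2 + y.1) ^+ 2.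
  by rewrite enorm_sq /= !opprK.
rewrite /DK !Kbs1 !Kbs2 !enormN !enorm_qrot e1 e2 e3 e4 /=.
split.
- apply: le_trans h2; rewrite -[leRHS]normrN le_eqVlt; apply/orP; left; apply/eqP.
  by congr Num.norm; rewrite !opprK; ring.
- apply: le_trans h1; rewrite le_eqVlt; apply/orP; left; apply/eqP.
  by congr Num.norm; rewrite !opprK; ring.
Qed.

End BiotSavart.

#[local] Instance leb2_ae_filter (R : realType) : Filter (almost_everywhere (@leb2 R)).
Proof. exact: ae_filter_ringOfSetsType. Qed.

(** * Integral estimates for relative velocities *)

Section Estimates.
Variable R : realType.
Local Notation mR := (measurableTypeR R).
Local Notation mR2 := (mR * mR)%type.
Local Notation mu := (@lebesgue_measure R).
Local Notation mu2 := (@leb2 R).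
Implicit Types (y z X : R * R) (r a b : R).

Lemma DK_norm_ib f N1 N3 X i : L13 f N1 N3 ->
  ib (fun y => `|DK i X y * f y|) (2 * (N1 + N3 + 64)).
Proof.
move=> Lf; have [m1 i1] := BS_ib X i Lf; have [m2 i2] := BS_ib 0 i Lf.
have ii := ib_add i1 i2; rewrite [X in ib _ X](_ : _ = (N1 + N3 + 64) + (N1 + N3 + 64)); last by ring.
apply: ib_le ii.
- have [m _] := DK_ib X i Lf.
  by apply: measurableT_comp m; exact: normr_measurable.
- by move=> y; exact: normr_ge0.
- by move=> y; rewrite /DK !sub0r mulrBl (le_trans (ler_normB _ _)).
Qed.

Lemma J_norm_ib f N1 N3 X : L13 f N1 N3 ->
  exists C, ib (fun y => `|Jker X y * f y|) C.
Proof.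
move=> Lf; have i1 := DK_norm_ib X true Lf; have i2 := DK_norm_ib X false Lf.
eexists; apply: ib_le (ib_add (ib_scale (normr_ge0 X.1) i1) (ib_scale (normr_ge0 X.2) i2)).
- apply: measurableT_comp; first exact: normr_measurable.
  by apply: measurable_funM; [exact: measurable_Jker|case: Lf].
- by move=> y; exact: normr_ge0.
- move=> y; rewrite -!normrM (le_trans _ (ler_normD _ _))//.
  by rewrite le_eqVlt; apply/orP; left; apply/eqP; congr Num.norm; rewrite /Jker /DK; ring.
Qed.

Lemma int_J_sub f F N1 N3 N1' N3' X : X != 0 -> L13 f N1 N3 ->
  measurable_fun [set: mR] (F : mR -> R) -> L13 (fun y => F (enorm y)) N1' N3' ->
  \int[mu2]_y (Jker X y * f y) = \int[mu2]_y (Jker X y * (f y - F (enorm y))).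
Proof.
move=> X0 Lf mF LF; have [C1 iF] := J_norm_ib X LF; have [C2 iG] := J_norm_ib X Lf.
have mm g N N' : L13 g N N' -> measurable_fun [set: mR2] ((fun y => Jker X y * g y) : mR2 -> R).
  by case=> mg _ _; apply: measurable_funM => //; exact: measurable_Jker.
have [j1 _] := ib_norm (mm _ _ _ LF) iF; have [j2 _] := ib_norm (mm _ _ _ Lf) iG.
under [RHS]eq_Rintegral do rewrite mulrBr.
by rewrite RintegralB// (Jker_radial X0 mF iF) subr0.
Qed.

Lemma J_bound_ib f g C X : 0 <= C -> measurable_fun [set: mR2] (f : mR2 -> R) ->
  ib g C -> {ae mu2, forall y, Pker X y * `|f y| <= g y} ->
  `|\int[mu2]_y (Jker X y * f y)| <= 2 * enorm X ^+ 2 * C.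
Proof.
move=> C0 mf ig fg.
have m : measurable_fun [set: mR2] ((fun y => Jker X y * f y) : mR2 -> R).
  by apply: measurable_funM => //; exact: measurable_Jker.
have c0 : 0 <= 2 * enorm X ^+ 2 by rewrite mulr_ge0// exprn_ge0// enorm_ge0.
suff H : {ae mu2, forall y, `|Jker X y * f y| <= 2 * enorm X ^+ 2 * g y}.
  exact: (ib_Rint m H (ib_scale c0 ig)).2.
apply: filterS fg => y fgy; rewrite normrM.
apply: (@le_trans _ _ (2 * enorm X ^+ 2 * Pker X y * `|f y|)).
  by rewrite ler_wpM2r//; exact: Jker_le.
by rewrite -mulrA ler_wpM2l.
Qed.

(** Integral bound of the majorant [q] in [radial_DK]: [ib_Pker] on the disk of radius 2 |X|, and
    four times [ib_k32_pair]. It does not depend on X. *)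
Definition Cq : R := 32 * ln 4 + 128.

Lemma Cq_gt0 : 0 < Cq.
Proof. by rewrite /Cq ltr_wpDl// mulr_ge0// ln_ge0//; lra. Qed.

Lemma qrotK X : qrot (qrot (qrot (qrot X))) = X.
Proof. by rewrite /qrot /= !opprK [RHS]surjective_pairing. Qed.

Lemma qrot_eq y X : qrot y = X -> y = qrot (qrot (qrot X)).
Proof. by move=> <-; rewrite qrotK. Qed.

(** The squares of the two components add up to the square of the right side. At the excluded points
    the default value of the kernel would break this. *)
Lemma DK_le_pt X y i : y <> 0 -> y <> X -> `|DK i X y| <= enorm X * Pker X y.
Proof.
move=> y0 yX.
have a0 : 0 < enorm y by rewrite enorm_gt0; exact/eqP.
have b0 : 0 < enorm (X - y).
  by rewrite enorm_gt0 subr_eq0; apply/eqP => Xy; exact: yX.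
have rhs0 : 0 <= enorm X * Pker X y by rewrite mulr_ge0 ?enorm_ge0 ?Pker_ge0.
have a2 : enorm y ^+ 2 != 0 by rewrite gt_eqF ?exprn_gt0.
have b2 : enorm (X - y) ^+ 2 != 0 by rewrite gt_eqF ?exprn_gt0.
have S : DK true X y ^+ 2 + DK false X y ^+ 2 = (enorm X * Pker X y) ^+ 2.
  rewrite /Pker exprMn exprVn exprMn /DK !Kbs1 !Kbs2 enormN.
  move: a2 b2; rewrite !enorm_sq /= => a2 b2.
  by field; rewrite a2 b2.
by rewrite -(ler_pXn2r (n := 2)) ?nnegrE// real_normK ?num_real// -S;
  case: i; rewrite ?lerDl ?lerDr sqr_ge0.
Qed.

(* Far from the origin, averaging a radial vorticity over the rotations by
   multiples of pi/2 improves the decay of the kernel from |y|^-2 to |y|^-4. *)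
Lemma radial_DK (F : R -> R) X M N1 N3 i : X != 0 -> 0 <= M ->
  L13 (fun y => F (enorm y)) N1 N3 ->
  (forall a, 0 < a -> `|F a| <= M * (1 + enorm X * Num.sqrt (kr (enorm X) a))) ->
  `|\int[mu2]_y (DK i X y * F (enorm y))| <= 9 * Cq * M * enorm X.
Proof.
move=> X0 M0 LF FM; have r0 : 0 < enorm X by rewrite enorm_gt0.
set r := enorm X in r0 FM *.
pose q z := (if enorm z < 2 * r then Pker X z else 0) +
   4 * (r * (k32 r (enorm z) + k32 r (enorm (X - z)))).
have iq : ib q Cq.
  have r20 : 0 < 2 * r by rewrite mulr_gt0.
  have := ib_add (ib_Pker X0 r20) (ib_scale (ler0n R 4) (ib_k32_pair X0)).
  rewrite (_ : _ + _ = Cq)//; rewrite -/r (_ : 2 + 2 * r / r = 4); last by field; rewrite gt_eqF.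
  by rewrite /Cq; congr (_ + _); ring.
have q0 z : 0 <= q z by have [_ + _] := iq.
pose G z := DK i X z * F (enorm z).
have [mG _] := DK_ib X i LF; have iG := DK_norm_ib X i LF.
pose rr k := iter k (@qrot R).
have prr k : mpres (rr k).
  elim: k => [|k IH]; last exact: mpres_comp (@mpres_qrot R) IH.
  by apply: mpres_eq (mpres_add (0 : R * R)) => z; rewrite addr0.
have err k z : enorm (rr k z) = enorm z.
  by elim: k => // k IH; rewrite /rr iterS enorm_qrot.
have IGk k : \int[mu2]_y G (rr k y) = \int[mu2]_y G y by exact: mpres_Rint (prr k) mG.
have mGk k : measurable_fun [set: mR2] ((fun y => G (rr k y)) : mR2 -> R).
  by apply: measurableT_comp mG _; have [] := prr k.
have intG k : mu2.-integrable setT (EFin \o (fun y => G (rr k y))).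
  exact: (ib_norm (mGk k) (ib_mpres (prr k) iG)).1.
(* Each quarter turn preserves the integral, so [S] integrates to four times the integral of [G],
   and [S] is where the kernels cancel. *)
pose S y := G (rr 0 y) + G (rr 1 y) + (G (rr 2 y) + G (rr 3 y)).
have IS : \int[mu2]_y S y = 4 * \int[mu2]_y G y.
  have i01 : mu2.-integrable setT (EFin \o (fun y => G (rr 0 y) + G (rr 1 y))).
    exact: eq_integrable (integrableD measurableT (intG 0) (intG 1)).
  have i23 : mu2.-integrable setT (EFin \o (fun y => G (rr 2 y) + G (rr 3 y))).
    exact: eq_integrable (integrableD measurableT (intG 2) (intG 3)).
  rewrite /S (RintegralD measurableT i01 i23).
  rewrite (RintegralD measurableT (intG 0%N) (intG 1%N)).
  rewrite (RintegralD measurableT (intG 2%N) (intG 3%N)).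
  by rewrite (IGk 0%N) (IGk 1%N) (IGk 2%N) (IGk 3%N); ring.
have mS : measurable_fun [set: mR2] (S : mR2 -> R).
  by apply: measurable_funD; apply: measurable_funD.
pose g y := M * r * ((q (rr 0 y) + q (rr 1 y) + (q (rr 2 y) + q (rr 3 y))) + 32 * q y).
have ig : ib g (M * r * (Cq + Cq + (Cq + Cq) + 32 * Cq)).
  apply: ib_scale; first by rewrite mulr_ge0// ltW.
  apply: ib_add; last exact: ib_scale.
  have iqk k : ib (fun y => q (rr k y)) Cq by exact: ib_mpres (prr k) iq.
  exact: ib_add (ib_add (iqk 0%N) (iqk 1%N)) (ib_add (iqk 2%N) (iqk 3%N)).
have Mr0 : 0 <= M * r by rewrite mulr_ge0// ltW.
have Sg : {ae mu2, forall y, `|S y| <= g y}.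
  have h0 := ae_neq (0 : R * R); have hX k := ae_neq (rr k X).
  apply: filterS2 h0 (filterI (filterI (hX 0) (hX 1)) (filterI (hX 2) (hX 3))).
  move=> y y0 [[yX0 yX1] [yX2 yX3]].
  have a0 : 0 < enorm y by rewrite enorm_gt0; exact/eqP.
  have sk0 := sqrtr_ge0 (kr r (enorm y)).
  (* Near the origin the four terms are bounded one by one, which requires that no rotated point is
     0 or X; cancellation is used only for |y| >= 2 r. *)
  have [yr|yr] := ltP (enorm y) (2 * r).
    have Gk k : rr k y <> 0 -> rr k y <> X -> `|G (rr k y)| <= M * r * q (rr k y).
      move=> k0 kX; rewrite /G normrM err.
      have := DK_le_pt i k0 kX; rewrite -/r => d1.
      apply: (@le_trans _ _ (r * Pker X (rr k y) * (M * (1 + r * Num.sqrt (kr r (enorm y)))))).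
        by rewrite ler_pM// FM.
      have -> : r * Pker X (rr k y) * (M * (1 + r * Num.sqrt (kr r (enorm y)))) =
         M * r * (Pker X (rr k y) + r * (Pker X (rr k y) * Num.sqrt (kr r (enorm y)))) by ring.
      rewrite ler_wpM2l// /q err yr lerD2l [4 * _]mulrCA ler_wpM2l ?(ltW r0)//.
      by rewrite -{1 2}(err k y); exact: Pker_sqrt_le.
    have rr0 k : rr k y <> 0.
      by move=> e; have := err k y; rewrite e enorm0; move: a0 => /[swap] <-; rewrite ltxx.
    have k0 : `|G (rr 0 y)| <= M * r * q (rr 0 y) by apply: Gk => // e; apply: yX0.
    have k1 : `|G (rr 1 y)| <= M * r * q (rr 1 y).
      by apply: Gk => // /= /qrot_eq e; apply: yX3.
    have k2 : `|G (rr 2 y)| <= M * r * q (rr 2 y).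
      by apply: Gk => // /= /qrot_eq/qrot_eq e; apply: yX2; rewrite e !qrotK.
    have k3 : `|G (rr 3 y)| <= M * r * q (rr 3 y).
      by apply: Gk => // /= /qrot_eq/qrot_eq/qrot_eq e; apply: yX1; rewrite e !qrotK.
    rewrite /S /g.
    have := mulr_ge0 Mr0 (q0 y).
    have := ler_normD (G (rr 0 y) + G (rr 1 y)) (G (rr 2 y) + G (rr 3 y)).
    have := ler_normD (G (rr 0 y)) (G (rr 1 y)).
    have := ler_normD (G (rr 2 y)) (G (rr 3 y)).
    have -> : M * r * (q (rr 0%N y) + q (rr 1%N y) + (q (rr 2%N y) + q (rr 3%N y)) + 32 * q y) =
      (M * r * q (rr 0%N y) + M * r * q (rr 1%N y) + (M * r * q (rr 2%N y) + M * r * q (rr 3%N y))) +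
      32 * (M * r * q y) by ring.
    move: k0 k1 k2 k3; move: (M * r * q (rr 0%N y)) (M * r * q (rr 1%N y)) (M * r * q (rr 2%N y))
      (M * r * q (rr 3%N y)) (M * r * q y) => u0 u1 u2 u3 u4.
    by move: `|_| `|_| `|_| `|_| => v0 v1 v2 v3; clear; lra.
  (* Here the sum of kernels is of order r^3 / |y|^4, which [r ^+ 2 * k32 r (enorm y)] dominates. *)
  have [f1 f2] := Kbs_four X0 yr.
  have fi : `|DK i X (rr 0 y) + DK i X (rr 1 y) + DK i X (rr 2 y) + DK i X (rr 3 y)| <=
     64 * r ^+ 3 / enorm y ^+ 4 by case: (i); [exact: f1|exact: f2].
  have -> : S y = (DK i X (rr 0 y) + DK i X (rr 1 y) + DK i X (rr 2 y) + DK i X (rr 3 y)) * F (enorm y).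
    by rewrite /S /G !err; ring.
  rewrite normrM.
  have kr1 : r * Num.sqrt (kr r (enorm y)) <= 1.
    rewrite -(ler_pXn2r (n := 2)) ?nnegrE ?mulr_ge0 ?(ltW r0)// exprMn expr1n.
    rewrite [Num.sqrt (kr _ _) ^+ 2]sqr_sqrtr ?kr_ge0 ?(ltW a0)//.
    by rewrite /kr ler_pdivrMr ?mulr_gt0 ?addr_gt0//; nra.
  have F2 : `|F (enorm y)| <= M * 2.
    by apply: le_trans (FM _ a0) _; rewrite ler_wpM2l//; lra.
  have a3k : (enorm y ^+ 3)^-1 <= 2 * k32 r (enorm y).
    have k0 : 0 < kr r (enorm y) by exact: kr_gt0.
    set a := enorm y in a0 yr k0 *.
    have sq : (5 / 4 * a)^-1 <= Num.sqrt (kr r a).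
      rewrite -(ler_pXn2r (n := 2)) ?nnegrE ?sqrtr_ge0 ?invr_ge0 ?mulr_ge0 ?(ltW a0)//.
      rewrite [Num.sqrt (kr _ _) ^+ 2]sqr_sqrtr ?(ltW k0)// /kr exprVn lef_pV2 ?posrE ?exprn_gt0 ?mulr_gt0 ?addr_gt0//.
      by rewrite expr2; nra.
    have kk : (3 / 2 * a ^+ 2)^-1 <= kr r a.
      rewrite /kr lef_pV2 ?posrE ?mulr_gt0 ?exprn_gt0 ?addr_gt0//.
      by nra.
    apply: (@le_trans _ _ (2 * ((3 / 2 * a ^+ 2)^-1 * (5 / 4 * a)^-1))).
      have -> : 2 * ((3 / 2 * a ^+ 2)^-1 * (5 / 4 * a)^-1) = (16 / 15) * (a ^+ 3)^-1.
        by field; rewrite gt_eqF.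
      by rewrite ler_peMl ?invr_ge0 ?exprn_ge0 ?(ltW a0)//; lra.
    by rewrite ler_wpM2l// /k32 ler_pM// invr_ge0 mulr_ge0 ?exprn_ge0 ?(ltW a0)//.
  have r3 : r ^+ 3 / enorm y ^+ 4 <= r ^+ 2 * k32 r (enorm y).
    rewrite (_ : r ^+ 3 / enorm y ^+ 4 = r ^+ 2 * ((enorm y ^+ 3)^-1 * (r / enorm y))); last first.
      by field; rewrite gt_eqF.
    rewrite ler_wpM2l ?sqr_ge0//.
    have ra : r / enorm y <= 2^-1 by rewrite ler_pdivrMr//; lra.
    have p3 : 0 <= (enorm y ^+ 3)^-1 by rewrite invr_ge0 exprn_ge0// ltW.
    have ra0 : 0 <= r / enorm y by rewrite divr_ge0// ltW.
    by apply: (@le_trans _ _ ((enorm y ^+ 3)^-1 * 2^-1)); [rewrite ler_wpM2l|lra].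
  apply: (@le_trans _ _ (64 * (r ^+ 2 * k32 r (enorm y)) * (M * 2))).
    rewrite ler_pM// (le_trans fi)// -mulrA ler_wpM2l//.
  have qy : 4 * (r * k32 r (enorm y)) <= q y.
    rewrite /q -[leLHS]add0r lerD//; first by case: ifP => // _; exact: Pker_ge0.
    by rewrite ler_wpM2l// ler_wpM2l ?(ltW r0)// lerDl k32_ge0.
  have h1 : 64 * (r ^+ 2 * k32 r (enorm y)) * (M * 2) <= M * r * (32 * q y).
    have -> : 64 * (r ^+ 2 * k32 r (enorm y)) * (M * 2) =
      M * r * (32 * (4 * (r * k32 r (enorm y)))) by ring.
    by rewrite ler_wpM2l// ler_wpM2l.
  have h2 : 0 <= M * r * (q (rr 0%N y) + q (rr 1%N y) + (q (rr 2%N y) + q (rr 3%N y))).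
    by apply: mulr_ge0 => //; apply: addr_ge0; apply: addr_ge0; exact: q0.
  by apply: le_trans h1 _; rewrite /g [leRHS]mulrDr lerDr.
have [_] := ib_Rint mS Sg ig; rewrite IS normrM gtr0_norm//.
have -> : M * r * (Cq + Cq + (Cq + Cq) + 32 * Cq) = 4 * (9 * Cq * M * r) by ring.
by rewrite ler_pM2l.
Qed.

End Estimates.

(** * Logarithmic weights and the a priori drift *)

Section Weights.
Variable R : realType.
Local Notation mR := (measurableTypeR R).
Local Notation mR2 := (mR * mR)%type.
Local Notation mu2 := (@leb2 R).
Implicit Types (y z X : R * R) (r a b : R).

#[local] Instance leb2_ae_filter' : Filter (almost_everywhere mu2).
Proof. exact: ae_filter_ringOfSetsType. Qed.

(** A substitute for ln(1/r) that is at least 1 for all r and smooth in r^2, so that it can be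
    differentiated along trajectories without a cut-off. Accordingly [ln (Zf r)] agrees with the
    vortex up to a bounded error ([profile_Zf]). *)
Definition Zf r : R := 1 + ln (1 + (r ^+ 2)^-1) / 2.
Definition Lw r : R := 1 + ln (Zf r).

Lemma ln_le_sub1 (x : R) : 0 < x -> ln x <= x - 1.
Proof.
move=> x0; have := @le_ln1Dx R (x - 1); rewrite (_ : 1 + (x - 1) = x); [apply; lra|ring].
Qed.

Lemma ln_sqr (x : R) : 0 < x -> ln (x ^+ 2) = 2 * ln x.
Proof. by move=> x0; rewrite lnXn// mulr_natl. Qed.

Lemma Zf_ge1 r : 1 <= Zf r.
Proof. by rewrite /Zf lerDl divr_ge0// ln_ge0// lerDl invr_ge0 sqr_ge0. Qed.

Lemma Zf_gt0 r : 0 < Zf r.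
Proof. exact: lt_le_trans (Zf_ge1 r). Qed.

Lemma Lw_ge1 r : 1 <= Lw r.
Proof. by rewrite /Lw lerDl ln_ge0// Zf_ge1. Qed.

Lemma Zf_anti a b : 0 < a -> a <= b -> Zf b <= Zf a.
Proof.
move=> a0 ab; have b0 := lt_le_trans a0 ab.
have h (x : R) : 0 < x -> 0 < 1 + (x ^+ 2)^-1 by move=> x0; rewrite addr_gt0// invr_gt0 exprn_gt0.
rewrite /Zf lerD2l ler_pM2r// ler_ln ?posrE ?h// lerD2l lef_pV2 ?posrE ?exprn_gt0//.
by rewrite lerXn2r ?nnegrE// ltW.
Qed.

Lemma Lw_anti a b : 0 < a -> a <= b -> Lw b <= Lw a.
Proof. by move=> a0 ab; rewrite /Lw lerD2l ler_ln ?posrE ?Zf_gt0// Zf_anti. Qed.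

(** The weight grows more slowly than any power: for a <= r its excess over [Lw r] is at most of
    order sqrt(r/a). The bound has the form that [Pker_sqrt_le] integrates to a constant. *)
Lemma Lw_le r a : 0 < r -> 0 < a -> Lw a <= Lw r + 3 * (r * Num.sqrt (kr r a)).
Proof.
move=> r0 a0; have k0 := kr_gt0 r0 a0; have s0 := sqrtr_ge0 (kr r a).
have [ra|/ltW ar] := leP r a.
  by rewrite ler_wpDr ?mulr_ge0 ?(ltW r0)// Lw_anti.
rewrite -lerBlDl /Lw opprD addrACA subrr add0r -ln_div ?posrE ?Zf_gt0//.
apply: le_trans (ln_le_sub1 _) _; first by rewrite divr_gt0 ?Zf_gt0.
have -> : Zf a / Zf r - 1 = (Zf a - Zf r) / Zf r by field; rewrite gt_eqF ?Zf_gt0.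
apply: (@le_trans _ _ (Zf a - Zf r)).
  by rewrite ler_pdivrMr ?Zf_gt0// ler_peMr ?Zf_ge1// subr_ge0 Zf_anti.
have h (x : R) : 0 < x -> 0 < 1 + (x ^+ 2)^-1 by move=> x0; rewrite addr_gt0// invr_gt0 exprn_gt0.
(* The difference of [Zf] is at most ln(r/a) = 2 ln t <= 2 t. *)
pose t := Num.sqrt (r / a).
have t0 : 0 < t by rewrite sqrtr_gt0 divr_gt0.
have t2 : t ^+ 2 = r / a by rewrite sqr_sqrtr// divr_ge0// ltW.
have e : Zf a - Zf r = ln ((1 + (a ^+ 2)^-1) / (1 + (r ^+ 2)^-1)) / 2.
  by rewrite ln_div ?posrE ?h// /Zf; field.
have le1 : (1 + (a ^+ 2)^-1) / (1 + (r ^+ 2)^-1) <= (t ^+ 2) ^+ 2.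
  rewrite t2 ler_pdivrMr ?h//.
  have -> : (r / a) ^+ 2 * (1 + (r ^+ 2)^-1) = (r / a) ^+ 2 + (a ^+ 2)^-1.
    by field; rewrite !gt_eqF.
  rewrite lerD2r -[leLHS](expr1n _ 2) lerXn2r ?nnegrE ?divr_ge0 ?(ltW r0) ?(ltW a0)//.
  by rewrite ler_pdivlMr// mul1r.
have le2 : Zf a - Zf r <= 2 * t.
  rewrite e; apply: (@le_trans _ _ (ln ((t ^+ 2) ^+ 2) / 2)).
    by rewrite ler_pM2r// ler_ln ?posrE ?exprn_gt0// divr_gt0// h.
  rewrite !ln_sqr ?exprn_gt0//.
  have := ln_le_sub1 t0; lra.
apply: le_trans le2 _.
rewrite -(ler_pXn2r (n := 2)) ?nnegrE ?mulr_ge0 ?(ltW t0) ?(ltW r0)//.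
rewrite !exprMn t2 [Num.sqrt (kr _ _) ^+ 2]sqr_sqrtr ?(ltW k0)// /kr.
have -> : 3 ^+ 2 * (r ^+ 2 * (a * (a + r))^-1) = (9 * r / (a + r)) * (r / a).
  by field; rewrite !gt_eqF// addr_gt0.
rewrite ler_pM2r ?divr_gt0// ler_pdivlMr ?addr_gt0//; lra.
Qed.

Lemma ln_1V r : 0 < r -> ln (1 + r^-1) <= Zf r.
Proof.
move=> r0; have v0 : 0 < r^-1 by rewrite invr_gt0.
have q0 : 0 < 1 + r^-1 by rewrite addr_gt0.
have l2 : ln 2 <= 1 :> R by have := @ln_le_sub1 2 ltac:(lra); lra.
have h : 0 < 1 + (r ^+ 2)^-1 by rewrite addr_gt0// invr_gt0 exprn_gt0.
have : ln ((1 + r^-1) ^+ 2) <= ln (2 * (1 + (r ^+ 2)^-1)).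
  rewrite ler_ln ?posrE ?exprn_gt0 ?mulr_gt0// -exprVn.
  by have := sqr_ge0 (1 - r^-1); nra.
rewrite ln_sqr// lnM ?posrE// /Zf; lra.
Qed.

Lemma ln_2D r b : 0 < r -> 0 <= b -> ln (2 + b / r) <= (ln (2 + b) + 1) * Zf r.
Proof.
move=> r0 b0; have v0 : 0 < r^-1 by rewrite invr_gt0.
have b2 : 0 < 2 + b by lra.
have lb : 0 <= ln (2 + b) by rewrite ln_ge0//; lra.
have br : 0 <= b / r by rewrite divr_ge0// ltW.
apply: (@le_trans _ _ (ln ((2 + b) * (1 + r^-1)))).
  have p1 : 0 < 2 + b / r by lra.
  have p2 : 0 < (2 + b) * (1 + r^-1) by rewrite mulr_gt0// addr_gt0.
  rewrite ler_ln ?posrE//.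
  have -> : (2 + b) * (1 + r^-1) = 2 + b / r + (b + 2 * r^-1) by ring.
  by rewrite lerDl; lra.
have p3 : 0 < 1 + r^-1 by rewrite addr_gt0.
rewrite lnM ?posrE//.
by have := ln_1V r0; have := Zf_ge1 r; nra.
Qed.

Definition CE b : R := 64 * (ln (2 + b) + 1) + 768.

(** The feedback estimate: a deviation A + B L from a radial vorticity returns as the same
    expression at X times Z. The factor Z is the logarithmic integral of [Pker]; replacing L(|y|) by
    L(|X|) costs only an integrable term by [Lw_le]. *)
Lemma J_weight_le f (F : R -> R) N1 N3 N1' N3' X b A B : X != 0 -> 0 < b ->
  0 <= A -> 0 <= B -> L13 f N1 N3 ->
  measurable_fun [set: mR] (F : mR -> R) -> L13 (fun y => F (enorm y)) N1' N3' ->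
  {ae mu2, forall y, `|f y - F (enorm y)| <=
     if enorm y < b then A + B * Lw (enorm y) else 0} ->
  `|\int[mu2]_y (Jker X y * f y)| <=
     enorm X ^+ 2 * (CE b * Zf (enorm X) * (A + B * Lw (enorm X))).
Proof.
move=> X0 b0 A0 B0 Lf mF LF fF; have r0 : 0 < enorm X by rewrite enorm_gt0.
have L1 := Lw_ge1 (enorm X); have Z1 := Zf_ge1 (enorm X).
have AB : 0 <= A + B * Lw (enorm X) by rewrite addr_ge0// mulr_ge0//; lra.
rewrite (int_J_sub X0 Lf mF LF).
have ig := ib_add (ib_scale AB (ib_Pker X0 b0))
   (ib_scale (mulr_ge0 B0 (ler0n R 12)) (ib_k32_pair X0)).
have lnb := ln_2D r0 (ltW b0).
apply: le_trans (J_bound_ib (ib_ge0 ig) _ ig _) _.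
- by apply: measurable_funB; [case: Lf|case: LF].
- apply: filterS2 (ae_neq (0 : R * R)) fF => y y0 h.
  have a0 : 0 < enorm y by rewrite enorm_gt0; exact/eqP.
  have P0 := Pker_ge0 X y.
  apply: (@le_trans _ _ _ _ _ (ler_wpM2l P0 h)).
  case: ifP => yb; last first.
    by rewrite mulr0 mulr0 add0r !mulr_ge0 ?addr_ge0 ?k32_ge0 ?(ltW r0).
  have h1 := Lw_le r0 a0; have h2 := Pker_sqrt_le y X0.
  apply: (@le_trans _ _ (Pker X y * (A + B * (Lw (enorm X) +
     3 * (enorm X * Num.sqrt (kr (enorm X) (enorm y))))))).
    by rewrite ler_wpM2l// lerD2l ler_wpM2l.
  have -> : Pker X y * (A + B * (Lw (enorm X) +
     3 * (enorm X * Num.sqrt (kr (enorm X) (enorm y))))) =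
     (A + B * Lw (enorm X)) * Pker X y +
     B * 3 * (enorm X * (Pker X y * Num.sqrt (kr (enorm X) (enorm y)))) by ring.
  rewrite lerD2l.
  have -> (u : R) : B * 12 * (enorm X * u) = B * 3 * (enorm X * (4 * u)) by ring.
  by rewrite ler_wpM2l ?mulr_ge0// ler_wpM2l// ltW.
- rewrite [leLHS](_ : _ = enorm X ^+ 2 * (2 * ((A + B * Lw (enorm X)) *
    (32 * ln (2 + b / enorm X)) + B * 12 * 32))); last by ring.
  rewrite ler_wpM2l ?sqr_ge0//.
  have lb0 : 0 <= ln (2 + b) by rewrite ln_ge0//; lra.
  have h1 : (A + B * Lw (enorm X)) * (32 * ln (2 + b / enorm X)) <=
     (A + B * Lw (enorm X)) * (32 * ((ln (2 + b) + 1) * Zf (enorm X))).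
    by rewrite ler_wpM2l// ler_wpM2l.
  have h2 : B <= (A + B * Lw (enorm X)) * Zf (enorm X).
    apply: (@le_trans _ _ ((A + B * Lw (enorm X)) * 1)); last by rewrite ler_wpM2l.
    by rewrite mulr1 ler_wpDl// ler_peMr.
  move: h1 h2; rewrite /CE; move: (A + B * Lw _) => u; move: (ln (2 + b / _)) => v.
  move: (Zf _) (ln (2 + b)) => z l h1 h2.
  have -> : (64 * (l + 1) + 768) * z * u =
     2 * (u * (32 * ((l + 1) * z))) + 768 * (u * z) by ring.
  lra.
Qed.

Definition CY b C0 : R := 2 * (expR 1 * C0 * (1 + ln 8) * (32 * (ln (2 + b) + 1)) +
  216 * (expR 1 * C0) ^+ 3 + 256).

(* Hoelder's inequality with an exponent of order ln Z(|X|): this is where the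
   logarithmic growth of the L^p norms is used. *)
Lemma J_yudovich_le f N1 N3 X b C0 : X != 0 -> 0 < b -> 0 < C0 -> L13 f N1 N3 ->
  (forall n : nat, (0 < n)%N -> ib (fun y => `|f y| ^+ n) ((C0 * (1 + ln n%:R)) ^+ n)) ->
  {ae mu2, forall y, b <= enorm y -> f y = 0} ->
  `|\int[mu2]_y (Jker X y * f y)| <=
     enorm X ^+ 2 * (CY b C0 * Zf (enorm X) * Lw (enorm X)).
Proof.
move=> X0 b0 C00 Lf fn fb; have r0 : 0 < enorm X by rewrite enorm_gt0.
have L1 := Lw_ge1 (enorm X); have Z1 := Zf_ge1 (enorm X).
set r := enorm X in r0 L1 Z1 *.
have rV0 : 0 < r^-1 by rewrite invr_gt0.
pose l1 := ln (1 + r^-1).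
have l10 : 0 <= l1 by rewrite ln_ge0// lerDl ltW.
(* The exponent: n <= 8 Z keeps 1 + ln n of order L, n >= 4 ln(1 + 1/r) makes e^-n beat r^-2, and n
   >= 3 allows |f|^3 to be traded for |f|^n. *)
pose n := ((Num.truncn (4 * l1)).+3)%N.
have nle : n%:R <= 8 * Zf r.
  have := ln_1V r0; rewrite -/l1 => h.
  have := @truncn_le R (4 * l1); rewrite mulr_ge0// => h2.
  by rewrite /n -addn3 natrD; lra.
have nge : 4 * l1 <= n%:R.
  have /ltW := truncnS_gt (4 * l1); move/le_trans; apply.
  by rewrite ler_nat /n; exact/leqW/leqW/leqnn.
have [m nm] : exists m, n = (m + 3)%N by exists (Num.truncn (4 * l1)); rewrite addn3.
clearbody n.
have nn0 : (0 < n)%N by rewrite nm addn3.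
have n0 : 0 < n%:R :> R by rewrite ltr0n.
have n1 : 1 <= n%:R :> R by rewrite ler1n.
have ln0 : 0 <= ln n%:R :> R by rewrite ln_ge0.
have lnL : 1 + ln n%:R <= (1 + ln 8) * Lw r.
  have : ln n%:R <= ln (8 * Zf r) by rewrite ler_ln ?posrE ?mulr_gt0 ?Zf_gt0//.
  rewrite lnM ?posrE ?Zf_gt0// /Lw.
  have l8 : 0 <= ln 8 :> R by rewrite ln_ge0//; lra.
  have lz : 0 <= ln (Zf r) by rewrite ln_ge0.
  by nra.
pose e : R := expR 1.
have e0 : 0 < e by exact: expR_gt0.
have eE : e = expR 1 by [].
clearbody e.
(* The threshold is e times the bound on the n-th norm, so the n-th moment divided by lam^n is at
   most e^-n. *)
pose lam := e * (C0 * (1 + ln n%:R)).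
have lamE : lam = e * (C0 * (1 + ln n%:R)) by [].
have c0 : 0 < C0 * (1 + ln n%:R) by rewrite mulr_gt0//; lra.
have lam0 : 0 < lam by rewrite mulr_gt0.
clearbody lam.
pose g y := lam * (if enorm y < b then Pker X y else 0) +
  (r^-1 ^+ 2 * lam ^+ 3 * (lam ^+ n)^-1 * `|f y| ^+ n +
   8 * (r * (k32 r (enorm y) + k32 r (enorm (X - y))))).
have k20 : 0 <= r^-1 ^+ 2 * lam ^+ 3 * (lam ^+ n)^-1.
  apply: mulr_ge0; first by apply: mulr_ge0; apply: exprn_ge0; exact: ltW.
  by rewrite invr_ge0; apply: exprn_ge0; exact: ltW.
have ig := ib_add (ib_scale (ltW lam0) (ib_Pker X0 b0))
  (ib_add (ib_scale k20 (fn n nn0)) (ib_scale (ler0n R 8) (ib_k32_pair X0))).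
apply: le_trans (J_bound_ib (ib_ge0 ig) _ ig _) _.
- by case: Lf.
- apply: filterS2 (ae_neq (0 : R * R)) fb => y y0 h.
  suff : Pker X y * `|f y| <= g y by [].
  have P0 := Pker_ge0 X y; have f0 := normr_ge0 (f y).
  have t1 : 0 <= lam * (if enorm y < b then Pker X y else 0).
    by rewrite mulr_ge0 ?(ltW lam0)//; case: ifP.
  have t2 : 0 <= r^-1 ^+ 2 * lam ^+ 3 * (lam ^+ n)^-1 * `|f y| ^+ n.
    by rewrite mulr_ge0// exprn_ge0.
  have t3 : 0 <= 8 * (r * (k32 r (enorm y) + k32 r (enorm (X - y)))).
    by rewrite !mulr_ge0 ?addr_ge0 ?k32_ge0 ?(ltW r0).
  have g0 : 0 <= g y by apply: addr_ge0 => //; apply: addr_ge0.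
  have [by_|yb] := leP b (enorm y); first by rewrite (h by_) normr0 mulr0; exact: g0.
  rewrite yb in t1.
  have -> : g y = lam * Pker X y + (r^-1 ^+ 2 * lam ^+ 3 * (lam ^+ n)^-1 * `|f y| ^+ n +
   8 * (r * (k32 r (enorm y) + k32 r (enorm (X - y))))) by rewrite /g yb.
  have [fl|lf] := leP `|f y| lam.
    apply: (@le_trans _ _ (lam * Pker X y)); first by rewrite mulrC ler_wpM2r.
    by rewrite lerDl addr_ge0.
  (* Above the threshold: Young's inequality with k = 1/r leaves r^-2 |f|^3, and |f|^3 <= lam^(3-n)
     |f|^n, while the kernel to the power 3/2 is integrable. *)
  have := young32 f0 P0 rV0; rewrite invrK [`|f y| * _]mulrC => yg.
  apply: le_trans yg _; rewrite -[leLHS]add0r; apply: lerD => //.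
  apply: lerD.
    have H2 (k q p u v : R) : 0 <= k -> 0 < p -> u * p <= q * v -> k * u <= k * q * p^-1 * v.
      move=> kk p0 upqv; rewrite [leRHS](_ : _ = k * (q * v / p)); last by ring.
      by rewrite ler_wpM2l// ler_pdivlMr.
    apply: H2; [by rewrite exprn_ge0// ltW|by rewrite exprn_gt0|].
    rewrite nm !exprD.
    have H (u p q s : R) : 0 <= u -> 0 <= q -> p <= s -> u * (p * q) <= q * (s * u).
      move=> u0 q0 ps; rewrite [leRHS](_ : _ = u * (s * q)); last by ring.
      by rewrite ler_wpM2l// ler_wpM2r.
    apply: H; rewrite ?exprn_ge0 ?(ltW lam0)//.
    by rewrite lerXn2r ?nnegrE ?(ltW lam0)// ltW.
  rewrite [leRHS]mulrCA ler_wpM2l ?(ltW r0)//; exact: Pker_32_le.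
rewrite [leLHS](_ : _ = enorm X ^+ 2 * (2 * (lam * (32 * ln (2 + b / enorm X)) +
  (r^-1 ^+ 2 * lam ^+ 3 * (lam ^+ n)^-1 * (C0 * (1 + ln n%:R)) ^+ n + 8 * 32)))); last by ring.
rewrite ler_wpM2l ?sqr_ge0//.
have ZL : 1 <= Zf r * Lw r by rewrite -[1]mulr1 ler_pM.
have h1 : lam * (32 * ln (2 + b / enorm X)) <=
   e * C0 * (1 + ln 8) * (32 * (ln (2 + b) + 1)) * (Zf r * Lw r).
  have h := ln_2D r0 (ltW b0).
  apply: (@le_trans _ _ (e * (C0 * ((1 + ln 8) * Lw r)) * (32 * ((ln (2 + b) + 1) * Zf r)))).
    rewrite ler_pM//.
    - exact: ltW.
    - by apply: mulr_ge0 => //; apply: ln_ge0; have : 0 <= b / enorm X; [rewrite divr_ge0// ltW|lra].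
    - by rewrite lamE ler_pM2l// ler_pM2l.
    - by rewrite ler_wpM2l.
  by rewrite le_eqVlt; apply/orP; left; apply/eqP; ring.
have h2 : r^-1 ^+ 2 * lam ^+ 3 * (lam ^+ n)^-1 * (C0 * (1 + ln n%:R)) ^+ n <=
   216 * (e * C0) ^+ 3.
  (* The gain e^n is split into two factors h^3: one absorbs r^-2, the other the power lam^3, since
     1 + ln n <= n <= 6 h. *)
  have E : expR (n%:R / 6) ^+ 6 = e ^+ n.
    by rewrite eE -!expRM_natl mulr1; congr expR; field.
  set h := expR (n%:R / 6) in E.
  have h0 : 0 < h by exact: expR_gt0.
  have nh : n%:R <= 6 * h by have := @expR_ge1Dx R (n%:R / 6); rewrite -/h; lra.
  have rh : r^-1 ^+ 2 <= h ^+ 3.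
    apply: (@le_trans _ _ ((1 + r^-1) ^+ 2)).
      by rewrite lerXn2r ?nnegrE ?addr_ge0 ?(ltW rV0)// lerDr.
    have q0 : 0 < 1 + r^-1 by rewrite addr_gt0.
    rewrite -[X in X ^+ 2 <= _]lnK ?posrE// -/l1.
    rewrite /h -!expRM_natl ler_expR; lra.
  have E2 : (C0 * (1 + ln n%:R)) ^+ n = lam ^+ n * (h ^+ 6)^-1.
    by rewrite E lamE !exprMn mulrAC divff ?mul1r// expf_neq0// gt_eqF.
  have lm : lam ^+ 3 <= (e * C0 * (6 * h)) ^+ 3.
    rewrite lerXn2r ?nnegrE ?mulr_ge0 ?(ltW lam0) ?(ltW e0) ?(ltW C00) ?(ltW h0)//.
    rewrite lamE -[leRHS]mulrA ler_pM2l// ler_pM2l//; apply: le_trans nh.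
    by have := ln_le_sub1 n0; lra.
  rewrite E2 [leLHS](_ : _ = r^-1 ^+ 2 * lam ^+ 3 * (h ^+ 6)^-1); last first.
    by rewrite mulrA -[_ * _ * lam ^+ n]mulrA mulVf ?mulr1// expf_neq0// gt_eqF.
  apply: (@le_trans _ _ (h ^+ 3 * (e * C0 * (6 * h)) ^+ 3 * (h ^+ 6)^-1)).
    by rewrite ler_wpM2r ?invr_ge0 ?exprn_ge0 ?(ltW h0)// ler_pM ?exprn_ge0 ?(ltW rV0) ?(ltW lam0).
  by rewrite le_eqVlt; apply/orP; left; apply/eqP; field; rewrite gt_eqF.
rewrite /CY -eE.
have e1 : 2 * (e * C0 * (1 + ln 8) * (32 * (ln (2 + b) + 1)) + 216 * (e * C0) ^+ 3 + 256) *
   Zf r * Lw r = 2 * (e * C0 * (1 + ln 8) * (32 * (ln (2 + b) + 1)) * (Zf r * Lw r) +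
   (216 * (e * C0) ^+ 3 * (Zf r * Lw r) + 256 * (Zf r * Lw r))) by ring.
rewrite e1 ler_pM2l// lerD//.
have h3 : 216 * (e * C0) ^+ 3 <= 216 * (e * C0) ^+ 3 * (Zf r * Lw r).
  have e3 : 0 <= (e * C0) ^+ 3 by apply: exprn_ge0; apply: mulr_ge0; exact: ltW.
  have c3 : 0 <= 216 * (e * C0) ^+ 3 by apply: mulr_ge0 e3; exact: ler0n.
  by apply: (ler_peMr c3).
have h4 : 8 * 32 <= 256 * (Zf r * Lw r) by lra.
by rewrite lerD// (le_trans h2).
Qed.

End Weights.

(** * The radial profile of the vortex *)

Section Profile.
Variable R : realType.
Local Notation mR := (measurableTypeR R).
Local Notation mR2 := (mR * mR)%type.
Local Notation mu2 := (@leb2 R).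
Variable s : R -> R.
Implicit Types (r a b : R).

Definition profile (r : R) : R := loglog_vortex s (r, 0).

Lemma enorm_axis r : enorm (r, 0 : R) = `|r|.
Proof. by rewrite /enorm /= expr0n/= addr0 sqrtr_sqr. Qed.

Lemma vortexE (x : R * R) : loglog_vortex s x = profile (enorm x).
Proof. by rewrite /profile /loglog_vortex enorm_axis ger0_norm ?enorm_ge0. Qed.

Lemma profile_lo r : 0 < r -> r < expR (- 2) -> profile r = ln (ln r^-1).
Proof.
by move=> r0 r2; rewrite /profile /loglog_vortex enorm_axis gtr0_norm// r2.
Qed.

Lemma profile_hi r : expR (- 1) < r -> profile r = 0.
Proof.
move=> r1; have r0 : 0 < r by apply: lt_trans r1; exact: expR_gt0.
rewrite /profile /loglog_vortex enorm_axis gtr0_norm//.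
have e21 : expR (- 2) < r by apply: lt_trans r1; rewrite ltr_expR; lra.
by rewrite ltNge (ltW e21)/= leNgt r1.
Qed.

Hypothesis s_smooth : smooth_on [set~ (0 : R * R)] (loglog_vortex s).

Lemma profile_continuous r : r != 0 -> {for r, continuous profile}.
Proof.
move=> r0.
have d : differentiable (loglog_vortex s) ((r, 0) : R * R).
  by apply: (@s_smooth [::]) => /= -[] e; rewrite e eqxx in r0.
have c := differentiable_continuous d.
apply: (@continuous_comp _ _ _ (fun t : R => (t, 0) : R * R) (loglog_vortex s)) => //.
apply: (@cvg_pair _ _ _ (nbhs r) (nbhs r) (nbhs (0 : R)) _ _ _ id (fun=> 0)) => //.
exact: cvg_cst.
Qed.

Lemma measurable_profile : measurable_fun [set: mR] (profile : mR -> R).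
Proof.
have -> : [set: mR] = [set~ (0 : R)] `|` [set (0 : R)] by rewrite setUC setUv.
apply/measurable_funU => //; first by apply: measurableC; exact: measurable_set1.
split; last exact: measurable_fun_set1.
apply: open_continuous_measurable_fun.
  by rewrite openC; exact: closed_eq.
by move=> x; rewrite inE/= => /eqP x0; exact: profile_continuous.
Qed.

(** For r < e^-2 and t = ln(1/r) one has t <= Z <= 2 t, so the two differ by at most ln 2. On the
    transition annulus the profile is bounded by compactness, and beyond it vanishes. *)
Lemma profile_Zf : exists2 C : R, 0 <= C & forall r, 0 < r -> `|profile r - ln (Zf r)| <= C.
Proof.
have e2 : 0 < expR (- 2) :> R by exact: expR_gt0.
have e12 : expR (- 2) <= expR (- 1) :> R by rewrite ler_expR; lra.
have cw : {within `[expR (- 2), expR (- 1)], continuous (fun t => `|profile t|)}.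
  apply: continuous_in_subspaceT => t; rewrite inE/= in_itv/= => /andP[t2 _].
  apply: (@continuous_comp _ _ _ profile (fun t => `|t|)).
    by apply: profile_continuous; rewrite gt_eqF// (lt_le_trans e2).
  exact: norm_continuous.
have [c _ cM] := EVT_max e12 cw.
pose z := ln (Zf (expR (- 2) : R)).
have lz0 r : 0 <= ln (Zf r) by rewrite ln_ge0// Zf_ge1.
have lnz r : expR (- 2) <= r -> ln (Zf r) <= z.
  by move=> h; rewrite ler_ln ?posrE ?Zf_gt0// Zf_anti.
have ln20 : 0 <= ln 2 :> R by rewrite ln_ge0//; lra.
exists (`|profile c| + z + ln 2); first by apply: addr_ge0 => //; apply: addr_ge0 => //; exact: lz0.
move=> r r0; have [rlo|rhi] := ltP r (expR (- 2)).
  pose t := ln r^-1.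
  have t2 : 2 < t by rewrite /t lnV ?posrE// ltrNr -ltr_expR lnK ?posrE.
  have t0 : 0 < t by lra.
  rewrite profile_lo// -/t.
  have n2 : 0 < (r ^+ 2)^-1 by rewrite invr_gt0 exprn_gt0.
  have n1 : 0 < 1 + (r ^+ 2)^-1 by rewrite addr_gt0.
  have tE : ln (r ^+ 2)^-1 = 2 * t.
    by rewrite -exprVn ln_sqr// invr_gt0.
  have l2 : ln 2 <= 1 :> R by have := @ln_le_sub1 R 2 ltac:(lra); lra.
  have tZ : t <= Zf r.
    have : ln (r ^+ 2)^-1 <= ln (1 + (r ^+ 2)^-1) by rewrite ler_ln ?posrE// lerDr.
    by rewrite tE /Zf; lra.
  have Z2t : Zf r <= 2 * t.
    have : ln (1 + (r ^+ 2)^-1) <= ln (2 * (r ^+ 2)^-1).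
      rewrite ler_ln ?posrE ?mulr_gt0//.
      have : 1 <= (r ^+ 2)^-1; last by lra.
      rewrite invf_ge1 ?exprn_gt0// expr_le1// ?(ltW r0)//.
      apply: ltW; apply: (lt_trans rlo); rewrite expR_lt1; lra.
    by rewrite lnM ?posrE// tE /Zf; lra.
  have h1 : ln t <= ln (Zf r) by rewrite ler_ln ?posrE ?Zf_gt0.
  have h2 : ln (Zf r) <= ln 2 + ln t.
    by rewrite -lnM ?posrE// ler_ln ?posrE ?Zf_gt0 ?mulr_gt0.
  have := lz0 (expR (- 2)); have := normr_ge0 (profile c); rewrite -/z.
  by rewrite ler_norml => ? ?; apply/andP; split; lra.
have := lnz r rhi; have := lz0 r.
suff : `|profile r| <= `|profile c|.
  by have := ler_normB (profile r) (ln (Zf r)); move=> h h1 h2 h3;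
     apply: (le_trans h); rewrite (ger0_norm h2); lra.
have [h|h] := leP r (expR (- 1)); first by apply: cM; rewrite in_itv/= rhi h.
by rewrite profile_hi// normr0.
Qed.

Lemma profile_le r (C : R) : (forall r, 0 < r -> `|profile r - ln (Zf r)| <= C) ->
  0 < r -> `|profile r| <= (if r < 1 then C + Lw r else 0).
Proof.
move=> hC r0; have [r1|r1] := ltP r 1; last first.
  rewrite profile_hi ?normr0//; apply: lt_le_trans r1; rewrite expR_lt1; lra.
have h := hC r r0; have l0 : 0 <= ln (Zf r) by rewrite ln_ge0// Zf_ge1.
rewrite -[profile r](subrK (ln (Zf r))) (le_trans (ler_normD _ _))// /Lw.
by rewrite (ger0_norm l0); lra.
Qed.

End Profile.

(** * Integrability of radial vorticities *)

Section RadialL13.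
Variable R : realType.
Local Notation mR := (measurableTypeR R).
Local Notation mR2 := (mR * mR)%type.
Local Notation mu2 := (@leb2 R).

Lemma cube_add (u v : R) : 0 <= u -> 0 <= v -> (u + v) ^+ 3 <= 4 * (u ^+ 3 + v ^+ 3).
Proof.
move=> u0 v0; rewrite -subr_ge0.
rewrite (_ : _ - _ = 3 * ((u + v) * (u - v) ^+ 2)); last by ring.
by rewrite mulr_ge0// mulr_ge0 ?sqr_ge0// addr_ge0.
Qed.

(** By [Lw_le] at scale 1 the weight is a constant plus a multiple of sqrt([kr 1]), whose cube is a
    multiple of [k32 1]; on the unit disk constants are dominated by [k32 1] as well. *)
Lemma L13_radial (F : R -> R) (A : R) : 0 <= A ->
  measurable_fun [set: mR] (F : mR -> R) ->
  (forall r : R, 0 < r -> `|F r| <= (if r < 1 then A * Lw r else 0)) ->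
  exists N1 N3, L13 (fun y => F (enorm y)) N1 N3.
Proof.
move=> A0 mF FA.
pose D := A * Lw (1 : R); have D0 : 0 <= D by rewrite mulr_ge0// (le_trans ler01)// Lw_ge1.
have mFe : measurable_fun [set: mR2] ((fun y => F (enorm y)) : mR2 -> R).
  exact: measurableT_comp mF (@measurable_enorm R).
have k1 (r : R) : 0 < r -> r < 1 -> 1 <= 3 * k32 1 r.
  move=> r0 r1; have : 2^-1 <= kr 1 r.
    by rewrite /kr lef_pV2 ?posrE ?mulr_gt0 ?addr_gt0//; nra.
  move=> h; have h2 : 2 / 3 <= Num.sqrt (kr 1 r).
    have p : 0 <= 2 / 3 :> R by lra.
    rewrite -(ler_pXn2r (n := 2)) ?nnegrE ?sqrtr_ge0//.
    by rewrite sqr_sqrtr ?kr_ge0 ?(ltW r0)// expr2; lra.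
  by rewrite /k32; nra.
have F3 (r : R) : 0 < r -> `|F r| ^+ 3 <= (12 * D ^+ 3 + 108 * A ^+ 3) * k32 1 r.
  move=> r0; have := FA r r0; have k0 := k32_ge0 1 r.
  have c0 : 0 <= (12 * D ^+ 3 + 108 * A ^+ 3) by rewrite addr_ge0// mulr_ge0// exprn_ge0.
  case: ltP => r1 h; last first.
    have -> : `|F r| = 0 by apply/eqP; rewrite eq_le h normr_ge0.
    by rewrite expr0n/= mulr_ge0.
  have s0 := sqrtr_ge0 (kr 1 r).
  have hL : `|F r| <= D + 3 * A * Num.sqrt (kr 1 r).
    apply: (le_trans h); rewrite /D.
    have := Lw_le (ltr01 : 0 < 1 :> R) r0; rewrite mul1r => hh.
    by apply: (le_trans (ler_wpM2l A0 hh)); rewrite le_eqVlt; apply/orP; left; apply/eqP; ring.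
  have sA0 : 0 <= 3 * A * Num.sqrt (kr 1 r) by rewrite !mulr_ge0.
  apply: (@le_trans _ _ ((D + 3 * A * Num.sqrt (kr 1 r)) ^+ 3)).
    by rewrite lerXn2r ?nnegrE// addr_ge0.
  apply: le_trans (cube_add D0 sA0) _.
  have -> : (3 * A * Num.sqrt (kr 1 r)) ^+ 3 = 27 * A ^+ 3 * k32 1 r.
    rewrite /k32 -{2}(@sqr_sqrtr _ (kr 1 r)) ?kr_ge0 ?(ltW r0)//; ring.
  have := k1 r r0 r1 => k1r.
  have : D ^+ 3 <= D ^+ 3 * (3 * k32 1 r) by rewrite ler_peMr// exprn_ge0.
  by move: (D ^+ 3) (A ^+ 3) (k32 1 r) => u v k hh; nra.
have F1 (r : R) : 0 < r -> `|F r| <= 3 * k32 1 r + (12 * D ^+ 3 + 108 * A ^+ 3) * k32 1 r.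
  move=> r0; have f3 := F3 r r0; have := FA r r0; have k0 := k32_ge0 1 r.
  have c0 : 0 <= (12 * D ^+ 3 + 108 * A ^+ 3) * k32 1 r.
    by rewrite mulr_ge0// addr_ge0// mulr_ge0// exprn_ge0.
  case: ltP => r1 h; last by rewrite (le_trans h)// addr_ge0// mulr_ge0.
  have := k1 r r0 r1; have [f1|f1] := leP `|F r| 1; first by lra.
  have : `|F r| <= `|F r| ^+ 3 by rewrite exprS ler_peMr// expr_ge1// ltW.
  by lra.
have c0 : 0 <= 12 * D ^+ 3 + 108 * A ^+ 3 by rewrite addr_ge0// mulr_ge0// exprn_ge0.
have i0 := ib_k32 (ltr01 : 0 < 1 :> R).
eexists; eexists; split => //.
- apply: ib_ae (ib_add (ib_scale (ler0n R 3) i0) (ib_scale c0 i0)).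
  + by apply: measurableT_comp mFe; exact: normr_measurable.
  + by move=> y; exact: normr_ge0.
  + apply: filterS (ae_neq (0 : R * R)) => y y0; apply: F1; rewrite enorm_gt0; exact/eqP.
- apply: ib_ae (ib_scale c0 i0).
  + by apply: measurable_funX; apply: measurableT_comp mFe; exact: normr_measurable.
  + by move=> y; rewrite exprn_ge0.
  + apply: filterS (ae_neq (0 : R * R)) => y y0; apply: F3; rewrite enorm_gt0; exact/eqP.
Qed.

End RadialL13.

(** * Trajectories relative to the origin *)

Section Flow.
Variable R : realType.

Lemma continuous_fst (d : R * R) : {for d, continuous (fun x : R * R => x.1)}.
Proof. by case: d => a b A hA; apply: (@cvg_fst _ _ (nbhs a) (nbhs b)). Qed.

Lemma continuous_snd (d : R * R) : {for d, continuous (fun x : R * R => x.2)}.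
Proof. by case: d => a b A hA; apply: (@cvg_snd _ _ (nbhs a) (nbhs b)). Qed.

Lemma is_derive_proj (f : R -> R * R) (t : R) (d : R * R) : is_derive t 1 f d ->
  is_derive t 1 (fun r => (f r).1) d.1 /\ is_derive t 1 (fun r => (f r).2) d.2.
Proof.
move=> [df fd].
have c : h^-1 *: ((f \o shift t) (h *: (1 : R)) - f t) @[h --> 0^'] --> d.
  by rewrite -fd; exact: df.
have c1 : h^-1 *: (((fun r => (f r).1) \o shift t) (h *: (1 : R)) - (f t).1) @[h --> 0^'] --> d.1.
  exact: (continuous_cvg _ (@continuous_fst d) c).
have c2 : h^-1 *: (((fun r => (f r).2) \o shift t) (h *: (1 : R)) - (f t).2) @[h --> 0^'] --> d.2.
  exact: (continuous_cvg _ (@continuous_snd d) c).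
split; apply: DeriveDef.
- by apply/cvg_ex; exists d.1.
- exact: cvg_lim c1.
- by apply/cvg_ex; exists d.2.
- exact: cvg_lim c2.
Qed.

Lemma within_continuous_proj (A : set R) (f : R -> R * R) :
  {within A, continuous f} ->
  {within A, continuous (fun r => (f r).1)} /\ {within A, continuous (fun r => (f r).2)}.
Proof.
move=> c; split => x.
- exact: (continuous_cvg _ (@continuous_fst (f x)) (c x)).
- exact: (continuous_cvg _ (@continuous_snd (f x)) (c x)).
Qed.

(** The mean value theorem for H - f and H + f. Derivatives are required in the open interval only,
    because the flow is merely continuous at time 0. *)
Lemma mvt_bound (f H df dH : R -> R) (a b : R) : a <= b ->
  {within `[a, b], continuous f} -> {within `[a, b], continuous H} ->
  (forall t, a < t < b -> is_derive t 1 f (df t)) ->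
  (forall t, a < t < b -> is_derive t 1 H (dH t)) ->
  (forall t, a < t < b -> `|df t| <= dH t) ->
  `|f b - f a| <= H b - H a.
Proof.
rewrite le_eqVlt => /predU1P[-> *|ab cf cH hf hH fH]; first by rewrite !subrr normr0.
have [c cab ec] : exists2 c, a < c < b & (H b - f b) - (H a - f a) = (dH c - df c) * (b - a).
  have hd x : x \in `]a, b[ -> is_derive x 1 (fun t => H t - f t) (dH x - df x).
    by rewrite in_itv/= => xab; apply: dD (hH _ xab) (dN (hf _ xab)).
  have cc : {within `[a, b], continuous (fun t => H t - f t)}.
    by move=> x; apply: cvgB; [exact: cH|exact: cf].
  by have [u uab eu] := MVT ab hd cc; exists u => //; move: uab; rewrite in_itv.
have [e eab ee] : exists2 c, a < c < b & (H b + f b) - (H a + f a) = (dH c + df c) * (b - a).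
  have hd x : x \in `]a, b[ -> is_derive x 1 (fun t => H t + f t) (dH x + df x).
    by rewrite in_itv/= => xab; apply: dD (hH _ xab) (hf _ xab).
  have cc : {within `[a, b], continuous (fun t => H t + f t)}.
    by move=> x; apply: cvgD; [exact: cH|exact: cf].
  by have [u uab eu] := MVT ab hd cc; exists u => //; move: uab; rewrite in_itv.
have ba : 0 <= b - a by rewrite subr_ge0 ltW.
have h1 : 0 <= (dH c - df c) * (b - a).
  by rewrite mulr_ge0//; have := fH c cab; rewrite ler_norml => /andP[]; lra.
have h2 : 0 <= (dH e + df e) * (b - a).
  by rewrite mulr_ge0//; have := fH e eab; rewrite ler_norml => /andP[]; lra.
rewrite ler_norml; apply/andP; split; lra.
Qed.

Lemma mvt_lip (f df : R -> R) (K a b : R) : a <= b ->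
  {within `[a, b], continuous f} ->
  (forall t, a < t < b -> is_derive t 1 f (df t)) ->
  (forall t, a < t < b -> `|df t| <= K) ->
  `|f b - f a| <= K * (b - a).
Proof.
move=> ab cf hf fK; rewrite mulrBr.
have hH (t : R) : is_derive t 1 (fun t : R => K * t) K.
  by eapply deq; [dauto|cbv beta; ring].
apply: (@mvt_bound f (fun t => K * t) df (fun=> K)) => //.
by apply: continuous_subspaceT => x; exact: dcont (hH x).
Qed.

End Flow.

Section Trajectories.
Variable R : realType.
Variables (w : R -> R * R -> R) (Phi : R -> R * R -> R * R) (T N1 N3 : R).
Hypothesis flow : flow_map w Phi.
Hypothesis inj : forall t : R, 0 <= t -> injective (Phi t).
Hypothesis wL : forall t : R, 0 <= t <= T -> L13 (w t) N1 N3.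
Local Notation mu2 := (@leb2 R).

Definition Umax : R := N1 + N3 + 64.
Definition Xt (a : R * R) (t : R) : R * R := Phi t a - Phi t 0.
Definition Nt (a : R * R) (t : R) : R := (Xt a t).1 ^+ 2 + (Xt a t).2 ^+ 2.

Lemma NtE (a : R * R) (t : R) : Nt a t = enorm (Xt a t) ^+ 2.
Proof. by rewrite enorm_sq. Qed.

Lemma Xt0 a : Xt a 0 = a.
Proof.
by rewrite /Xt; have [-> _ _] := flow a; have [-> _ _] := flow 0; rewrite subr0.
Qed.

Lemma Xt_neq0 (a : R * R) (t : R) : 0 <= t -> a != 0 -> Xt a t != 0.
Proof. by move=> t0; apply: contra; rewrite subr_eq0 => /eqP /(inj t0) ->. Qed.

Lemma Nt_gt0 (a : R * R) (t : R) : 0 <= t -> a != 0 -> 0 < Nt a t.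
Proof. by move=> t0 a0; rewrite NtE exprn_gt0// enorm_gt0 Xt_neq0. Qed.

Lemma sub_itv (a b : R) : 0 <= a -> b <= T -> `[a, b] `<=` (`[0, +oo[ : set R).
Proof.
move=> a0 _ x /=; rewrite !in_itv/= andbT => /andP[ax _]; exact: le_trans ax.
Qed.

Lemma disp (a : R * R) (t1 t2 : R) : 0 <= t1 -> t1 <= t2 -> t2 <= T ->
  `|(Phi t2 a).1 - (Phi t1 a).1| <= Umax * (t2 - t1) /\
  `|(Phi t2 a).2 - (Phi t1 a).2| <= Umax * (t2 - t1).
Proof.
move=> t10 t12 t2T; have [_ c d] := flow a.
have [c1 c2] := within_continuous_proj c.
have s12 := @sub_itv t1 t2 t10 t2T.
have dd (t : R) : t1 < t < t2 -> is_derive t 1 (fun r => Phi r a) (biot_savart (w t) (Phi t a)).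
  by move=> /andP[h _]; apply: d; exact: le_lt_trans h.
have bd (t : R) : t1 < t < t2 -> `|(biot_savart (w t) (Phi t a)).1| <= Umax /\
    `|(biot_savart (w t) (Phi t a)).2| <= Umax.
  move=> /andP[h1 h2]; apply: BS_bound; apply: wL; apply/andP; split.
    by apply: ltW; exact: le_lt_trans h1.
  by apply: ltW; exact: lt_le_trans t2T.
split.
- apply: (@mvt_lip _ (fun r => (Phi r a).1) (fun t => (biot_savart (w t) (Phi t a)).1)) => //.
  + exact: continuous_subspaceW s12 c1.
  + by move=> t /dd /is_derive_proj[].
  + by move=> t /bd[].
- apply: (@mvt_lip _ (fun r => (Phi r a).2) (fun t => (biot_savart (w t) (Phi t a)).2)) => //.
  + exact: continuous_subspaceW s12 c2.
  + by move=> t /dd /is_derive_proj[].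
  + by move=> t /bd[].
Qed.

Definition dX1 (a : R * R) (t : R) : R := (biot_savart (w t) (Phi t a)).1 - (biot_savart (w t) (Phi t 0)).1.
Definition dX2 (a : R * R) (t : R) : R := (biot_savart (w t) (Phi t a)).2 - (biot_savart (w t) (Phi t 0)).2.

Lemma Xt_derive (a : R * R) (t : R) : 0 < t ->
  is_derive t 1 (fun r => (Xt a r).1) (dX1 a t) /\
  is_derive t 1 (fun r => (Xt a r).2) (dX2 a t).
Proof.
move=> t0; have [_ _ /(_ t t0) /is_derive_proj [da1 da2]] := flow a.
have [_ _ /(_ t t0) /is_derive_proj [d01 d02]] := flow 0.
by split; [exact: dD da1 (dN d01)|exact: dD da2 (dN d02)].
Qed.

Lemma Xt_cont (a : R * R) (t1 t2 : R) : 0 <= t1 -> t2 <= T ->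
  {within `[t1, t2], continuous (fun r => (Xt a r).1)} /\
  {within `[t1, t2], continuous (fun r => (Xt a r).2)}.
Proof.
move=> t10 t2T; have s12 := @sub_itv t1 t2 t10 t2T.
have [_ ca _] := flow a; have [_ c0 _] := flow 0.
have [a1 a2] := within_continuous_proj (continuous_subspaceW s12 ca).
have [b1 b2] := within_continuous_proj (continuous_subspaceW s12 c0).
by split=> x; apply: cvgB; [exact: a1|exact: b1|exact: a2|exact: b2].
Qed.

Lemma Nt_cont (a : R * R) (t1 t2 : R) : 0 <= t1 -> t2 <= T -> {within `[t1, t2], continuous (Nt a)}.
Proof.
move=> t10 t2T; have [c1 c2] := @Xt_cont a t1 t2 t10 t2T.
have -> : Nt a = fun r => (Xt a r).1 * (Xt a r).1 + (Xt a r).2 * (Xt a r).2.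
  by apply/funext => r; rewrite /Nt !expr2.
by move=> x; apply: cvgD; apply: cvgM; [exact: c1|exact: c1|exact: c2|exact: c2].
Qed.

Definition dNt (a : R * R) (t : R) : R := 2 * ((Xt a t).1 * dX1 a t + (Xt a t).2 * dX2 a t).

Lemma Nt_derive (a : R * R) (t : R) : 0 < t -> is_derive t 1 (Nt a) (dNt a t).
Proof.
move=> /(Xt_derive a) [d1 d2]; rewrite /Nt.
have := dD (dX 1 d1) (dX 1 d2) => /deq; apply.
by rewrite /dNt; ring.
Qed.

Lemma dNtE (a : R * R) (t : R) : 0 <= t <= T -> dNt a t =
  2 * ((2 * pi)^-1 * \int[mu2]_y (Jker (Xt a t) y * w t (y + Phi t 0))).
Proof.
move=> /wL Lw; rewrite -(Du_dot (Phi t 0) (Xt a t) Lw) /dNt /dX1 /dX2.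
have -> : Phi t 0 + Xt a t = Phi t a by rewrite /Xt addrC subrK.
by [].
Qed.

(* The composition with [ln (1 + 1/N)] turns a bound on the radial velocity
   into a bound on the growth of [Zf]. *)
Definition ZN (N : R) : R := 1 + ln (1 + N^-1) / 2.

Lemma ZNt (a : R * R) (t : R) : ZN (Nt a t) = Zf (enorm (Xt a t)).
Proof. by rewrite NtE. Qed.

Definition dlnZ (a : R * R) (t : R) : R := (ZN (Nt a t))^-1 * ((1 + (Nt a t)^-1)^-1 * (- dNt a t / Nt a t ^+ 2) / 2).

Lemma lnZ_derive (a : R * R) (t : R) : 0 < t -> a != 0 ->
  is_derive t 1 (fun r => ln (ZN (Nt a r))) (dlnZ a t).
Proof.
move=> t0 a0; have N0 := Nt_gt0 (ltW t0) a0; have dN := Nt_derive a t0.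
have Z0 : 0 < ZN (Nt a t) by rewrite ZNt Zf_gt0.
have n0 : 0 < 1 + (Nt a t)^-1 by rewrite addr_gt0// invr_gt0.
eapply deq.
  by rewrite /ZN; dauto; rewrite ?gt_eqF.
by rewrite /dlnZ; congr (_ * _); rewrite add0r mulr0 add0r /ZN; ring.
Qed.

(** The derivative of ln Z equals - N' / (2 N (N + 1) Z), so a strain bound |X|^2 D Z turns into the
    bound D. *)
Lemma dlnZ_le (a : R * R) (t : R) : 0 <= t -> a != 0 -> `|dlnZ a t| <= `|dNt a t| / (2 * Nt a t * ZN (Nt a t)).
Proof.
move=> t0 a0; have N0 := Nt_gt0 t0 a0; have Z0 : 0 < ZN (Nt a t) by rewrite ZNt Zf_gt0.
rewrite /dlnZ; set N := Nt a t in N0 Z0 *; set Z := ZN N in Z0 *; set d := dNt a t.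
have -> : Z^-1 * ((1 + N^-1)^-1 * (- d / N ^+ 2) / 2) = - (d * (2 * N * (N + 1) * Z)^-1).
  by field; rewrite !gt_eqF// addr_gt0.
have p0 : 0 < 2 * N * Z by rewrite !mulr_gt0.
have p1 : 2 * N * Z <= 2 * N * (N + 1) * Z.
  by rewrite ler_pM2r// ler_peMr ?mulr_ge0 ?(ltW N0)//; lra.
rewrite normrN normrM ler_wpM2l// gtr0_norm ?invr_gt0 ?(lt_le_trans p0)//.
by rewrite lef_pV2 ?posrE// (lt_le_trans p0).
Qed.

Lemma lnZ_cont (a : R * R) (t1 t2 : R) : 0 <= t1 -> t2 <= T -> a != 0 ->
  {within `[t1, t2], continuous (fun r => ln (ZN (Nt a r)))}.
Proof.
move=> t10 t2T a0; have cN := @Nt_cont a t1 t2 t10 t2T.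
apply/subspace_continuousP => x xI.
have x0 : 0 <= x by move: xI; rewrite /= in_itv/= => /andP[h _]; exact: le_trans h.
have N0 := Nt_gt0 x0 a0.
have cx : {for Nt a x, continuous (fun N => ln (ZN N))}.
  have n0 : 0 < 1 + (Nt a x)^-1 by rewrite addr_gt0// invr_gt0.
  have Z0 : 0 < ZN (Nt a x) by rewrite ZNt Zf_gt0.
  suff [d dd] : exists d, is_derive (Nt a x) 1 (fun N => ln (ZN N)) d by exact: dcont dd.
  by eexists; rewrite /ZN; dauto; rewrite ?gt_eqF.
move/subspace_continuousP : cN => /(_ x xI) cN.
exact: (cvg_comp _ _ cN cx).
Qed.

End Trajectories.

(** * Boundedness of the perturbation *)

Section Bounded.
Variable R : realType.
Local Notation mR := (measurableTypeR R).
Local Notation mR2 := (mR * mR)%type.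
Local Notation mu2 := (@leb2 R).

Lemma ae_mpres S (P : R * R -> Prop) : mpres S -> {ae mu2, forall x, P x} ->
  {ae mu2, forall y, P (S y)}.
Proof.
move=> [mS pS] [A [mA A0 PA]]; exists (S @^-1` A); split.
- by rewrite -[X in measurable X]setTI; exact: mS.
- by rewrite pS.
- by move=> y /= nP; exact: PA.
Qed.

Lemma ib_Lnorm (f : R * R -> R) (n : nat) (C : R) : (0 < n)%N ->
  measurable_fun [set: mR2] (f : mR2 -> R) -> 0 <= C ->
  (Lnorm mu2 n%:R%:E (EFin \o f) <= C%:E)%E ->
  ib (fun y => `|f y| ^+ n) (C ^+ n).
Proof.
move=> n0 mf C0 h; split.
- by apply: measurable_funX; apply: measurableT_comp mf; exact: normr_measurable.
- by move=> y; rewrite exprn_ge0.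
- have nR : n%:R != 0 :> R by rewrite pnatr_eq0 -lt0n.
  have e := powR_Lnorm mu2 (EFin \o f) nR.
  have -> : (\int[mu2]_y (`|f y| ^+ n)%:E = \int[mu2]_y (`|(EFin \o f) y| `^ n%:R))%E.
    by apply: eq_integral => y _; rewrite /= ?poweR_EFin powR_mulrn.
  rewrite -e -powR_mulrn// -poweR_EFin.
  by apply: gt0_ler_poweR => //; rewrite in_itv/= ?Lnorm_ge0 ?lee_fin ?leey ?C0 //.
Qed.

Variables (s : R -> R) (g0 : R * R -> R).
Hypothesis s_smooth : smooth_on [set~ (0 : R * R)] (loglog_vortex s).
Hypothesis g0_le1 : forall x, `|g0 x| <= 1.
Hypothesis g0_supp : forall x, 3 <= enorm x -> g0 x = 0.
Local Notation v := (fun x => loglog_vortex s x + g0 x).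

Variables (w : R -> R * R -> R) (Phi : R -> R * R -> R * R) (T : R).
Hypothesis T0 : 0 < T.
Hypothesis sol : euler_solution v w Phi.

Lemma w_measurable t : 0 <= t -> measurable_fun [set: mR2] (w t : mR2 -> R).
Proof.
move=> t0; have [[mw _] _ _ _] := sol.
pose D : set (mR * mR2)%type := `[0%R, +oo[%classic `*` setT.
have md : measurable D by apply: measurableX => //; exact: measurable_itv.
apply: (measurable_comp (F := D) md _ mw (g := fun x : mR2 => (t, x))).
  by move=> _ [x _ <-] /=; split => //=; rewrite in_itv/= andbT.
exact: measurable_pair1.
Qed.

Lemma w_moments : exists2 C0 : R, 0 < C0 & forall t, 0 <= t <= T ->
  forall n : nat, (0 < n)%N -> ib (fun y => `|w t y| ^+ n) ((C0 * (1 + ln n%:R)) ^+ n).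
Proof.
have [[_ /(_ T T0) [C hC]] _ _ _] := sol.
exists (Num.max C 1); first by rewrite lt_max ltr01 orbT.
move=> t tT n n0; have n1 : 1 <= n%:R :> R by rewrite ler1n.
have ln1 : 1 <= 1 + ln n%:R :> R by rewrite lerDl ln_ge0.
apply: ib_Lnorm => //.
- by apply: w_measurable; case/andP: tT.
- by rewrite mulr_ge0 ?le_max ?ler01 ?orbT//; lra.
- apply: le_trans (hC t n%:R tT n1) _; rewrite lee_fin ler_wpM2r ?le_max ?lexx//; lra.
Qed.

Lemma Phi_inj t : 0 <= t -> injective (Phi t).
Proof. by move=> t0; have [_ _ _ /(_ t t0) [Psi [c _ _]]] := sol; exact: can_inj c. Qed.

Lemma Phi_flow : flow_map w Phi.
Proof. by case: sol. Qed.

Section WithMoments.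
Variable C0 : R.
Hypothesis C00 : 0 < C0.
Hypothesis moments : forall t : R, 0 <= t <= T ->
  forall n : nat, (0 < n)%N -> ib (fun y => `|w t y| ^+ n) ((C0 * (1 + ln n%:R)) ^+ n).

Let N1 := (C0 * (1 + ln 1%:R)) ^+ 1.
Let N3 := (C0 * (1 + ln 3%:R)) ^+ 3.
Let U := Umax N1 N3.
(** Each coordinate of a particle moves by at most U T, so a particle and the origin each move by at
    most 2 U T in the Euclidean norm; 3 is the initial radius. *)
Definition supp_radius : R := 3 + 4 * (U * T).
Let b := supp_radius.

Lemma w_L13 t : 0 <= t <= T -> L13 (w t) N1 N3.
Proof.
move=> tT; split.
- by apply: w_measurable; case/andP: tT.
- by have := moments tT (ltn0Sn 0); congr ib; apply/funext => y; rewrite expr1.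
- exact (@moments t tT 3%N isT).
Qed.

Lemma U_ge0 : 0 <= U.
Proof.
have [_ i1 i3] := @w_L13 0 (introT andP (conj (lexx 0) (ltW T0))).
by rewrite /U /Umax !addr_ge0// ?(ib_ge0 i1) ?(ib_ge0 i3).
Qed.

Lemma b_ge3 : 3 <= b.
Proof. by rewrite /b /supp_radius lerDl mulr_ge0// mulr_ge0 ?U_ge0// ltW. Qed.

Lemma Phi_disp a t : 0 <= t <= T -> enorm (Phi t a - a) <= 2 * (U * t).
Proof.
move=> /andP[t0 tT]; have [p0 _ _] := Phi_flow a.
have [h1 h2] := disp Phi_flow w_L13 a (lexx 0) t0 tT.
rewrite subr0 p0 in h1 h2.
apply: le_trans (enorm_le_sup _) _; rewrite ler_pM2l//.
by rewrite ge_max; apply/andP; split.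
Qed.

Lemma w_centered t : 0 <= t <= T -> exists Psi : R * R -> R * R,
  [/\ cancel (Phi t) Psi, cancel Psi (Phi t) &
   {ae mu2, forall y, w t (y + Phi t 0) = v (Psi (y + Phi t 0))}].
Proof.
move=> /andP[t0 tT]; have [_ _ _ /(_ t t0) [Psi [c1 c2 h]]] := sol.
exists Psi; split => //.
exact: (ae_mpres (mpres_add (Phi t 0)) (P := fun x => w t x = v (Psi x))).
Qed.

Lemma profile_ge1 r : 1 <= r -> profile s r = 0.
Proof.
by move=> r1; apply: profile_hi; apply: lt_le_trans r1; rewrite expR_lt1; lra.
Qed.

Lemma w_supp t : 0 <= t <= T -> {ae mu2, forall y, b <= enorm y -> w t (y + Phi t 0) = 0}.
Proof.
move=> tT; have [Psi [c1 c2 h]] := w_centered tT.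
apply: filterS h => y -> yb; set x := y + Phi t 0.
have d1 := Phi_disp (Psi x) tT; rewrite c2 in d1.
have d0 := Phi_disp 0 tT; rewrite subr0 in d0.
have ut : U * t <= U * T by rewrite ler_wpM2l ?U_ge0//; case/andP: tT.
have x3 : 3 <= enorm (Psi x).
  have := enorm_triangle (x - Psi x) (Psi x); rewrite subrK.
  have := enorm_triangle x (- Phi t 0); rewrite enormN /x addrK.
  by move: yb; rewrite /b /supp_radius; lra.
rewrite vortexE profile_ge1 ?g0_supp ?addr0//; lra.
Qed.

Let CYb := CY b C0.

Lemma b_gt0 : 0 < b. Proof. by have := b_ge3; lra. Qed.

Lemma ln2b_ge0 : 0 <= ln (2 + b).
Proof. by rewrite ln_ge0//; have := b_ge3; lra. Qed.

Lemma CYb_ge0 : 0 <= CYb.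
Proof.
have l8 : 0 <= ln 8 :> R by rewrite ln_ge0//; lra.
have e0 : 0 < expR 1 :> R := expR_gt0 1.
have l2 := ln2b_ge0.
have eC : 0 <= expR 1 * C0 by apply: mulr_ge0; exact: ltW.
have H (u p x : R) : 0 <= u -> 0 <= p -> 0 <= x ->
    0 <= 2 * (u * (1 + p) * (32 * (x + 1)) + 216 * u ^+ 3 + 256).
  move=> u0 p0 x0; have h1 : 0 <= u * (1 + p) * (x + 1).
    by rewrite mulr_ge0 ?mulr_ge0 ?addr_ge0.
  have h2 : 0 <= u ^+ 3 by exact: exprn_ge0.
  rewrite [X in X + _ + _](_ : _ = 32 * (u * (1 + p) * (x + 1))); last by ring.
  by move: h1 h2; move: (u * _ * _) (u ^+ 3) => y z; lra.
exact: H eC l8 l2.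
Qed.

Lemma dlnZ_bound (a : R * R) (t D : R) : 0 <= t <= T -> a != 0 ->
  `|\int[mu2]_y (Jker (Xt Phi a t) y * w t (y + Phi t 0))| <=
     enorm (Xt Phi a t) ^+ 2 * (D * Zf (enorm (Xt Phi a t))) ->
  `|dlnZ w Phi a t| <= D.
Proof.
move=> tT a0 h; have t0 : 0 <= t by case/andP: tT.
have N0 := Nt_gt0 Phi_inj t0 a0.
have Z0 : 0 < ZN (Nt Phi a t) by rewrite ZNt Zf_gt0.
apply: le_trans (dlnZ_le _ Phi_inj t0 a0) _.
rewrite ler_pdivrMr ?mulr_gt0//.
rewrite (dNtE Phi w_L13 a tT) !normrM (gtr0_norm (ltr0n _ 2)) (gtr0_norm (pi2_inv R).1).
rewrite ZNt NtE in Z0 *.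
apply: (@le_trans _ _ (2 * (enorm (Xt Phi a t) ^+ 2 * (D * Zf (enorm (Xt Phi a t)))))).
  rewrite ler_pM2l//; apply: le_trans h.
  by rewrite ler_piMl// (pi2_inv R).2.
by rewrite le_eqVlt; apply/orP; left; apply/eqP; ring.
Qed.

Definition Lt (a : R * R) (t : R) : R := Lw (enorm (Xt Phi a t)).

Lemma dlnZ_apriori (a : R * R) t : 0 <= t <= T -> a != 0 -> `|dlnZ w Phi a t| <= CYb * Lt a t.
Proof.
move=> tT a0; apply: dlnZ_bound => //.
have t0 : 0 <= t by case/andP: tT.
apply: le_trans (J_yudovich_le (Xt_neq0 Phi_inj t0 a0) b_gt0 C00
  (L13_shift (Phi t 0) (w_L13 tT)) _ (w_supp tT)) _.
  move=> n n0; exact: (ib_mpres (mpres_add (Phi t 0)) (moments tT n0)).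
by rewrite le_eqVlt; apply/orP; left; apply/eqP; rewrite /Lt /CYb; ring.
Qed.

Lemma LtE a t : Lt a t = 1 + ln (ZN (Nt Phi a t)).
Proof. by rewrite /Lt ZNt. Qed.

Lemma Lt_ge1 a t : 1 <= Lt a t. Proof. exact: Lw_ge1. Qed.

(** Gronwall's inequality in logarithmic form: the a priori bound says |L'| <= C L, so ln L is
    Lipschitz in time. *)
Lemma Lt_compare (a : R * R) t : 0 <= t <= T -> a != 0 ->
  `|ln (Lt a t) - ln (Lt a 0)| <= CYb * t.
Proof.
move=> /andP[t0 tT] a0.
have tt (u : R) : 0 < u < t -> 0 <= u <= T.
  by case/andP=> u0 ut; rewrite (ltW u0) (le_trans (ltW ut)).
rewrite -[t in X in _ <= X]subr0.
pose f u := ln (1 + ln (ZN (Nt Phi a u))).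
have fE u : f u = ln (Lt a u) by rewrite LtE.
rewrite -!fE.
apply: (@mvt_lip _ f (fun u => (Lt a u)^-1 * dlnZ w Phi a u)) => //.
- have cZ := lnZ_cont Phi_flow Phi_inj (lexx 0) tT a0.
  apply/subspace_continuousP => x xI; move/subspace_continuousP: cZ => /(_ x xI) cZ.
  have L0 : 0 < 1 + ln (ZN (Nt Phi a x)) by rewrite -LtE; have := Lt_ge1 a x; lra.
  have cx : {for ln (ZN (Nt Phi a x)), continuous (fun z : R => ln (1 + z))}.
    suff [d dd] : exists d, is_derive (ln (ZN (Nt Phi a x))) 1 (fun z : R => ln (1 + z)) d by exact: dcont dd.
    by eexists; dauto; exact: L0.
  exact: (cvg_comp _ _ cZ cx).
- move=> u ut; have /andP[u0 _] := ut.
  have L0 : 0 < 1 + ln (ZN (Nt Phi a u)) by rewrite -LtE; have := Lt_ge1 a u; lra.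
  have d := lnZ_derive Phi_flow Phi_inj u0 a0.
  have dd := @dln _ (fun r => 1 + ln (ZN (Nt Phi a r))) _ _ L0 (dD (is_derive_cst (1 : R) u 1) d).
  by apply: (deq dd); rewrite add0r LtE.
- move=> u ut; have uT := tt u ut; have L1 := Lt_ge1 a u.
  have L0 : 0 < Lt a u by lra.
  rewrite normrM gtr0_norm ?invr_gt0// mulrC ler_pdivrMr//.
  exact: dlnZ_apriori.
Qed.

Let kap := expR (CYb * T).

Lemma kap_ge1 : 1 <= kap.
Proof. by rewrite /kap -[X in X <= _]expR0 ler_expR mulr_ge0 ?CYb_ge0// ltW. Qed.

Lemma Lt_kap (a : R * R) t : 0 <= t <= T -> a != 0 ->
  Lt a t <= kap * Lt a 0 /\ Lt a 0 <= kap * Lt a t.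
Proof.
move=> tT a0; have := Lt_compare tT a0; have /andP[t0 tT'] := tT.
have ct : CYb * t <= CYb * T by rewrite ler_wpM2l// CYb_ge0.
rewrite ler_norml => /andP[h1 h2].
have L0 u : 0 < Lt a u by have := Lt_ge1 a u; lra.
have k0 : 0 < kap by have := kap_ge1; lra.
split; rewrite -ler_ln ?posrE ?mulr_gt0// lnM ?posrE// /kap expRK; move: h1 h2 ct;
  by move: (ln _) (ln _) (_ * t) (_ * T) => *; lra.
Qed.

Lemma Lt0E (a : R * R) : Lt a 0 = Lw (enorm a).
Proof. by rewrite /Lt (Xt0 Phi_flow). Qed.

Variable C1 : R.
Hypothesis C1_ge0 : 0 <= C1.
Hypothesis hC1 : forall r : R, 0 < r -> `|profile s r - ln (Zf r)| <= C1.

(* As [Lt] = 1 + ln Z, this bounds the drift of ln Z along all trajectories. *)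
Definition drift_le (lam A B : R) : Prop := forall (a : R * R) (t : R), 0 <= t <= T -> a != 0 ->
  `|Lt a t - Lt a 0| <= expR (lam * t) * (A + B * Lt a 0).

Lemma C12_ge0 : 0 <= 2 * C1 + 1.
Proof. by rewrite addr_ge0 ?mulr_ge0. Qed.

(** Transport turns the drift of ln Z into a change of the vortex value: 2 C1 pays for replacing the
    profile by ln Z at both ends and 1 for [g0]. The factor [kap] passes from the weight at the
    initial position to the weight at the present one. *)
Lemma drift_le_ae lam A B t : 0 <= A -> 0 <= B -> drift_le lam A B -> 0 <= t <= T ->
  {ae mu2, forall y, `|w t (y + Phi t 0) - profile s (enorm y)| <=
    if enorm y < b then (2 * C1 + 1 + expR (lam * t) * A) +
      (expR (lam * t) * (B * kap)) * Lw (enorm y) else 0}.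
Proof.
move=> A0 B0 h tT; have [Psi [c1 c2 hae]] := w_centered tT.
apply: filterS3 (ae_neq 0) hae (w_supp tT) => y y0 hy sy.
have [yb|yb] := ltP (enorm y) b; last first.
  by rewrite sy// profile_ge1 ?subrr ?normr0//; have := b_ge3; lra.
rewrite hy; set a := Psi _.
have Xa : Xt Phi a t = y by rewrite /Xt /a c2 addrK.
have a0 : a != 0.
  by apply/eqP => ea; apply: y0; rewrite -Xa ea /Xt subrr.
have r0 : 0 < enorm y by rewrite enorm_gt0; apply/eqP.
have q0 : 0 < enorm a by rewrite enorm_gt0.
have := h a t tT a0; have [_ hk] := Lt_kap tT a0.
have e0 := expR_gt0 (lam * t).
have : B * Lt a 0 <= B * (kap * Lt a t) by rewrite ler_wpM2l.
rewrite -(ler_pM2l e0).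
have := hC1 r0; have := hC1 q0; have := g0_le1 a.
rewrite Lt0E /Lt Xa vortexE /Lw.
rewrite !ler_norml => /andP[? ?] /andP[? ?] /andP[? ?] ? /andP[? ?].
by apply/andP; split; lra.
Qed.

Let E := CE b.

Lemma CE_gt0 : 0 < E.
Proof. by rewrite /E /CE; have := ln2b_ge0; lra. Qed.

(** Integrating exp(lam u) in time gains 1/lam, which cancels E and the two factors [kap] of the
    feedback and leaves 1/2. [K] is the time integral over [0,T] of the part that does not depend on
    the drift. *)
Let lam := 2 * (E * kap ^+ 2).
Let K := E * (2 * C1 + 1) * T.

Lemma dlnZ_drift A B (a : R * R) t : 0 <= A -> 0 <= B -> drift_le lam A B -> 0 <= t <= T ->
  a != 0 ->
  `|dlnZ w Phi a t| <= E * (2 * C1 + 1) + expR (lam * t) * (E * (A + B * kap ^+ 2 * Lt a 0)).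
Proof.
move=> A0 B0 h tT a0; have t0 : 0 <= t by case/andP: tT.
have E0 := CE_gt0; have k1 := kap_ge1; have e0 := expR_gt0 (lam * t).
have k0 : 0 <= kap by lra.
have C10 : 0 <= 2 * C1 + 1 by rewrite addr_ge0 ?mulr_ge0.
set A' := 2 * C1 + 1 + expR (lam * t) * A.
set B' := expR (lam * t) * (B * kap).
have A'0 : 0 <= A' by rewrite addr_ge0// mulr_ge0// ltW.
have B'0 : 0 <= B' by rewrite mulr_ge0 ?mulr_ge0// ltW.
have [N1' [N3' Lp]] : exists N1 N3, L13 (fun y => profile s (enorm y)) N1 N3.
  apply: (@L13_radial _ _ (C1 + 1)); first by rewrite addr_ge0.
    exact: measurable_profile.
  move=> r r0; apply: le_trans (profile_le hC1 r0) _.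
  by case: ifP => // _; rewrite mulrDl mul1r lerD2r ler_peMr// Lw_ge1.
have b1 : `|dlnZ w Phi a t| <= E * (A' + B' * Lt a t).
  apply: dlnZ_bound => //.
  apply: le_trans (J_weight_le (Xt_neq0 Phi_inj t0 a0) b_gt0 A'0 B'0
    (L13_shift (Phi t 0) (w_L13 tT)) (measurable_profile s_smooth) Lp (drift_le_ae A0 B0 h tT)) _.
  by rewrite le_eqVlt; apply/orP; left; apply/eqP; rewrite /Lt /E; ring.
apply: le_trans b1 _.
have [hk _] := Lt_kap tT a0.
have : B' * Lt a t <= B' * (kap * Lt a 0) by rewrite ler_wpM2l.
rewrite -(ler_pM2l E0) => hB.
rewrite [X in X <= _]mulrDr; apply: le_trans (lerD (lexx _) hB) _.
by rewrite le_eqVlt; apply/orP; left; apply/eqP; rewrite /A' /B'; ring.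
Qed.

Lemma lam_gt0 : 0 < lam.
Proof.
have kk : 0 < kap ^+ 2 by rewrite exprn_gt0// (lt_le_trans ltr01)// kap_ge1.
by rewrite /lam; apply: mulr_gt0 => //; apply: mulr_gt0 => //; exact: CE_gt0.
Qed.

(** One round of feedback as a contraction in a norm with exponential weight in time: [dlnZ_drift]
    is integrated from 0 to t. *)
Lemma drift_le_step A B : 0 <= A -> 0 <= B -> drift_le lam A B ->
  drift_le lam (K + A / 2) (B / 2).
Proof.
move=> A0 B0 h a t /andP[t0 tT] a0.
have E0 := CE_gt0; have k1 := kap_ge1; have l0 := lam_gt0.
have L1 := Lt_ge1 a 0; have L0 : 0 <= Lt a 0 by lra.
set S := E * (A + B * kap ^+ 2 * Lt a 0).
have S0 : 0 <= S.
  by rewrite mulr_ge0 ?(ltW E0)// addr_ge0// !mulr_ge0// ?exprn_ge0//; lra.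
have kE : E * (2 * C1 + 1) * t <= K.
  by rewrite /K ler_wpM2l// mulr_ge0 ?(ltW E0) ?C12_ge0.
pose H u := E * (2 * C1 + 1) * u + lam^-1 * S * expR (lam * u).
have dH (u : R) : is_derive u 1 H (E * (2 * C1 + 1) + expR (lam * u) * S).
  rewrite /H; eapply deq; first by dauto.
  by cbv beta; field; rewrite gt_eqF.
have bd : `|ln (ZN (Nt Phi a t)) - ln (ZN (Nt Phi a 0))| <= H t - H 0.
  apply: (@mvt_bound _ (fun u => ln (ZN (Nt Phi a u))) H (dlnZ w Phi a)
    (fun u => E * (2 * C1 + 1) + expR (lam * u) * S)) => //.
  - by have := lnZ_cont Phi_flow Phi_inj (lexx 0) tT a0; apply.
  - by apply: continuous_subspaceT => x; exact: dcont (dH x).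
  - by move=> u /andP[u0 _]; have := lnZ_derive Phi_flow Phi_inj u0 a0; apply.
  - move=> u /andP[u0 ut]; apply: dlnZ_drift => //.
    by rewrite (ltW u0) (le_trans (ltW ut)).
have -> : Lt a t - Lt a 0 = ln (ZN (Nt Phi a t)) - ln (ZN (Nt Phi a 0)).
  by rewrite !LtE opprD addrACA subrr add0r.
apply: le_trans bd _.
have e1 : 1 <= expR (lam * t) by rewrite -[X in X <= _]expR0 ler_expR mulr_ge0// ltW.
have SE : lam^-1 * S <= A / 2 + B / 2 * Lt a 0.
  rewrite mulrC ler_pdivrMr// /S /lam -subr_ge0.
  rewrite (_ : _ - _ = E * A * (kap ^+ 2 - 1)); last by field.
  by rewrite !mulr_ge0 ?(ltW E0)// subr_ge0 expr_ge1//; lra.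
have iS : 0 <= lam^-1 * S by rewrite mulr_ge0// invr_ge0 ltW.
have K0 : 0 <= K by apply: le_trans kE; rewrite mulr_ge0 ?mulr_ge0 ?(ltW E0) ?C12_ge0.
rewrite /H !mulr0 expR0 mulr1 add0r.
have : lam^-1 * S * expR (lam * t) <= (A / 2 + B / 2 * Lt a 0) * expR (lam * t).
  by rewrite ler_wpM2r// ltW// expR_gt0.
have : K <= K * expR (lam * t) by rewrite ler_peMr.
by move: kE iS; move: (expR _) (lam^-1 * S) (Lt a 0) => *; lra.
Qed.

Lemma K_ge0 : 0 <= K.
Proof. by rewrite /K mulr_ge0 ?mulr_ge0 ?(ltW CE_gt0) ?(ltW T0) ?C12_ge0. Qed.

(** 2 K is the fixed point of A -> K + A/2, so only the second coefficient changes; it starts at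
    [kap] by the Gronwall bound. *)
Lemma drift_le_iter n : drift_le lam (2 * K) (kap / 2 ^+ n).
Proof.
have K0 := K_ge0; have k1 := kap_ge1.
elim: n => [|n IH].
  move=> a t tT a0; rewrite expr0 divr1.
  have [h1 _] := Lt_kap tT a0; have L1 := Lt_ge1 a t; have L2 := Lt_ge1 a 0.
  have e1 : 1 <= expR (lam * t).
    by rewrite -[X in X <= _]expR0 ler_expR mulr_ge0 ?(ltW lam_gt0)//; case/andP: tT.
  have k0 : 0 <= kap by exact: le_trans ler01 k1.
  have l0 : 0 <= Lt a 0 by exact: le_trans ler01 L2.
  have kl : 0 <= kap * Lt a 0 by exact: mulr_ge0.
  have kL : 0 <= 2 * K + kap * Lt a 0 by apply: addr_ge0 => //; exact: mulr_ge0.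
  apply: le_trans (ler_peMl kL e1).
  have kl' : Lt a 0 <= kap * Lt a 0 by rewrite ler_peMl.
  have H (k x y z : R) : 0 <= k -> 0 <= y -> 1 <= z -> y <= x -> z <= x -> `|z - y| <= 2 * k + x.
    by move=> *; rewrite ler_norml; apply/andP; split; lra.
  exact: H.
have := drift_le_step (A := 2 * K) (B := kap / 2 ^+ n).
rewrite (_ : K + 2 * K / 2 = 2 * K); last by field.
have -> : kap / 2 ^+ n.+1 = kap / 2 ^+ n / 2 by rewrite exprSr invfM mulrA.
have k0 : 0 <= kap by exact: le_trans ler01 k1.
by apply => //; [rewrite mulr_ge0|rewrite divr_ge0// exprn_ge0].
Qed.

Lemma le_geometric_limit (x y c : R) : (forall n, x <= y + c / 2 ^+ n) -> x <= y.
Proof.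
move=> h; rewrite leNgt; apply/negP => yx.
have d0 : 0 < x - y by rewrite subr_gt0.
pose n := (Num.truncn (`|c| / (x - y))).+1.
have hn : `|c| / (x - y) < n%:R by exact: truncnS_gt.
have n2 : n%:R <= 2 ^+ n :> R by rewrite -natrX ler_nat ltnW// ltn_expl.
have p0 : 0 < 2 ^+ n :> R by exact: exprn_gt0.
have := h n; rewrite -lerBlDl ler_pdivlMr// leNgt => /negP; apply.
apply: le_lt_trans (ler_norm c) _; rewrite mulrC -ltr_pdivrMr//.
exact: lt_le_trans n2.
Qed.

Lemma drift_le_limit : drift_le lam (2 * K) 0.
Proof.
move=> a t tT a0; rewrite mul0r addr0.
apply: (@le_geometric_limit _ _ (expR (lam * t) * kap * Lt a 0)) => n.
apply: le_trans (drift_le_iter n tT a0) _.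
by rewrite le_eqVlt; apply/orP; left; apply/eqP; ring.
Qed.

Lemma perturbation_bounded : exists2 M : R, 0 <= M & forall t, 0 <= t <= T ->
  {ae mu2, forall y, `|w t (y + Phi t 0) - profile s (enorm y)| <=
    if enorm y < b then M else 0}.
Proof.
have K0 : 0 <= 2 * K by have := K_ge0; lra.
have l0 := lam_gt0.
exists (2 * C1 + 1 + expR (lam * T) * (2 * K)).
  by rewrite addr_ge0 ?C12_ge0// mulr_ge0 ?expR_ge0.
move=> t tT; apply: filterS (drift_le_ae K0 (lexx 0) drift_le_limit tT) => y.
move=> /le_trans; apply; case: ifP => // _; rewrite mul0r mulr0 mul0r addr0.
rewrite lerD2l ler_wpM2r// ler_expR ler_wpM2l ?(ltW l0)//.
by case/andP: tT.
Qed.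

End WithMoments.
End Bounded.

(** * Existence of the decomposition *)

Section Decomposition.
Variable R : realType.
Local Notation mR := (measurableTypeR R).
Local Notation mR2 := (mR * mR)%type.
Local Notation mu2 := (@leb2 R).

Lemma euler_a_priori (s : R -> R) (g0 : R * R -> R) w Phi (T : R) :
  smooth_on [set~ (0 : R * R)] (loglog_vortex s) ->
  (forall x, `|g0 x| <= 1) -> (forall x, 3 <= enorm x -> g0 x = 0) -> 0 < T ->
  euler_solution (fun x => loglog_vortex s x + g0 x) w Phi ->
  exists N1 N3 b M U : R, [/\ 3 <= b, 0 <= M,
    forall (a : R * R) (t : R), 0 <= t <= T -> enorm (Phi t a - a) <= U * t,
    forall t, 0 <= t <= T -> L13 (w t) N1 N3 &
    forall t, 0 <= t <= T -> {ae mu2, forall y,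
      `|w t (y + Phi t 0) - profile s (enorm y)| <= if enorm y < b then M else 0}].
Proof.
move=> ss g1 g3 T0 sol; have [C0 C00 hm] := w_moments T0 sol.
have [C1 C10 hC1] := profile_Zf ss.
have [M M0 hM] := perturbation_bounded ss g1 g3 T0 sol C00 hm C10 hC1.
eexists; eexists; exists (supp_radius T C0), M; eexists; split => //.
- exact: (b_ge3 T0 sol hm).
- by move=> a t tT; have h := Phi_disp sol hm a tT; rewrite mulrA in h; exact: h.
- exact: (w_L13 sol hm).
Qed.

Lemma Lnorm_oo_le (f : R * R -> R) (M : R) : 0 <= M ->
  {ae mu2, forall x, `|f x| <= M} -> (Lnorm mu2 +oo (EFin \o f) <= M%:E)%E.
Proof.
move=> M0 h; rewrite unlock /Lnorm; case: ifP => _; last by rewrite lee_fin.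
by apply/ess_supP; apply: filterS h => x hx; rewrite /= lee_fin.
Qed.

(** The difference itself serves as g. Its joint measurability uses the continuity of the trajectory
    of the origin. *)
Lemma vortex_decomposition_exists (s : R -> R) (g0 : R * R -> R) w Phi (T : R) :
  smooth_on [set~ (0 : R * R)] (loglog_vortex s) ->
  (forall x, `|g0 x| <= 1) -> (forall x, 3 <= enorm x -> g0 x = 0) -> 0 < T ->
  euler_solution (fun x => loglog_vortex s x + g0 x) w Phi ->
  exists g, vortex_decomposition s T w Phi g.
Proof.
move=> ss g1 g3 T0 sol.
have [N1 [N3 [b [M [U [b3 M0 _ wL hM]]]]]] := euler_a_priori ss g1 g3 T0 sol.
exists (fun t x => w t x - loglog_vortex s (x - Phi t 0)); split.
  by move=> t _; apply: aeW => x; rewrite addrC subrK.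
split.
  pose D : set (mR * mR2)%type := `[0%R, T]%classic `*` setT.
  have md : measurable D by apply: measurableX => //; exact: measurable_itv.
  have sT : `[0, T] `<=` (`[0, +oo[ : set R).
    by move=> x; rewrite /= !in_itv/= andbT => /andP[].
  have mfst : measurable_fun D (fun z : mR * mR2 => z.1) by exact: measurable_funTS measurable_fst.
  have m2 : measurable_fun D (fun z : mR * mR2 => z.2) by exact: measurable_funTS measurable_snd.
  have mphi (h : R -> R) : {within `[0, +oo[, continuous h} ->
      measurable_fun D (fun z : mR * mR2 => (h z.1 : mR)).
    move=> ch.
    apply: (measurable_comp (F := (`[0, T]%classic : set mR)) _ _ _ mfst (f := h)).
    - exact: measurable_itv.
    - by move=> _ [[t x] [/= tT _] <-].
    - apply: subspace_continuous_measurable_fun; first exact: measurable_itv.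
      exact: continuous_subspaceW sT ch.
  have [_ c _] := Phi_flow sol 0.
  have [c1 c2] := within_continuous_proj c.
  apply: measurable_funB.
    have [[mw _] _ _ _] := sol.
    apply: measurable_funS mw; first by apply: measurableX => //; exact: measurable_itv.
    by move=> [t x] [/= /sT tT _]; split.
  rewrite (_ : (fun z : R * (R * R) => _) =
    (fun z : R * (R * R) => profile s (enorm (z.2.1 - (Phi z.1 0).1, z.2.2 - (Phi z.1 0).2)))); last first.
    by apply/funext => z; rewrite vortexE.
  apply: (measurableT_comp (measurable_profile ss)).
  rewrite /enorm /=; apply: measurable_funsqrt.
  apply: measurable_funD; apply: measurable_funX; apply: measurable_funB.
  - have m21 := measurableT_comp (@measurable_fst2 R) m2; exact: m21.
  - exact: mphi c1.
  - have m22 := measurableT_comp (@measurable_snd2 R) m2; exact: m22.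
  - exact: mphi c2.
exists M; apply: aeW => t; rewrite inE/= => tT.
apply: Lnorm_oo_le => //.
have := ae_mpres (mpres_add (- Phi t 0)) (hM t tT).
apply: filterS => x; rewrite subrK -vortexE => /le_trans; apply.
by case: ifP.
Qed.

End Decomposition.

(** * The strain at the origin *)

Section Instant.
Variable R : realType.
Local Notation mR := (measurableTypeR R).
Local Notation mR2 := (mR * mR)%type.
Local Notation mu2 := (@leb2 R).
Implicit Types (X y : R * R) (r a b : R).

Lemma powR_small (p e : R) : p < 0 -> 0 < e -> exists2 q0, 1 < q0 & forall q, q0 <= q -> q `^ p <= e.
Proof.
move=> p0 e0; pose q0 := Num.max 2 (e `^ p^-1).
have q2 : 2 <= q0 by rewrite le_max lexx.
exists q0 => [|q q0q]; first lra.
have q00 : 0 < q0 by lra.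
have x0 : 0 < e `^ p^-1 by exact: powR_gt0.
have h : (e `^ p^-1) `^ (- p) <= q `^ (- p).
  apply: ge0_ler_powR; rewrite ?nnegrE ?(ltW x0)//; [lra|lra|].
  by apply: le_trans q0q; rewrite /q0 le_max lexx orbT.
have {}h : e^-1 <= q `^ (- p).
  by apply: le_trans h; rewrite -powRrM mulrN mulVf ?ltr0_neq0// powR_inv1// ltW.
rewrite -[e]invrK (_ : q `^ p = (q `^ (- p))^-1); last by rewrite powRN invrK.
have qp : 0 < q by lra.
by rewrite lef_pV2 ?posrE ?powR_gt0 ?invr_gt0.
Qed.

(** Only an upper bound for the area: 1 <= 2 b^2 [kr b a] for 0 < a < b, and [ib_kr] applies with r
    = b. *)
Definition disk_area b : R := 2 * b ^+ 2 * (8 * ln 2).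

Lemma measurable_disk b (c : R) : measurable_fun [set: mR2]
  ((fun y => if enorm y < b then c else 0) : mR2 -> R).
Proof.
apply: measurable_fun_ifT => //.
by apply: measurable_fun_ltr => //; exact: measurable_enorm.
Qed.

Lemma ib_disk b : 0 < b -> ib (fun y => if enorm y < b then 1 else 0) (disk_area b).
Proof.
move=> b0; have i := ib_kr b0 b0.
have k2 : 0 <= 2 * b ^+ 2 by rewrite mulr_ge0// exprn_ge0// ltW.
have {i} := ib_scale k2 i; rewrite divff ?gt_eqF// (_ : 1 + 1 = 2)// => i.
apply: ib_ae i; first exact: measurable_disk.
  by move=> y; case: ifP.
apply: filterS (ae_neq 0) => y /eqP y0; case: ifP => yb; last by rewrite mulr0.
have a0 : 0 < enorm y by rewrite enorm_gt0.
rewrite /kr -[X in X <= _](mulfV (x := 2 * b ^+ 2)) ?gt_eqF ?mulr_gt0 ?exprn_gt0//.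
rewrite ler_wpM2l// lef_pV2 ?posrE ?mulr_gt0 ?addr_gt0 ?exprn_gt0//.
rewrite (_ : 2 * b ^+ 2 = b * (b + b)); last by ring.
by rewrite ler_pM ?(ltW a0) ?addr_ge0 ?(ltW a0) ?(ltW b0) ?lerD ?(ltW yb).
Qed.

Lemma Pker_far X y : 0 < enorm y -> 2 * enorm X <= enorm y -> Pker X y <= 2 / enorm y ^+ 2.
Proof.
move=> y0 Xy; have := enorm_triangle X (y - X); rewrite subrKC -enormB => tr.
rewrite /Pker (_ : 2 / enorm y ^+ 2 = (enorm y * (enorm y / 2))^-1); last first.
  by field; rewrite gt_eqF.
have h : enorm y / 2 <= enorm (X - y) by lra.
have p : 0 < enorm y / 2 by lra.
by rewrite lef_pV2 ?posrE ?mulr_gt0// ?ler_pM2l// (lt_le_trans p).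
Qed.

Lemma log_modulus_ge0 beta a : 0 <= log_modulus beta a.
Proof. by rewrite /log_modulus; case: eqP => // _; rewrite powR_ge0. Qed.

Lemma log_modulus_le beta a b : 0 < beta -> 0 <= a -> a <= b -> b < 1 ->
  log_modulus beta a <= log_modulus beta b.
Proof.
move=> p0 a0 ab b1; rewrite {1}/log_modulus; case: eqP => [_|/eqP an]; first exact: log_modulus_ge0.
have a1 : 0 < a by rewrite lt_neqAle eq_sym an.
have b0 : 0 < b by exact: lt_le_trans ab.
rewrite /log_modulus gt_eqF// !powRN lef_pV2 ?posrE ?powR_gt0 ?ln_gt0 ?invf_gt1//; last first.
  exact: le_lt_trans b1.
have l0 : 0 <= ln b^-1 by rewrite ln_ge0// invf_ge1// ltW.
have lab : ln b^-1 <= ln a^-1 by rewrite ler_ln ?posrE ?invr_gt0// lef_pV2.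
by apply: ge0_ler_powR; rewrite ?nnegrE ?(ltW p0)//; exact: le_trans lab.
Qed.

Lemma log_modulus_small beta e : 0 < beta -> 0 < e ->
  exists2 r0, 0 < r0 < 1 & forall a, 0 <= a -> a <= r0 -> log_modulus beta a <= e.
Proof.
move=> p0 e0; have pn : - beta < 0 by lra.
have [q0 q1 hq] := powR_small pn e0.
exists (expR (- q0)); first by rewrite expR_gt0 expR_lt1; lra.
have r1 : expR (- q0) < 1 by rewrite expR_lt1; lra.
move=> a a0 ar; apply: le_trans (log_modulus_le p0 a0 ar r1) _.
by rewrite /log_modulus gt_eqF ?expR_gt0// expRN invrK expRK hq.
Qed.

(* Bound for |g - g(0) 1_{|y| < rho} - g0|: modulus of continuity near the origin,
   small change since time 0 elsewhere, finite speed beyond b. *)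
Definition weight beta M rho eta b a : R :=
  if a < rho then M * log_modulus beta a else if a < b then eta else 0.

Lemma measurable_weight beta M rho eta b :
  measurable_fun [set: mR] (weight beta M rho eta b : mR -> R).
Proof.
apply: measurable_fun_ifT => //; first exact: measurable_fun_ltr.
  apply: measurable_funM => //; apply: measurable_fun_ifT => //.
    by apply: measurable_fun_eqr.
  apply: measurableT_comp (measurable_powR _) _; apply: measurable_funln.
  exact: measurable_inv.
by apply: measurable_fun_ifT => //; exact: measurable_fun_ltr.
Qed.

(** Three ranges contribute e/3 each. The Dini integral over 2 |X| <= |y| < rho fixes rho, the outer
    range fixes eta in terms of rho, and for |y| < 2 |X| the kernel has a bounded integral while the
    modulus is small, which fixes r1. *)
Lemma ib_weight beta M b e : 1 < beta -> 0 <= M -> 0 < b -> 0 < e ->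
  exists rho eta r1, [/\ 0 < rho, rho < expR (- 1), 0 < eta, 0 < r1 &
    forall X, X != 0 -> enorm X <= r1 ->
      ib (fun y => Pker X y * weight beta M rho eta b (enorm y)) e].
Proof.
move=> b1 M0 b0 e0; have p0 : 0 < beta by lra.
have bm : 0 < beta - 1 by lra.
have pn : 1 - beta < 0 by lra.
have en : 0 < e / 3 / (2 * M * 8 / (beta - 1) + 1).
  by rewrite !divr_gt0// ltr_wpDl// divr_ge0 ?mulr_ge0// ltW.
have [q0 q1 hq] := powR_small pn en.
pose rho := expR (- q0) / 2.
have rho0 : 0 < rho by rewrite divr_gt0 ?expR_gt0.
have rho1 : 2 * rho < 1 by rewrite /rho mulrC divfK// expR_lt1; lra.
have iD := ib_dini b1 rho0 rho1.
have A0 := ib_ge0 (ib_disk b0).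
pose eta := e / 3 / (2 / rho ^+ 2 * disk_area b + 1).
have d0 : 0 < 2 / rho ^+ 2 * disk_area b + 1.
  by rewrite ltr_wpDl// mulr_ge0// divr_ge0// exprn_ge0// ltW.
have eta0 : 0 < eta by rewrite !divr_gt0.
have l4 : 0 <= ln 4 :> R by rewrite ln_ge0//; lra.
pose K3 := M * (32 * ln 4) + 1.
have K30 : 0 < K3 by rewrite ltr_wpDl// !mulr_ge0.
have ek : 0 < e / 3 / K3 by rewrite !divr_gt0.
have [r0 /andP[r00 r01] hr0] := log_modulus_small p0 ek.
pose r1 := Num.min (r0 / 2) (rho / 2).
exists rho, eta, r1; split => //.
  rewrite /rho ltr_pdivrMr//; apply: (@le_lt_trans _ _ (expR (- 1))).
    by rewrite ler_expR; lra.
  by rewrite ltr_pMr ?expR_gt0//; lra.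
  by rewrite lt_min; apply/andP; split; apply: divr_gt0.
move=> X X0 Xr; have x0 : 0 < enorm X by rewrite enorm_gt0.
have Xr0 : 2 * enorm X <= r0.
  have : r1 <= r0 / 2 by rewrite ge_min lexx.
  by lra.
have Xrho : 2 * enorm X <= rho.
  have : r1 <= rho / 2 by rewrite ge_min lexx orbT.
  by lra.
have x20 : 0 < 2 * enorm X by rewrite mulr_gt0.
have phi0 : 0 <= log_modulus beta (2 * enorm X) := log_modulus_ge0 _ _.
have i3 := ib_scale (mulr_ge0 M0 phi0) (ib_Pker X0 x20).
have M2 : 0 <= 2 * M by rewrite mulr_ge0.
have i1 := ib_scale M2 iD.
have e2 : 0 <= 2 / rho ^+ 2 * eta by rewrite mulr_ge0 ?(ltW eta0)// divr_ge0// exprn_ge0// ltW.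
have i2 := ib_scale e2 (ib_disk b0).
apply: ib_weak (ib_le _ _ _ (ib_add (ib_add i3 i1) i2)).
- have t3 : M * log_modulus beta (2 * enorm X) * (32 * ln (2 + 2 * enorm X / enorm X)) <= e / 3.
    rewrite mulfK ?gt_eqF// (_ : 2 + 2 = 4); last by ring.
    have := hr0 _ (ltW x20) Xr0; rewrite ler_pdivlMr// => h.
    apply: le_trans h; rewrite -mulrA mulrCA ler_wpM2l// /K3; lra.
  have t1 : 2 * M * (8 * (ln (2 * rho)^-1 `^ (1 - beta) / (beta - 1))) <= e / 3.
    have -> : 2 * rho = expR (- q0) by rewrite /rho mulrC divfK.
    rewrite expRN invrK expRK.
    have := hq q0 (lexx _); rewrite ler_pdivlMr; last first.
      by rewrite ltr_wpDl// divr_ge0 ?mulr_ge0// ltW.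
    move: (powR_ge0 q0 (1 - beta)); move: (q0 `^ _) => z z0 h.
    by apply: le_trans h; rewrite mulrDr mulr1 ler_wpDr// le_eqVlt; apply/orP; left; apply/eqP; field; rewrite gt_eqF.
  have t2 : 2 / rho ^+ 2 * eta * disk_area b <= e / 3.
    have H (u v d : R) : 0 < d -> u <= d -> 0 <= v -> u * (v / d) <= v.
      by move=> d1 ud v0; rewrite mulrA ler_pdivrMr// mulrC ler_wpM2l.
    by rewrite mulrAC; apply: H; rewrite ?divr_ge0 ?(ltW e0)// lerDl.
  by lra.
- apply: measurable_funM; first exact: measurable_Pker.
  by apply: measurableT_comp (measurable_weight _ _ _ _ _) _; exact: measurable_enorm.
- move=> y; rewrite mulr_ge0 ?Pker_ge0// /weight; case: ifP => _.
    by rewrite mulr_ge0// log_modulus_ge0.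
  by case: ifP => _ //; exact: ltW.
- move=> y; have P0 := Pker_ge0 X y; have y0 := enorm_ge0 y.
  have T1 : 0 <= (if enorm y < rho then ln (enorm y)^-1 `^ (- beta) / enorm y ^+ 2 else 0).
    by case: ifP => // _; rewrite divr_ge0 ?powR_ge0 ?exprn_ge0.
  have T2 : 0 <= (if enorm y < b then 1 else 0) :> R by case: ifP.
  have T3 : 0 <= (if enorm y < 2 * enorm X then Pker X y else 0) by case: ifP.
  have [near|far] := ltP (enorm y) (2 * enorm X).
    rewrite /weight (lt_le_trans near Xrho) -addrA ler_wpDr//.
      by rewrite addr_ge0// mulr_ge0//; move: T1; rewrite (lt_le_trans near Xrho).
    rewrite mulrC ler_wpM2r// ler_wpM2l// log_modulus_le// ?(ltW near)//.
    by apply: le_lt_trans rho1; lra.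
  have yp : 0 < enorm y by exact: lt_le_trans far.
  have Pf := Pker_far yp far.
  rewrite mulr0 add0r /weight; have [yr|yr] := ltP (enorm y) rho.
    have T4 := mulr_ge0 e2 T2; apply: (ler_wpDr T4).
    rewrite /log_modulus gt_eqF//.
    apply: le_trans (ler_wpM2r _ Pf) _; first by rewrite mulr_ge0// powR_ge0.
    by rewrite le_eqVlt; apply/orP; left; apply/eqP; ring.
  rewrite mulr0 add0r; case: ifP => _; last by rewrite !mulr0.
  rewrite mulr1 ler_wpM2r ?(ltW eta0)//; apply: le_trans Pf _.
  by rewrite ler_wpM2l// lef_pV2 ?posrE ?exprn_gt0// lerXn2r ?nnegrE// ltW.
Qed.

End Instant.

Section Strain.
Variable R : realType.
Local Notation mR := (measurableTypeR R).
Local Notation mR2 := (mR * mR)%type.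
Local Notation mu2 := (@leb2 R).
Implicit Types (X y : R * R) (r a b : R).

Lemma L13_sub f h N1 N3 N1' N3' : L13 f N1 N3 -> L13 h N1' N3' ->
  L13 (fun y => f y - h y) (N1 + N1') (4 * (N3 + N3')).
Proof.
move=> [mf f1 f3] [mh h1 h3].
have md : measurable_fun [set: mR2] ((fun y => f y - h y) : mR2 -> R) by exact: measurable_funB.
have mn : measurable_fun [set: mR2] ((fun y => `|f y - h y|) : mR2 -> R).
  by apply: measurableT_comp md; exact: normr_measurable.
split => //.
- apply: ib_le (ib_add f1 h1) => // y; exact: ler_normB.
- apply: ib_le (ib_scale _ (ib_add f3 h3)) => //; first exact: measurable_funX.
  move=> y; apply: le_trans (cube_add _ _) => //.
  by rewrite lerXn2r ?nnegrE ?addr_ge0// ler_normB.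
Qed.

Lemma L13_disk (f : R * R -> R) b : 0 < b -> measurable_fun [set: mR2] (f : mR2 -> R) ->
  (forall y, `|f y| <= if enorm y < b then 1 else 0) -> L13 f (disk_area b) (disk_area b).
Proof.
move=> b0 mf fb.
have mn : measurable_fun [set: mR2] ((fun y => `|f y|) : mR2 -> R).
  by apply: measurableT_comp mf; exact: normr_measurable.
split => //; apply: ib_le (ib_disk b0) => //; first exact: measurable_funX.
move=> y; have := fb y; case: ifP => _ h; first by rewrite exprn_ile1.
have -> : `|f y| = 0 by apply/eqP; rewrite eq_le h normr_ge0.
by rewrite expr0n.
Qed.

Variables (s : R -> R) (C1 : R).
Hypothesis s_smooth : smooth_on [set~ (0 : R * R)] (loglog_vortex s).
Hypothesis C1_ge0 : 0 <= C1.
Hypothesis hC1 : forall r : R, 0 < r -> `|profile s r - ln (Zf r)| <= C1.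

(** The radial part to be subtracted: the vortex and the value c of the perturbation at the origin.
    [Jker] does not see it, so only the oscillation of the perturbation near the origin matters
    there. *)
Definition core (c rho a : R) : R := profile s a + (if a < rho then c else 0).

Lemma measurable_core (c rho : R) : measurable_fun [set: mR] (core c rho : mR -> R).
Proof.
apply: measurable_funD; first exact: measurable_profile.
by apply: measurable_fun_ifT => //; exact: measurable_fun_ltr.
Qed.

Lemma core_le (c rho a : R) : rho <= 1 -> 0 < a ->
  `|core c rho a| <= if a < 1 then (C1 + `|c| + 1) * Lw a else 0.
Proof.
move=> rho1 a0; have L1 := Lw_ge1 a; have h := profile_le hC1 a0.
have c0 := normr_ge0 c.
apply: le_trans (ler_normD _ _) _; have [a1|a1] := ltP a 1; last first.
  by move: h; rewrite ltNge a1/= ltNge (le_trans rho1 a1)/= normr0 addr0.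
move: h; rewrite a1 => h.
have h2 : `|if a < rho then c else 0| <= `|c| by case: ifP => _; rewrite ?normr0.
have : (C1 + `|c|) * 1 <= (C1 + `|c|) * Lw a by rewrite ler_wpM2l// addr_ge0.
by move: h h2; move: `|c| (Lw a) `|profile s a| `|if _ then _ else _| => *; lra.
Qed.

Lemma L13_core (c rho : R) : rho <= 1 -> exists N1 N3, L13 (fun y => core c rho (enorm y)) N1 N3.
Proof.
move=> rho1; apply: (@L13_radial _ _ (C1 + `|c| + 1)).
- by rewrite !addr_ge0.
- exact: measurable_core.
- by move=> r r0; exact: core_le.
Qed.

Variable g0 : R * R -> R.
Hypothesis mg0 : measurable_fun [set: mR2] (g0 : mR2 -> R).
Hypothesis g0_itv : forall y, 0 <= g0 y <= 1.
Hypothesis g0_supp : forall y, g0 y != 0 -> 1 <= y.1 <= 2 /\ 1 <= y.2 <= 2.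

Lemma box_annulus y : 1 <= y.1 <= 2 -> 1 <= y.2 <= 2 -> 1 <= enorm y < 3.
Proof.
move=> /andP[h1 h2] /andP[h3 h4].
have e0 := enorm_ge0 y; have e2 := enorm_sq y.
apply/andP; split.
  by rewrite -(ler_pXn2r (n := 2)) ?nnegrE// e2 expr1n; nra.
by rewrite -(ltr_pXn2r (n := 2)) ?nnegrE// e2; nra.
Qed.

Lemma g0_annulus y : g0 y != 0 -> 1 <= enorm y < 3.
Proof. by move=> /g0_supp[]; exact: box_annulus. Qed.

Lemma g0_disk y : `|g0 y| <= if enorm y < 3 then 1 else 0.
Proof.
have /andP[p q] := g0_itv y; rewrite ger0_norm//.
have [->|/g0_annulus/andP[_ ->//]] := eqVneq (g0 y) 0; by case: ifP.
Qed.

Let A3 := disk_area (3 : R).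

Lemma L13_g0 : L13 g0 A3 A3.
Proof. by apply: L13_disk => //; exact: g0_disk. Qed.

Lemma Pker_g0 X y : enorm X <= 1 / 2 -> Pker X y * `|g0 y| <= 2 * (if enorm y < 3 then 1 else 0).
Proof.
move=> X1; have P0 := Pker_ge0 X y; have := g0_disk y.
have [->|/g0_annulus/andP[h1 h2]] := eqVneq (g0 y) 0.
  by rewrite normr0 mulr0 => _; case: ifP => _; lra.
rewrite h2 mulr1 => g1; have y0 : 0 < enorm y by lra.
apply: (@le_trans _ _ (Pker X y)); first by rewrite ler_piMr.
apply: le_trans (Pker_far y0 _) _; first by lra.
rewrite ler_pdivrMr ?exprn_gt0// ler_peMr// -[1](expr1n _ 2) lerXn2r ?nnegrE//; lra.
Qed.

Lemma J_g0_le X : enorm X <= 1 / 2 ->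
  `|\int[mu2]_y (Jker X y * g0 y)| <= 2 * enorm X ^+ 2 * (2 * A3).
Proof.
move=> X1; have A0 : 0 <= A3 by exact: ib_ge0 (ib_disk (ltr0n R 3)).
apply: (J_bound_ib _ mg0 (ib_scale _ (ib_disk (ltr0n R 3)))) => //; first by rewrite mulr_ge0.
by apply: aeW => y; exact: Pker_g0.
Qed.

Section Perturb.
Variables (om : R * R -> R) (N1 N3 c rho : R) (D : R -> R).
Hypothesis Lom : L13 om N1 N3.
Hypothesis rho1 : rho <= 1.
Hypothesis omD : {ae mu2, forall y, `|om y - core c rho (enorm y) - g0 y| <= D (enorm y)}.

Lemma J_perturb X e : X != 0 -> ib (fun y => Pker X y * D (enorm y)) e ->
  `|\int[mu2]_y (Jker X y * om y) - \int[mu2]_y (Jker X y * g0 y)| <= 2 * enorm X ^+ 2 * e.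
Proof.
move=> X0 iD; have [M1 [M3 LF]] := L13_core c rho1.
have Ld := L13_sub Lom L13_g0.
have [K1 i1] := J_norm_ib X Lom; have [K2 i2] := J_norm_ib X L13_g0.
have mm g N N' : L13 g N N' -> measurable_fun [set: mR2] ((fun y => Jker X y * g y) : mR2 -> R).
  by case=> mg _ _; apply: measurable_funM => //; exact: measurable_Jker.
have [j1 _] := ib_norm (mm _ _ _ Lom) i1; have [j2 _] := ib_norm (mm _ _ _ L13_g0) i2.
rewrite -RintegralB//.
under eq_Rintegral do rewrite -mulrBr.
rewrite (int_J_sub X0 Ld (measurable_core c rho) LF).
apply: (J_bound_ib (ib_ge0 iD) _ iD).
  by have [] := L13_sub Ld LF.
apply: filterS omD => y hy; rewrite ler_wpM2l ?Pker_ge0//.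
by rewrite addrAC.
Qed.

(** For the full relative velocity the radial part does not drop out; [radial_DK] bounds its
    contribution, and this is the source of the factor L. *)
Lemma DK_perturb X e i : X != 0 -> enorm X <= 1 / 2 -> ib (fun y => Pker X y * D (enorm y)) e ->
  `|\int[mu2]_y (DK i X y * om y)| <=
    (27 * Cq R * (C1 + `|c| + 1) + e + 2 * A3) * Lw (enorm X) * enorm X.
Proof.
move=> X0 X1 iD; have [M1 [M3 LF]] := L13_core c rho1.
have r0 : 0 < enorm X by rewrite enorm_gt0.
have L1 := Lw_ge1 (enorm X); have c0 := normr_ge0 c.
have A0 : 0 <= A3 by exact: ib_ge0 (ib_disk (ltr0n R 3)).
have [m1 j1] := DK_ib X i Lom; have [m2 j2] := DK_ib X i LF.
have Ld := L13_sub Lom LF; have [md jd] := DK_ib X i Ld.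
have k0 : 0 <= C1 + `|c| + 1 by rewrite !addr_ge0.
have b1 : `|\int[mu2]_y (DK i X y * core c rho (enorm y))| <=
    9 * Cq R * (3 * (C1 + `|c| + 1) * Lw (enorm X)) * enorm X.
  apply: (radial_DK i X0 _ LF).
    by rewrite mulr_ge0 ?(le_trans ler01 L1)// mulr_ge0.
  move=> a a0; apply: le_trans (core_le c rho1 a0) _.
  have := Lw_le r0 a0; have := Lw_ge1 a.
  have : 0 <= enorm X * Num.sqrt (kr (enorm X) a) by rewrite mulr_ge0 ?sqrtr_ge0// ltW.
  move: (enorm X * _) => z z0 La Lr.
  have h : Lw a <= 3 * Lw (enorm X) * (1 + z).
    have : z <= Lw (enorm X) * z by rewrite ler_peMl.
    by move: Lr L1; move: (Lw _) (Lw _) => *; nra.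
  case: ifP => _; last by rewrite mulr_ge0 ?addr_ge0// mulr_ge0 ?(le_trans ler01 L1)// mulr_ge0.
  apply: le_trans (ler_wpM2l k0 h) _.
  by rewrite le_eqVlt; apply/orP; left; apply/eqP; ring.
have b2 : `|\int[mu2]_y (DK i X y * (om y - core c rho (enorm y)))| <= enorm X * (e + 2 * A3).
  have ii := ib_scale (ltW r0) (ib_add iD (ib_scale (ler0n R 2) (ib_disk (ltr0n R 3)))).
  apply: (ib_Rint md _ ii).2.
  apply: filterS3 omD (ae_neq 0) (ae_neq X) => y hy y0 yX.
  rewrite normrM; apply: le_trans (ler_wpM2r _ (DK_le_pt i y0 yX)) _ => //.
  rewrite -mulrA ler_wpM2l ?(ltW r0)//.
  have Pg := Pker_g0 y X1; have P0 := Pker_ge0 X y.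
  have h : `|om y - core c rho (enorm y)| <= D (enorm y) + `|g0 y|.
    rewrite -[om y - _](subrK (g0 y)); apply: le_trans (ler_normD _ _) _.
    by rewrite lerD2r.
  apply: le_trans (ler_wpM2l P0 h) _.
  by rewrite mulrDr lerD2l.
have -> : \int[mu2]_y (DK i X y * om y) =
    \int[mu2]_y (DK i X y * core c rho (enorm y)) +
    \int[mu2]_y (DK i X y * (om y - core c rho (enorm y))).
  rewrite -RintegralD//; apply: eq_Rintegral => y _.
  by rewrite -mulrDr subrKC.
apply: le_trans (ler_normD _ _) _; apply: le_trans (lerD b1 b2) _.
have e0 := ib_ge0 iD.
have : e + 2 * A3 <= (e + 2 * A3) * Lw (enorm X) by rewrite ler_peMr// addr_ge0// mulr_ge0.
move=> h; have := ler_wpM2l (ltW r0) h.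
by move: (enorm X) (Lw _) A3 (Cq R) (C1 + `|c| + 1) => *; lra.
Qed.

End Perturb.

(** Makes the sign visible: for small X it is that of (X cross y)(X . y). *)
Lemma Jker_factor X y : enorm y != 0 -> enorm (X - y) != 0 -> Jker X y =
  (X.1 * y.2 - X.2 * y.1) * (2 * (X.1 * y.1 + X.2 * y.2) - enorm X ^+ 2) /
    (enorm (X - y) ^+ 2 * enorm y ^+ 2).
Proof.
move=> y0 d0; rewrite JkerE.
have e : enorm X ^+ 2 = enorm (X - y) ^+ 2 - enorm y ^+ 2 + 2 * (X.1 * y.1 + X.2 * y.2).
  by rewrite !enorm_sq /=; ring.
by rewrite e; field; rewrite y0 d0.
Qed.

Lemma enorm_le_l1 X : enorm X <= `|X.1| + `|X.2|.
Proof.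
rewrite -(ler_pXn2r (n := 2)) ?nnegrE ?addr_ge0 ?enorm_ge0// enorm_sq.
rewrite -[X.1 ^+ 2]real_normK ?num_real// -[X.2 ^+ 2]real_normK ?num_real//.
by have := normr_ge0 X.1; have := normr_ge0 X.2; nra.
Qed.

(** In the cone the two factors of the numerator are at least 3/4 and 5/4 times [X.1], and the
    denominator is at most 4^2 * 3^2; the constant 300 leaves room. *)
Lemma Jker_cone1 X y : `|X.2| <= X.1 / 8 -> 0 < X.1 -> X.1 <= 1 / 8 ->
  1 <= y.1 <= 2 -> 1 <= y.2 <= 2 ->
  X.1 ^+ 2 / 300 <= Jker X y.
Proof.
rewrite ler_norml => /andP[k1 k2] x0 x1 b1 b2; have /andP[a1 a3] := box_annulus b1 b2.
move: b1 b2 => /andP[h1 h2] /andP[h3 h4].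
have Xn : enorm X <= 9 / 64.
  apply: le_trans (enorm_le_l1 X) _; rewrite gtr0_norm//.
  have : `|X.2| <= X.1 / 8 by rewrite ler_norml k1 k2.
  by lra.
have n0 := enorm_ge0 X.
have t1 := enorm_triangle X (- y); rewrite enormN in t1.
have t2 := enorm_triangle X (y - X); rewrite subrKC -enormB in t2.
have d0 : 0 < enorm (X - y) by lra.
rewrite Jker_factor ?gt_eqF//; last lra.
set n := enorm X in Xn n0 t1 t2 *; set d := enorm (X - y) in t1 t2 d0 *; set e := enorm y in a1 a3 t1 t2 *.
have X2 : n ^+ 2 = X.1 ^+ 2 + X.2 ^+ 2 by rewrite enorm_sq.
have p1 : X.1 * 1 <= X.1 * y.1 by rewrite ler_pM2l.
have p2 : X.1 * 1 <= X.1 * y.2 by rewrite ler_pM2l.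
have c1 : - (X.1 / 8) * y.2 <= X.2 * y.2 by rewrite ler_wpM2r//; lra.
have c1' : X.1 / 8 * y.2 <= X.1 / 8 * 2 by rewrite ler_wpM2l//; lra.
have c2 : X.2 * y.1 <= X.1 / 8 * y.1 by rewrite ler_wpM2r//; lra.
have c2' : X.1 / 8 * y.1 <= X.1 / 8 * 2 by rewrite ler_wpM2l//; lra.
have s1 : X.1 ^+ 2 <= X.1 * (1 / 8) by rewrite expr2 ler_wpM2l// ltW.
have s2 : X.2 ^+ 2 <= (X.1 / 8) ^+ 2.
  by rewrite -[X.2 ^+ 2]real_normK ?num_real// lerXn2r ?nnegrE ?ler_norml ?k1//; lra.
have s3 : (X.1 / 8) ^+ 2 = X.1 ^+ 2 / 64 by rewrite expr_div_n; field.
have q1 : X.1 * (3 / 4) <= X.1 * y.2 - X.2 * y.1 by lra.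
have q2 : X.1 * (5 / 4) <= 2 * (X.1 * y.1 + X.2 * y.2) - n ^+ 2 by rewrite X2; lra.
have D1 : d ^+ 2 * e ^+ 2 <= 16 * 9.
  have de : d <= 4 by lra.
  have -> : 16 * 9 = 4 ^+ 2 * 3 ^+ 2 :> R by ring.
  have e3 : e <= 3 by exact: ltW.
  have dd : d ^+ 2 <= 4 ^+ 2 by rewrite lerXn2r ?nnegrE// ltW.
  have ee : e ^+ 2 <= 3 ^+ 2 by rewrite lerXn2r ?nnegrE// (le_trans ler01 a1).
  exact: ler_pM (sqr_ge0 d) (sqr_ge0 e) dd ee.
have D0 : 0 < d ^+ 2 * e ^+ 2 by rewrite mulr_gt0 ?exprn_gt0//; lra.
rewrite ler_pdivlMr//.
apply: (@le_trans _ _ (X.1 ^+ 2 / 300 * (16 * 9))).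
  have i0 : 0 <= X.1 ^+ 2 / 300 by apply: divr_ge0; [exact: sqr_ge0|exact: ler0n].
  exact: ler_wpM2l i0 _ _ D1.
apply: (@le_trans _ _ (X.1 * (3 / 4) * (X.1 * (5 / 4)))).
  have := sqr_ge0 X.1; rewrite (_ : X.1 * _ * _ = X.1 ^+ 2 * (15 / 16)); last by field.
  by move: (X.1 ^+ 2) => *; lra.
by rewrite ler_pM// mulr_ge0// ltW.
Qed.

(** Exchanging the coordinates preserves the square but reverses orientation, hence the sign. *)
Lemma Jker_cone2 X y : `|X.1| <= X.2 / 8 -> 0 < X.2 -> X.2 <= 1 / 8 ->
  1 <= y.1 <= 2 -> 1 <= y.2 <= 2 -> X.2 ^+ 2 / 300 <= - Jker X y.
Proof.
move=> k x0 x1 b1 b2.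
have := @Jker_cone1 (X.2, X.1) (y.2, y.1) k x0 x1 b2 b1.
rewrite !JkerE /=.
have -> : enorm ((X.2, X.1) - (y.2, y.1) : R * R) = enorm (X - y) by rewrite /enorm /= addrC.
have -> : enorm (y.2, y.1) = enorm y by rewrite /enorm /= addrC.
by move=> /le_trans; apply; rewrite le_eqVlt; apply/orP; left; apply/eqP; ring.
Qed.

(* The strain exerted at the origin by the vorticity [g0] in the first
   quadrant stretches the first axis and contracts the second one. *)
Lemma J_g0_cone1 X : `|X.2| <= X.1 / 8 -> 0 < X.1 -> X.1 <= 1 / 8 ->
  X.1 ^+ 2 / 300 * \int[mu2]_y g0 y <= \int[mu2]_y (Jker X y * g0 y).
Proof.
move=> k x0 x1.
have [_ ig _] := L13_g0; have [j2 _] := ib_norm mg0 ig.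
have [K2 i2] := J_norm_ib X L13_g0.
have [j1 _] := ib_norm (measurable_funM (measurable_Jker X) mg0) i2.
rewrite -RintegralZl//; apply: le_Rintegral => //.
  by have j3 := integrableZl measurableT (X.1 ^+ 2 / 300) j2; exact: j3.
move=> y _; have /andP[p _] := g0_itv y.
have [->|gy] := eqVneq (g0 y) 0; first by rewrite !mulr0.
by have [b1 b2] := g0_supp gy; rewrite ler_wpM2r// Jker_cone1.
Qed.

Lemma J_g0_cone2 X : `|X.1| <= X.2 / 8 -> 0 < X.2 -> X.2 <= 1 / 8 ->
  \int[mu2]_y (Jker X y * g0 y) <= - (X.2 ^+ 2 / 300 * \int[mu2]_y g0 y).
Proof.
move=> k x0 x1.
have [_ ig _] := L13_g0; have [j2 _] := ib_norm mg0 ig.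
have [K2 i2] := J_norm_ib X L13_g0.
have [j1 _] := ib_norm (measurable_funM (measurable_Jker X) mg0) i2.
rewrite -mulNr -RintegralZl//; apply: le_Rintegral => //.
  by have j3 := integrableZl measurableT (- (X.2 ^+ 2 / 300)) j2; exact: j3.
move=> y _; have /andP[p _] := g0_itv y.
have [->|gy] := eqVneq (g0 y) 0; first by rewrite !mulr0.
have [b1 b2] := g0_supp gy; rewrite ler_wpM2r//.
by rewrite lerNr Jker_cone2.
Qed.

End Strain.

(** * Backward trajectories *)

Section Backward.
Variable R : realType.
Local Notation mu2 := (@leb2 R).

Lemma mvt_ge (f df : R -> R) (K a b : R) : a <= b ->
  {within `[a, b], continuous f} ->
  (forall t : R, a < t < b -> is_derive t 1 f (df t)) ->
  (forall t : R, a < t < b -> K <= df t) -> K * (b - a) <= f b - f a.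
Proof.
rewrite le_eqVlt => /predU1P[-> *|ab cf hf hK]; first by rewrite !subrr mulr0.
have hd x : x \in `]a, b[ -> is_derive x 1 f (df x).
  by rewrite in_itv/=; exact: hf.
have [u uab ->] := MVT ab hd cf.
by rewrite ler_wpM2r ?subr_ge0 ?(ltW ab)// hK//; move: uab; rewrite in_itv.
Qed.

Lemma Lw_half (r : R) : 0 < r -> Lw (r / 2) <= 5 * Lw r.
Proof.
move=> r0; have r20 : 0 < r / 2 by rewrite divr_gt0.
apply: le_trans (Lw_le r0 r20) _.
have L1 := Lw_ge1 r.
suff : r * Num.sqrt (kr r (r / 2)) <= 4 / 3 by lra.
have k0 : 0 <= kr r (r / 2) by apply: kr_ge0 => //; exact: ltW.
rewrite -(ler_pXn2r (n := 2)) ?nnegrE ?mulr_ge0 ?sqrtr_ge0 ?(ltW r0)//.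
rewrite exprMn sqr_sqrtr// /kr (_ : r ^+ 2 * _ = 4 / 3); first lra.
by field; rewrite !gt_eqF//; lra.
Qed.

Lemma cone_perturb (r p q p' q' : R) : 0 < r -> r <= p -> `|q| <= r / 32 ->
  `|p - p'| <= r / 32 -> `|q - q'| <= r / 32 -> 0 < p' /\ `|q'| <= p' / 8.
Proof.
rewrite !ler_norml => r0 rp /andP[q1 q2] /andP[p1 p2] /andP[d1 d2].
by split; [lra|apply/andP; split; lra].
Qed.

Variables (w : R -> R * R -> R) (Phi : R -> R * R -> R * R) (T N1 N3 : R).
Hypothesis flow : flow_map w Phi.
Hypothesis inj : forall t : R, 0 <= t -> injective (Phi t).
Hypothesis wL : forall t : R, 0 <= t <= T -> L13 (w t) N1 N3.

Variables (KJ KD r1 kappa : R).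
Hypothesis KJ0 : 0 <= KJ.
Hypothesis KD0 : 0 <= KD.
Hypothesis r10 : 0 < r1.
Hypothesis kappa0 : 0 <= kappa.
Local Notation JI t X := (\int[mu2]_y (Jker X y * w t (y + Phi t 0))).
Hypothesis hJ : forall (t : R) (X : R * R), 0 <= t <= T -> X != 0 -> `|JI t X| <= KJ * enorm X ^+ 2.
Hypothesis hD : forall (t : R) (X : R * R) i, 0 <= t <= T -> X != 0 -> enorm X <= r1 ->
  `|\int[mu2]_y (DK i X y * w t (y + Phi t 0))| <= KD * Lw (enorm X) * enorm X.
Hypothesis h1 : forall (t : R) (X : R * R), 0 <= t <= T -> `|X.2| <= X.1 / 8 -> 0 < X.1 -> enorm X <= r1 ->
  kappa * enorm X ^+ 2 <= JI t X.
Hypothesis h2 : forall (t : R) (X : R * R), 0 <= t <= T -> `|X.1| <= X.2 / 8 -> 0 < X.2 -> enorm X <= r1 ->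
  JI t X <= 0.

Lemma lnN_derive (a : R * R) (t : R) : 0 < t -> a != 0 ->
  is_derive t 1 (fun u => ln (Nt Phi a u)) ((Nt Phi a t)^-1 * dNt w Phi a t).
Proof.
move=> t0 a0; have d := Nt_derive flow a t0.
by have := dln (Nt_gt0 inj (ltW t0) a0) d; apply.
Qed.

Lemma lnN_cont (a : R * R) (t1 t2 : R) : 0 <= t1 -> t2 <= T -> a != 0 ->
  {within `[t1, t2], continuous (fun u => ln (Nt Phi a u))}.
Proof.
move=> t10 t2T a0; have cN := Nt_cont flow (a := a) t10 t2T.
apply/subspace_continuousP => x xI.
have x0 : 0 <= x by move: xI; rewrite /= in_itv/= => /andP[h _]; exact: le_trans h.
move/subspace_continuousP : cN => /(_ x xI) cN.
exact: (cvg_comp _ _ cN (continuous_ln (Nt_gt0 inj x0 a0))).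
Qed.

Lemma dlnN_bound (a : R * R) (t : R) : 0 <= t <= T -> a != 0 ->
  `|(Nt Phi a t)^-1 * dNt w Phi a t| <= 2 * KJ.
Proof.
move=> tT a0; have t0 : 0 <= t by case/andP: tT.
have N0 := Nt_gt0 inj t0 a0.
rewrite normrM gtr0_norm ?invr_gt0// mulrC ler_pdivrMr//.
rewrite (dNtE Phi wL a tT) !normrM (gtr0_norm (ltr0n _ 2)) (gtr0_norm (pi2_inv R).1).
rewrite -mulrA ler_pM2l// NtE; apply: le_trans (hJ tT (Xt_neq0 inj t0 a0)).
by rewrite ler_piMl// (pi2_inv R).2.
Qed.

Section Point.
Variables (a : R * R) (ts r : R).
Hypothesis a0 : a != 0.
Hypothesis tsT : 0 <= ts <= T.
Hypothesis r0 : 0 < r.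
Hypothesis rr1 : 6 * r <= r1.
Hypothesis rX : r <= enorm (Xt Phi a ts) <= 3 * r.
Hypothesis tJ : 2 * KJ * ts <= ln 4.
Hypothesis tD : 32 * (30 * KD) * Lw r * ts <= 1.

Lemma sub_time (u : R) : 0 <= u <= ts -> 0 <= u <= T.
Proof. by case/andP: tsT => _ h /andP[u0 uts]; rewrite u0 (le_trans uts). Qed.

(** [tJ] limits the change of ln |X|^2 to ln 4, that is, |X| changes by a factor of at most 2. *)
Lemma backward_radius (u : R) : 0 <= u <= ts -> r / 2 <= enorm (Xt Phi a u) <= 6 * r.
Proof.
move=> uts; have uT := sub_time uts; have /andP[u0 us] := uts.
have /andP[t0 tT] := tsT; have /andP[X1 X2] := rX.
have := @mvt_lip _ (fun u => ln (Nt Phi a u)) (fun u => (Nt Phi a u)^-1 * dNt w Phi a u) (2 * KJ) u ts us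
  (lnN_cont u0 tT a0).
have dd (x : R) : u < x < ts -> is_derive x 1 (fun u => ln (Nt Phi a u)) ((Nt Phi a x)^-1 * dNt w Phi a x).
  by move=> /andP[ux _]; apply: lnN_derive => //; exact: le_lt_trans ux.
have bb (x : R) : u < x < ts -> `|(Nt Phi a x)^-1 * dNt w Phi a x| <= 2 * KJ.
  move=> /andP[ux xs]; apply: dlnN_bound => //; apply: sub_time.
  by rewrite (ltW xs) ltW// (le_lt_trans u0).
move=> /(_ dd bb) => {dd bb} h.
have {}h : `|ln (Nt Phi a ts) - ln (Nt Phi a u)| <= ln 4.
  apply: le_trans h _; apply: le_trans tJ.
  by rewrite ler_wpM2l ?mulr_ge0//; lra.
have N0 := Nt_gt0 inj t0 a0; have M0 := Nt_gt0 inj u0 a0.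
move: h; rewrite ler_norml => /andP[k1 k2].
have q1 : Nt Phi a u <= 4 * Nt Phi a ts.
  by rewrite -ler_ln ?posrE ?mulr_gt0// lnM ?posrE//; lra.
have q2 : Nt Phi a ts <= 4 * Nt Phi a u.
  by rewrite -ler_ln ?posrE ?mulr_gt0// lnM ?posrE//; lra.
rewrite !NtE in q1 q2.
have e0 := enorm_ge0 (Xt Phi a u); have e1 := enorm_ge0 (Xt Phi a ts).
have four (x : R) : 4 * x ^+ 2 = (2 * x) ^+ 2 by rewrite exprMn; congr (_ * _); ring.
move: q1 q2; rewrite !four !ler_pXn2r ?nnegrE ?mulr_ge0// => q1 q2.
by apply/andP; split; lra.
Qed.

(** With |X| between r/2 and 6 r, the weight is at most 5 [Lw r], so each component of the relative
    velocity is at most 30 KD [Lw r] r; [tD] is exactly what makes the displacement at most r/32. *)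
Lemma backward_disp (u : R) : 0 <= u <= ts ->
  `|(Xt Phi a ts).1 - (Xt Phi a u).1| <= r / 32 /\ `|(Xt Phi a ts).2 - (Xt Phi a u).2| <= r / 32.
Proof.
move=> uts; have uT := sub_time uts; have /andP[u0 us] := uts.
have /andP[t0 tT] := tsT.
have [c1 c2] := Xt_cont flow a u0 tT.
have dd (x : R) : u < x < ts -> 0 < x by move=> /andP[ux _]; exact: le_lt_trans ux.
have L1 := Lw_ge1 r.
have bb (x : R) (i : bool) : u < x < ts ->
    `|(2 * pi)^-1 * \int[mu2]_y (DK i (Xt Phi a x) y * w x (y + Phi x 0))| <= 30 * KD * Lw r * r.
  move=> xx; have x0 := dd x xx; have /andP[_ xs] := xx.
  have xts : 0 <= x <= ts by rewrite (ltW x0) ltW.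
  have /andP[y1 y2] := backward_radius xts.
  rewrite normrM (gtr0_norm (pi2_inv R).1).
  apply: (@le_trans _ _ (KD * Lw (enorm (Xt Phi a x)) * enorm (Xt Phi a x))).
    apply: le_trans (hD i (sub_time xts) (Xt_neq0 inj (ltW x0) a0) (le_trans y2 rr1)).
    by rewrite ler_piMl// (pi2_inv R).2.
  have r20 : 0 < r / 2 by rewrite divr_gt0.
  have LL := le_trans (Lw_anti r20 y1) (Lw_half r0).
  have L0 : 0 <= Lw (enorm (Xt Phi a x)) by exact: le_trans ler01 (Lw_ge1 _).
  apply: (@le_trans _ _ (KD * (5 * Lw r) * (6 * r))).
    by apply: ler_pM => //; [exact: mulr_ge0|exact: enorm_ge0|exact: ler_wpM2l].
  by rewrite le_eqVlt; apply/orP; left; apply/eqP; ring.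
have fin : 30 * KD * Lw r * r * (ts - u) <= r / 32.
  have k0 : 0 <= 30 * KD * Lw r * r.
    by rewrite mulr_ge0 ?(ltW r0)// mulr_ge0 ?mulr_ge0//; lra.
  apply: (@le_trans _ _ (30 * KD * Lw r * r * ts)); first by rewrite ler_wpM2l//; lra.
  rewrite (_ : _ * ts = 32 * (30 * KD) * Lw r * ts * (r / 32)); last by field.
  by rewrite ler_piMl// divr_ge0// ltW.
have Du (x : R) : u < x < ts -> _ := fun xx => Du_DK (Phi x 0) (Xt Phi a x)
  (wL (sub_time (introT andP (conj (ltW (dd x xx)) (ltW (elimT andP xx).2))))).
have PX (x : R) : Phi x 0 + Xt Phi a x = Phi x a by rewrite /Xt addrC subrK.
split; apply: le_trans fin.
- apply: (@mvt_lip _ (fun t => (Xt Phi a t).1) (dX1 w Phi a)) => //.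
  + by move=> x /dd x0; have [] := Xt_derive flow a x0.
  + move=> x xx; have [e _] := Du x xx; rewrite PX in e.
    by rewrite /dX1 e; exact: bb.
- apply: (@mvt_lip _ (fun t => (Xt Phi a t).2) (dX2 w Phi a)) => //.
  + by move=> x /dd x0; have [] := Xt_derive flow a x0.
  + move=> x xx; have [_ e] := Du x xx; rewrite PX in e.
    by rewrite /dX2 e; exact: bb.
Qed.

(** By [backward_disp] the particle has been in the cone around the first axis since time 0, so the
    lower bound on the strain holds throughout. *)
Lemma stretched_axis : r <= (Xt Phi a ts).1 -> `|(Xt Phi a ts).2| <= r / 32 ->
  2 * ((2 * pi)^-1 * kappa) * ts <= ln (Nt Phi a ts) - ln (Nt Phi a 0).
Proof.
move=> k1 k2; have /andP[t0 tT] := tsT.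
rewrite -[X in _ * X <= _]subr0.
apply: (@mvt_ge (fun u => ln (Nt Phi a u)) (fun u => (Nt Phi a u)^-1 * dNt w Phi a u)) => //.
- by have := lnN_cont (lexx 0) tT a0; apply.
- by move=> x /andP[x0 _]; exact: lnN_derive.
move=> x /andP[x0 xs]; have xts : 0 <= x <= ts by rewrite (ltW x0) ltW.
have [d1 d2] := backward_disp xts; have /andP[y1 y2] := backward_radius xts.
have N0 := Nt_gt0 inj (ltW x0) a0.
rewrite [X in _ <= X]mulrC ler_pdivlMr// (dNtE Phi wL a (sub_time xts)) -!mulrA ler_pM2l// ler_pM2l ?(pi2_inv R).1//.
rewrite NtE; have [p0 pc] := cone_perturb r0 k1 k2 d1 d2.
exact: h1 (sub_time xts) pc p0 (le_trans y2 rr1).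
Qed.

Lemma contracted_axis : r <= (Xt Phi a ts).2 -> `|(Xt Phi a ts).1| <= r / 32 ->
  ln (Nt Phi a ts) <= ln (Nt Phi a 0).
Proof.
move=> k1 k2; have /andP[t0 tT] := tsT.
suff : 0 * (ts - 0) <= - ln (Nt Phi a ts) - - ln (Nt Phi a 0) by rewrite mul0r; lra.
apply: (@mvt_ge (fun u => - ln (Nt Phi a u)) (fun u => - ((Nt Phi a u)^-1 * dNt w Phi a u))) => //.
- by have c := lnN_cont (lexx 0) tT a0; move=> x; apply: cvgN; exact: c.
- by move=> x /andP[x0 _]; have := dN (lnN_derive x0 a0); apply.
move=> x /andP[x0 xs]; have xts : 0 <= x <= ts by rewrite (ltW x0) ltW.
have [d1 d2] := backward_disp xts; have /andP[y1 y2] := backward_radius xts.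
have N0 := Nt_gt0 inj (ltW x0) a0.
rewrite oppr_ge0 pmulr_rle0 ?invr_gt0// (dNtE Phi wL a (sub_time xts)) pmulr_rle0//.
rewrite pmulr_rle0 ?(pi2_inv R).1//.
have [p0 pc] := cone_perturb r0 k1 k2 d2 d1.
exact: h2 (sub_time xts) pc p0 (le_trans y2 rr1).
Qed.

End Point.
End Backward.

(** * Points off null sets, uniform continuity, comparison of logarithms and powers *)

Section Tools.
Variable R : realType.
Local Notation mR := (measurableTypeR R).
Local Notation mR2 := (mR * mR)%type.
Local Notation mu := (@lebesgue_measure R).
Local Notation mu2 := (@leb2 R).

Lemma ae_witness (P : R * R -> Prop) (a1 b1 a2 b2 : R) : {ae mu2, forall y, P y} ->
  a1 < b1 -> a2 < b2 -> exists y, [/\ a1 < y.1 < b1, a2 < y.2 < b2 & P y].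
Proof.
move=> [N [mN N0 PN]] h1 h2; apply: contrapT => nex.
pose B : set mR2 := `]a1, b1[%classic `*` `]a2, b2[%classic.
have BN : B `<=` N.
  move=> y [/=]; rewrite !in_itv/= => y1 y2; apply: PN => /= Py.
  by apply: nex; exists y.
have mB : measurable B by apply: measurableX; exact: measurable_itv.
have : (mu2 B <= mu2 N)%E by apply: le_measure; rewrite ?inE.
rewrite N0 leNgt => /negP; apply.
have e := @product_measure1E _ _ mR mR R mu mu _ _
  (measurable_itv `]a1, b1[) (measurable_itv `]a2, b2[).
rewrite [ltRHS]e [X in (X * _)%E]lebesgue_measure_itv [X in (_ * X)%E]lebesgue_measure_itv.
by rewrite /= !lte_fin h1 h2 -!EFinB -EFinM lte_fin mulr_gt0// subr_gt0.
Qed.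

(** Only the first point has to lie in [A], so values just outside the compact set are controlled
    too. *)
Lemma heine (V : normedModType R) (A : set V) (f : V -> R) : compact A ->
  (forall x, A x -> {for x, continuous f}) -> forall e : R, 0 < e ->
  exists2 d : R, 0 < d & forall x y, A x -> `|x - y| < d -> `|f x - f y| <= e.
Proof.
move=> /compact_near_coveringP cA fc e e0.
have h := cA R (0 : R)^'+ (fun d x => forall y, `|x - y| < d -> `|f x - f y| <= e) _ .
have : \forall d \near (0 : R)^'+, A `<=` (fun x => forall y, `|x - y| < d -> `|f x - f y| <= e).
  apply: h => x Ax; have e20 : 0 < e / 2 by rewrite divr_gt0.
  have /cvgrPdist_lt /(_ _ e20) /nbhs_normP[d /= d0 hd] := fc x Ax.
  have d20 : 0 < d / 2 by rewrite divr_gt0.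
  exists (ball x (d / 2), [set u : R | u < d / 2]).
    by split; [exact: nbhsx_ballx|exact: nbhs_right_lt].
  move=> [x' u] /= [xx' ud] y x'y.
  move: xx'; rewrite -ball_normE/= => xx'.
  have h1 : `|f x - f x'| < e / 2 by apply: hd => /=; lra.
  have h2 : `|f x - f y| < e / 2.
    apply: hd => /=; have := ler_distD x' x y; lra.
  have := ler_distD (f x) (f x') (f y); rewrite [`|f x' - f x|]distrC; lra.
move=> H; near (0 : R)^'+ => d; exists d => // x y Ax; apply: (near H d) => //.
Unshelve. all: by end_near.
Qed.

(** The surplus beta - 1 is cut into halves e: one power l^-e absorbs the logarithm, the other tends
    to 0. *)
Lemma ln_over_powR (beta C k M : R) : 1 < beta -> 0 < k -> 0 <= M -> 0 <= C ->
  exists2 l0 : R, 1 < l0 & forall l, l0 <= l ->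
    M * (l / 2) `^ (- beta) * (2 * l * (C + ln l)) < k.
Proof.
move=> b1 k0 M0 C0; pose e := (beta - 1) / 2.
have e0 : 0 < e by rewrite divr_gt0//; lra.
have en : - e < 0 by lra.
pose K := 2 * M * (2 `^ beta) * (C + e^-1) + 1.
have ie : 0 < e^-1 by rewrite invr_gt0.
have KM0 : 0 <= 2 * M * (2 `^ beta) * (C + e^-1).
  by rewrite mulr_ge0 ?mulr_ge0 ?powR_ge0// addr_ge0// ltW.
have K0 : 0 < K by rewrite /K; lra.
have [l0 l01 hl] := powR_small en (divr_gt0 k0 K0).
exists l0 => // l ll; have lp : 0 < l by lra.
have le0 : 0 < l `^ e by exact: powR_gt0.
have le1 : 1 <= l `^ e.
  by rewrite -[X in X <= _](powRr0 l) ler_powR ?(ltW e0)//; lra.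
have lnl : ln l <= e^-1 * l `^ e.
  rewrite mulrC ler_pdivlMr// mulrC -ln_powR.
  by apply: le_trans (ln_le_sub1 le0) _; lra.
have h1 : C + ln l <= (C + e^-1) * l `^ e.
  have : C <= C * l `^ e by rewrite ler_peMr.
  by rewrite mulrDl; lra.
have pe : (l / 2) `^ (- beta) = 2 `^ beta * (l^-1 * l `^ (- e) * l `^ (- e)).
  rewrite powRM ?invr_ge0 ?(ltW lp)// mulrC -powR_inv1// -powRrM mulN1r opprK; congr (_ * _).
  rewrite -powR_inv1 ?(ltW lp)// -!powRD; last 2 first.
  - by apply/implyP => _; rewrite gt_eqF.
  - by apply/implyP => _; rewrite gt_eqF.
  by congr (_ `^ _); rewrite /e; field.
have le_inv : l `^ (- e) * l `^ e = 1 by rewrite powRN mulVf// gt_eqF.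
have P0 : 0 <= M * (l / 2) `^ (- beta) * (2 * l) by rewrite mulr_ge0 ?mulr_ge0 ?powR_ge0// ltW.
rewrite [X in X < _]mulrA; apply: le_lt_trans (ler_wpM2l P0 h1) _.
have -> : M * (l / 2) `^ (- beta) * (2 * l) * ((C + e^-1) * l `^ e) =
   2 * M * (2 `^ beta) * (C + e^-1) * (l^-1 * l) * (l `^ (- e) * l `^ e) * l `^ (- e).
  by rewrite pe; ring.
rewrite le_inv mulVf ?gt_eqF// !mulr1.
apply: le_lt_trans (ler_wpM2l KM0 (hl l ll)) _.
by rewrite mulrCA gtr_pMr// ltr_pdivrMr// mul1r /K; lra.
Qed.

Lemma sup_norm_le_enorm (x : R * R) : `|x| <= enorm x.
Proof. by have := sup_le_enorm x; apply. Qed.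

Lemma enorm_dist (x y : R * R) : `|enorm x - enorm y| <= enorm (x - y).
Proof.
have t1 := enorm_triangle (x - y) y; rewrite subrK in t1.
have t2 := enorm_triangle (y - x) x; rewrite subrK (enormB y x) in t2.
by rewrite ler_norml; apply/andP; split; lra.
Qed.

Lemma profile_unif (s : R -> R) : smooth_on [set~ (0 : R * R)] (loglog_vortex s) ->
  forall rho e : R, 0 < rho -> 0 < e -> exists2 d : R, 0 < d &
    forall a b : R, rho <= a -> `|a - b| < d -> `|profile s a - profile s b| <= e.
Proof.
move=> ss rho e rho0 e0.
have pc (x : R) : `[rho, 2]%classic x -> {for x, continuous (profile s)}.
  rewrite /= in_itv/= => /andP[h _]; apply: (profile_continuous ss).
  by rewrite gt_eqF// (lt_le_trans rho0).
have [d d0 hd] := heine (@segment_compact R rho 2) pc e0.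
exists (Num.min d 1); first by rewrite lt_min d0 ltr01.
move=> a b ra; rewrite lt_min => /andP[abd ab1].
have [a2|a2] := leP a 2; first by apply: hd => //; rewrite /= in_itv/= ra.
have b1 : 1 <= b by move: ab1; rewrite ltr_norml => /andP[]; lra.
by rewrite !profile_ge1 ?subrr ?normr0 ?(ltW e0)//; lra.
Qed.

End Tools.

(** * Elementary inequalities for the strain bounds *)

Section Arithmetic.
Variable R : realType.

Lemma half_sum_lt (p q q0 q1 q2 : R) : p <= q -> 2 * q < q2 -> q0 <= p -> q1 <= p -> q0 + q1 < q2.
Proof. by move=> *; lra. Qed.

Lemma CE_ge0 (b : R) : 3 <= b -> 0 <= CE b.
Proof. by move=> b3; have : 0 <= ln (2 + b) by [rewrite ln_ge0//; lra]; rewrite /CE; lra. Qed.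

Lemma cone_sq (p q n : R) : `|q| <= p / 8 -> 0 < p -> n = p ^+ 2 + q ^+ 2 -> n <= 2 * p ^+ 2.
Proof.
move=> qp p0 ->; have : `|q| ^+ 2 <= p ^+ 2 by rewrite lerXn2r ?nnegrE ?(ltW p0)//; lra.
by rewrite real_normK ?num_real//; lra.
Qed.

Lemma le_half (n r : R) : r <= 1 / 8 -> n <= r -> n <= 1 / 2.
Proof. by move=> *; lra. Qed.

Lemma strain_const_le (A e z n : R) : 0 <= z * n ->
  2 * n * e + 2 * n * (2 * A) <= (4 * A + 2 * e + z) * n.
Proof. by move=> h; lra. Qed.

Lemma le_strain_const (A e z u : R) : 0 <= A -> 0 < e -> u <= z -> u <= 4 * A + 2 * e + z.
Proof. by move=> *; lra. Qed.

Lemma strain_const_ge0 (A e z : R) : 0 <= A -> 0 < e -> 0 <= z ->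
  0 <= 4 * A + 2 * e + z /\ 0 <= z + e + 2 * A.
Proof. by move=> *; split; lra. Qed.

Lemma stretch_le (J G x n i : R) : - (2 * n * (i / 8)) <= J - G -> x * i <= G ->
  n * i <= 2 * x * i -> i / 4 * n <= J.
Proof. by move=> *; lra. Qed.

Lemma contract_le (J G x n i : R) : J - G <= 2 * n * (i / 8) -> G <= - (x * i) ->
  n * i <= 2 * x * i -> 0 <= n * i -> J <= 0.
Proof. by move=> *; lra. Qed.

End Arithmetic.

(** * Loss of the modulus of continuity *)

Section Contradiction.
Variable R : realType.
Local Notation mR := (measurableTypeR R).
Local Notation mR2 := (mR * mR)%type.
Local Notation mu2 := (@leb2 R).

Variables (s : R -> R) (g0 : R * R -> R).
Hypothesis s_smooth : smooth_on [set~ (0 : R * R)] (loglog_vortex s).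
Hypothesis cg0 : continuous g0.
Hypothesis mg0 : measurable_fun [set: mR2] (g0 : mR2 -> R).
Hypothesis g0_itv : forall y, 0 <= g0 y <= 1.
Hypothesis g0_supp : forall y, g0 y != 0 -> 1 <= y.1 <= 2 /\ 1 <= y.2 <= 2.
Hypothesis g0_pos : 0 < \int[mu2]_y g0 y.
Local Notation v := (fun x => loglog_vortex s x + g0 x).

Lemma g0_norm_le1 x : `|g0 x| <= 1.
Proof. by have /andP[h1 h2] := g0_itv x; rewrite ger0_norm. Qed.

Lemma g0_outside x : 3 <= enorm x -> g0 x = 0.
Proof. by move=> h; apply: contraTeq h => /(g0_annulus g0_supp) /andP[_]; rewrite ltNge. Qed.

Lemma g0_inside x : enorm x < 1 -> g0 x = 0.
Proof. by move=> h; apply: contraTeq h => /(g0_annulus g0_supp) /andP[+ _]; rewrite leNgt. Qed.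

Lemma g0_unif (e : R) : 0 < e -> exists2 d : R, 0 < d &
  forall x y, `|x - y| < d -> `|g0 x - g0 y| <= e.
Proof.
move=> e0; pose A : set (R * R) := `[1, 2]%classic `*` `[1, 2]%classic.
have cA : compact A by apply: compact_setX; exact: segment_compact.
have cA' x : A x -> {for x, continuous g0} by move=> _; exact: cg0.
have [d d0 hd] := heine cA cA' e0.
exists d => // x y xy; have [gx|/g0_supp[b1 b2]] := eqVneq (g0 x) 0; last first.
  by apply: hd => //; split; rewrite /= in_itv.
have [gy|/g0_supp[b1 b2]] := eqVneq (g0 y) 0; first by rewrite gx gy subrr normr0 ltW.
by rewrite distrC; apply: hd; rewrite 1?distrC//; split; rewrite /= in_itv.
Qed.

Lemma v_unif (rho e : R) : 0 < rho -> 0 < e -> exists2 d : R, 0 < d &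
  forall x y, rho <= enorm x -> enorm (x - y) < d -> `|v x - v y| <= e.
Proof.
move=> rho0 e0; have e20 : 0 < e / 2 by rewrite divr_gt0.
have [d1 d10 h1] := profile_unif s_smooth rho0 e20.
have [d2 d20 h2] := g0_unif e20.
exists (Num.min d1 d2); first by rewrite lt_min d10.
move=> x y rx; rewrite lt_min => /andP[xy1 xy2].
have k1 := h1 _ (enorm y) rx (le_lt_trans (enorm_dist x y) xy1).
have k2 := h2 _ _ (le_lt_trans (sup_norm_le_enorm (x - y)) xy2).
rewrite !vortexE opprD addrACA; apply: le_trans (ler_normD _ _) _.
by lra.
Qed.

Variables (w : R -> R * R -> R) (Phi : R -> R * R -> R * R) (T beta M : R).
Hypothesis T0 : 0 < T.
Hypothesis sol : euler_solution v w Phi.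
Hypothesis beta1 : 1 < beta.
Hypothesis M0 : 0 <= M.
Variable g : R -> R * R -> R.
Hypothesis g_dec : forall t : R, 0 <= t <= T ->
  {ae mu2, forall x, w t x = loglog_vortex s (x - Phi t 0) + g t x}.
Hypothesis g_mod : forall (t : R) (x y : R * R), 0 <= t <= T -> 0 < enorm (x - y) < expR (- 1) ->
  `|g t x - g t y| <= M * log_modulus beta (enorm (x - y)).

Let gam (t : R) (y : R * R) : R := g t (y + Phi t 0).

Lemma gam_ae (t : R) : 0 <= t <= T -> {ae mu2, forall y, w t (y + Phi t 0) = profile s (enorm y) + gam t y}.
Proof.
move=> tT; have := ae_mpres (mpres_add (Phi t 0)) (g_dec tT).
by apply: filterS => y ->; rewrite addrK vortexE.
Qed.

Lemma gam_mod (t : R) x y : 0 <= t <= T -> 0 < enorm (x - y) < expR (- 1) ->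
  `|gam t x - gam t y| <= M * log_modulus beta (enorm (x - y)).
Proof.
move=> tT; rewrite /gam; have e : x + Phi t 0 - (y + Phi t 0) = x - y.
  by rewrite opprD addrACA subrr addr0.
by rewrite -e; exact: g_mod.
Qed.

(** An almost everywhere bound says nothing at a single point; it is carried to the origin by the
    modulus from a nearby point where it holds. The modulus takes the value 1 at e^-1. *)
Lemma gam0_le (t Mp : R) : 0 <= t <= T ->
  {ae mu2, forall y, `|w t (y + Phi t 0) - profile s (enorm y)| <= Mp} -> `|gam t 0| <= Mp + M.
Proof.
move=> tT h; have e1 : 0 < expR (- 1) :> R := expR_gt0 _.
have e4 : 0 < expR (- 1) / 4 :> R by rewrite divr_gt0.
have ee : expR (- 1) < 1 :> R by rewrite expR_lt1; lra.
have h2 : {ae mu2, forall y, `|gam t y| <= Mp}.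
  by apply: filterS2 h (gam_ae tT) => y + e; rewrite e addrAC subrr add0r.
have [y [/andP[p1 p2] /andP[q1 q2] gy]] := ae_witness h2 e4 e4.
have n1 : enorm y <= expR (- 1) / 2.
  by apply: le_trans (enorm_le_l1 y) _; rewrite !gtr0_norm//; lra.
have n0 : 0 < enorm y by rewrite enorm_gt0; apply: contraTneq p1 => ->; rewrite ltxx.
have := @gam_mod t y 0 tT; rewrite subr0 n0 => /(_ _).
have -> : enorm y < expR (- 1) by lra.
move=> /(_ isT) k.
have lm : log_modulus beta (enorm y) <= 1.
  have b0 : 0 < beta by exact: lt_trans beta1.
  have n1' : enorm y <= expR (- 1) by lra.
  apply: le_trans (log_modulus_le b0 (ltW n0) n1' ee) _.
  by rewrite /log_modulus gt_eqF// expRN invrK expRK powR1.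
have k2 : M * log_modulus beta (enorm y) <= M by rewrite ler_piMr.
have := ler_normB (gam t y) (gam t y - gam t 0).
by rewrite opprB subrKC; lra.
Qed.

(** Turns a gain d of ln(1/|X|) into a gain of ln ln(1/|X|), by 1 - x <= - ln x at x = lx/la. *)
Lemma lnln_gap (la lx d l : R) : 0 < lx -> lx + d <= la -> 0 <= d -> la <= 2 * l ->
  d / (2 * l) <= ln la - ln lx.
Proof.
move=> x0 h d0 al; have a0 : 0 < la by lra.
rewrite -ln_div ?posrE// -[la / lx]invrK lnV ?posrE ?invr_gt0 ?divr_gt0// invf_div.
have := @ln_le_sub1 R (lx / la) (divr_gt0 x0 a0).
have k : d / (2 * l) <= d / la by rewrite ler_wpM2l// lef_pV2 ?posrE//; lra.
have : lx / la + d / la <= 1 by rewrite -mulrDl ler_pdivrMr// mul1r.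
by move: k; move: (ln (lx / la)) (lx / la) (d / la) (d / (2 * l)) => *; lra.
Qed.

Let I := \int[mu2]_y g0 y.
Local Notation JI t X := (\int[mu2]_y (Jker X y * w t (y + Phi t 0))).

Lemma strain_bounds : exists N1 N3 T' KJ KD r1 kappa : R,
  [/\ 0 < T' <= T, 0 <= KJ /\ 0 <= KD, [/\ 0 < r1, r1 <= 1 / 8 & r1 < expR (- 2)], 0 < kappa &
  [/\ forall t : R, 0 <= t <= T' -> L13 (w t) N1 N3,
     forall (t : R) (X : R * R), 0 <= t <= T' -> X != 0 -> `|JI t X| <= KJ * enorm X ^+ 2,
     forall (t : R) (X : R * R) i, 0 <= t <= T' -> X != 0 -> enorm X <= r1 ->
       `|\int[mu2]_y (DK i X y * w t (y + Phi t 0))| <= KD * Lw (enorm X) * enorm X,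
     forall (t : R) (X : R * R), 0 <= t <= T' -> `|X.2| <= X.1 / 8 -> 0 < X.1 -> enorm X <= r1 ->
       kappa * enorm X ^+ 2 <= JI t X &
     forall (t : R) (X : R * R), 0 <= t <= T' -> `|X.1| <= X.2 / 8 -> 0 < X.2 -> enorm X <= r1 ->
       JI t X <= 0]].
Proof.
have [N1 [N3 [b [Mp [U [b3 Mp0 disp wL hM]]]]]] :=
  euler_a_priori s_smooth g0_norm_le1 g0_outside T0 sol.
have Tle : 0 <= T <= T by rewrite lexx (ltW T0).
have U0 : 0 <= U.
  by have := le_trans (enorm_ge0 _) (disp 0 T Tle); rewrite pmulr_lge0.
have [C1 C10 hC1] := profile_Zf s_smooth.
have I0 : 0 < I := g0_pos.
have q300 : 0 < 300 :> R by rewrite ltr0n.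
have I30 : 0 < I / 300 by exact: divr_gt0.
(* The error in the strain is then |X|^2 I/1200, half of the contribution |X|^2 I/600 of [g0], as
   |X|^2 is at most twice the square of the main coordinate in a cone; hence kappa = I/300/4. *)
pose e := I / 300 / 8; have e0 : 0 < e by exact: divr_gt0.
have b0 : 0 < b by lra.
have [rho [eta [r1' [rho0 rhoe eta0 r1'0 iW]]]] := ib_weight beta1 M0 b0 e0.
have rho1 : rho < 1 by apply: lt_trans rhoe _; rewrite expR_lt1; lra.
have [d d0 hd] := v_unif rho0 eta0.
have U1 : 0 < 2 * U + 1 by lra.
(* Until T' a particle and the origin together move by less than d, so away from the origin the
   vorticity changes by at most eta; adding 1 covers U = 0. *)
pose T' := Num.min T (d / (2 * U + 1)).
have T'0 : 0 < T' by rewrite lt_min T0 divr_gt0.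
have T'T : T' <= T by rewrite ge_min lexx.
have tt (t : R) : 0 <= t <= T' -> 0 <= t <= T.
  by move=> /andP[-> h]; exact: le_trans T'T.
have Mc (t : R) : 0 <= t <= T' -> `|gam t 0| <= Mp + M.
  move=> tT; apply: gam0_le; first exact: tt.
  by apply: filterS (hM t (tt t tT)) => y /le_trans; apply; case: ifP.
have hom (t : R) : 0 <= t <= T' -> {ae mu2, forall y,
    `|w t (y + Phi t 0) - core s (gam t 0) rho (enorm y) - g0 y| <= weight beta M rho eta b (enorm y)}.
  move=> tT; have [Psi [c1 c2 hv]] := w_centered sol (tt t tT).
  apply: filterS3 (gam_ae (tt t tT)) (ae_neq 0) (filterI hv (hM t (tt t tT))) => y wy y0 [hy my].
  have yp : 0 < enorm y by rewrite enorm_gt0; apply/eqP.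
  rewrite /weight /core; have [yr|yr] := ltP (enorm y) rho.
    rewrite wy g0_inside ?(lt_trans yr)// subr0 opprD addrACA subrr add0r.
    have := @gam_mod t y 0 (tt t tT); rewrite subr0 yp (lt_trans yr rhoe).
    by apply.
  rewrite addr0; have [yb|yb] := ltP (enorm y) b; last first.
    rewrite g0_outside ?subr0; last exact: le_trans yb.
    by move: my; rewrite ltNge yb.
  have -> : w t (y + Phi t 0) - profile s (enorm y) - g0 y = - (v y - v (Psi (y + Phi t 0))).
    by rewrite hy /= [loglog_vortex s y]vortexE; ring.
  rewrite normrN; apply: hd => //.
  set a := Psi _.
  have d1 := disp a t (tt t tT); rewrite /a c2 -/a in d1.
  have d2 := disp 0 t (tt t tT); rewrite subr0 in d2.
  have tr := enorm_triangle (y + Phi t 0 - a) (- Phi t 0); rewrite enormN in tr.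
  have ey : y + Phi t 0 - a - Phi t 0 = y - a by rewrite addrAC addrK.
  rewrite ey in tr.
  have ut : U * t <= U * (d / (2 * U + 1)).
    by rewrite ler_wpM2l//; have /andP[_ h] := tT; apply: le_trans h _; rewrite ge_min lexx orbT.
  have ud : 2 * (U * (d / (2 * U + 1))) < d.
    rewrite (_ : 2 * _ = 2 * U * d / (2 * U + 1)); last by ring.
    by rewrite ltr_pdivrMr// mulrDr mulr1 [d * _]mulrC ltrDl.
  exact: le_lt_trans tr (half_sum_lt ut ud d1 d2).
have e2 : 0 < expR (- 2) / 2 :> R by rewrite divr_gt0 ?expR_gt0.
pose r1 := Num.min r1' (Num.min (1 / 8) (expR (- 2) / 2)).
have r10 : 0 < r1 by rewrite !lt_min r1'0 e2 divr_gt0.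
have r11 : r1 <= r1' by rewrite ge_min lexx.
have r18 : r1 <= 1 / 8 by rewrite !ge_min lexx orbT.
have r12 : r1 < expR (- 2).
  apply: (@le_lt_trans _ _ (expR (- 2) / 2)); first by rewrite !ge_min lexx !orbT.
  by rewrite ltr_pdivrMr// ltr_pMr ?expR_gt0// ltr1n.
have A0 : 0 <= disk_area 3 :> R by exact: ib_ge0 (ib_disk (ltr0n R 3)).
have Zr := Zf_gt0 r1.
have CE0 := CE_ge0 b3.
have rho1' := ltW rho1.
have LS (t : R) (tT : 0 <= t <= T') := L13_shift (Phi t 0) (wL t (tt t tT)).
have JP (t : R) (X : R * R) : 0 <= t <= T' -> X != 0 -> enorm X <= r1 ->
    `|JI t X - \int[mu2]_y (Jker X y * g0 y)| <= 2 * enorm X ^+ 2 * e.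
  move=> tT X0 Xr.
  exact: (J_perturb s_smooth C10 hC1 mg0 g0_itv g0_supp (LS t tT) rho1' (hom t tT) X0 (iW X X0 (le_trans Xr r11))).
have n12 (p n : R) : 0 < p -> p <= n -> n <= r1 -> p <= 1 / 8.
  by move=> _ pn nr; exact: le_trans pn (le_trans nr r18).
have fst_le (X : R * R) : X.1 <= enorm X.
  by apply: le_trans (ler_norm _) (le_trans _ (sup_le_enorm X)); rewrite le_max lexx.
have snd_le (X : R * R) : X.2 <= enorm X.
  by apply: le_trans (ler_norm _) (le_trans _ (sup_le_enorm X)); rewrite le_max lexx orbT.
exists N1, N3, T', (4 * disk_area 3 + 2 * e + CE b * Zf r1 * Mp),
  (27 * Cq R * (C1 + (Mp + M) + 1) + e + 2 * disk_area 3), r1, (I / 300 / 4); split.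
- by rewrite T'0.
- have z0 : 0 <= CE b * Zf r1 * Mp by rewrite !mulr_ge0// ltW.
  have z1 : 0 <= 27 * Cq R * (C1 + (Mp + M) + 1).
    by rewrite mulr_ge0 ?addr_ge0// mulr_ge0// ltW// Cq_gt0.
  by split; [have [] := strain_const_ge0 A0 e0 z0|have [] := strain_const_ge0 A0 e0 z1].
- by split.
- exact: divr_gt0.
split.
- by move=> t /tt; exact: wL.
- move=> t X tT X0.
  have XX : 0 <= enorm X ^+ 2 by rewrite exprn_ge0// enorm_ge0.
  have z0 : 0 <= CE b * Zf r1 * Mp by rewrite !mulr_ge0// ltW.
  have [Xr|Xr] := leP (enorm X) r1.
    have X12 := le_half r18 Xr.
    have j1 := JP t X tT X0 Xr; have j2 := J_g0_le mg0 g0_itv g0_supp X12.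
    rewrite -[JI t X](subrK (\int[mu2]_y (Jker X y * g0 y))).
    apply: le_trans (ler_normD _ _) _; apply: le_trans (lerD j1 j2) _.
    exact: strain_const_le (mulr_ge0 z0 XX).
  (* For |X| > r1 the weight Z is bounded by its value at r1, so the global bound on the
     perturbation is enough. With c = 0 the core is the profile. *)
  have [M1 [M3 LF]] := L13_core s_smooth C10 hC1 0 (lexx 1).
  have ce (a : R) : core s 0 1 a = profile s a by rewrite /core; case: ifP => _; rewrite addr0.
  have LF' : L13 (fun y => profile s (enorm y)) M1 M3.
    by move: LF; congr L13; apply/funext => y; rewrite ce.
  have bb : {ae mu2, forall y, `|w t (y + Phi t 0) - profile s (enorm y)| <=
      if enorm y < b then Mp + 0 * Lw (enorm y) else 0}.
    by apply: filterS (hM t (tt t tT)) => y; rewrite mul0r addr0.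
  apply: le_trans (J_weight_le X0 b0 Mp0 (lexx 0) (LS t tT) (measurable_profile s_smooth) LF' bb) _.
  rewrite mul0r addr0 mulrC ler_wpM2r//.
  apply: le_strain_const => //.
  by rewrite ler_wpM2r// ler_wpM2l// Zf_anti// ltW.
- move=> t X i tT X0 Xr; have X12 := le_half r18 Xr.
  apply: le_trans (DK_perturb s_smooth C10 hC1 g0_itv g0_supp (LS t tT) rho1' (hom t tT) i X0 X12 (iW X X0 (le_trans Xr r11))) _.
  rewrite ler_wpM2r ?enorm_ge0// ler_wpM2r ?(le_trans ler01 (Lw_ge1 _))//.
  rewrite lerD2r lerD2r ler_wpM2l ?mulr_ge0 ?(ltW (Cq_gt0 R))//.
  by rewrite lerD2r lerD2l Mc.
- move=> t X tT k p Xr.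
  have X0 : X != 0 by apply: contraTneq p => ->; rewrite ltxx.
  have x8 := n12 _ _ p (fst_le X) Xr.
  have j1 := JP t X tT X0 Xr; have j2 := J_g0_cone1 mg0 g0_itv g0_supp k p x8.
  have j3 := cone_sq k p (enorm_sq X).
  rewrite -/I mulrAC -mulrA in j2.
  have j4 : enorm X ^+ 2 * (I / 300) <= 2 * X.1 ^+ 2 * (I / 300) by rewrite ler_wpM2r ?(ltW I30).
  move: j1; rewrite ler_norml => /andP[j1 _].
  exact: stretch_le j1 j2 j4.
- move=> t X tT k p Xr.
  have X0 : X != 0 by apply: contraTneq p => ->; rewrite ltxx.
  have x8 := n12 _ _ p (snd_le X) Xr.
  have j1 := JP t X tT X0 Xr; have j2 := J_g0_cone2 mg0 g0_itv g0_supp k p x8.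
  have j3 := cone_sq k p (etrans (enorm_sq X) (addrC _ _)).
  rewrite -/I mulrAC -mulrA in j2.
  have j4 : enorm X ^+ 2 * (I / 300) <= 2 * X.2 ^+ 2 * (I / 300) by rewrite ler_wpM2r ?(ltW I30).
  have j5 : 0 <= enorm X ^+ 2 * (I / 300) by rewrite mulr_ge0 ?exprn_ge0 ?enorm_ge0 ?(ltW I30).
  move: j1; rewrite ler_norml => /andP[_ j1].
  exact: contract_le j1 j2 j4 j5.
Qed.

End Contradiction.

(** * Comparison of two particles on the axes *)

Section NoModulus.
Variable R : realType.
Local Notation mR := (measurableTypeR R).
Local Notation mR2 := (mR * mR)%type.
Local Notation mu2 := (@leb2 R).

Lemma box_enorm1 (X : R * R) (r : R) : 0 < r -> r < X.1 < 2 * r -> `|X.2| <= r / 32 ->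
  r <= enorm X <= 3 * r.
Proof.
move=> r0 /andP[h1 h2] h3; apply/andP; split.
  apply: le_trans (sup_le_enorm X); rewrite le_max; apply/orP; left.
  exact: le_trans (ltW h1) (ler_norm _).
by apply: le_trans (enorm_le_l1 X) _; rewrite [`|X.1|]gtr0_norm; lra.
Qed.

Lemma box_enorm2 (X : R * R) (r : R) : 0 < r -> r < X.2 < 2 * r -> `|X.1| <= r / 32 ->
  r <= enorm X <= 3 * r.
Proof.
move=> r0 h1 h2; have := @box_enorm1 (X.2, X.1) r r0 h1 h2.
by rewrite /enorm /= addrC.
Qed.

Lemma box_dist (X Y : R * R) (r : R) : 0 < r -> r < X.1 -> Y.1 < r / 32 ->
  enorm X <= 3 * r -> enorm Y <= 3 * r -> 0 < enorm (X - Y) <= 6 * r.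
Proof.
move=> r0 x1 y1 hX hY; apply/andP; split.
  by rewrite enorm_gt0 subr_eq0; apply: contraTneq x1 => ->; rewrite -leNgt; lra.
by have := enorm_triangle X (- Y); rewrite enormN; lra.
Qed.

Lemma ln_double_le (l : R) : 3 <= l -> ln 2 + l <= 2 * l.
Proof. by move=> l3; have := @ln_le_sub1 R 2 ltac:(lra); lra. Qed.

Lemma shift_le (a b C : R) : `|a - b| <= C -> 1 + b <= 1 + C + a.
Proof. by rewrite ler_norml => /andP[h _]; lra. Qed.

Lemma gap_le (k t x a : R) : 2 * k * t <= - (2 * x) - - (2 * a) -> x + k * t <= a.
Proof. by move=> h; lra. Qed.

Lemma log_modulus_6r (beta r l : R) : 0 < beta -> 0 < r -> ln r^-1 = l -> 0 < l -> 2 * ln 6 <= l ->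
  log_modulus beta (6 * r) <= (l / 2) `^ (- beta).
Proof.
move=> b0 r0 rl l0 l6; rewrite /log_modulus gt_eqF ?mulr_gt0//.
rewrite invfM lnM ?posrE ?invr_gt0// rl lnV ?posrE//.
have h : l / 2 <= - ln 6 + l by lra.
have h0 : 0 < l / 2 by rewrite divr_gt0.
have h1 := lt_le_trans h0 h.
rewrite !powRN lef_pV2 ?posrE ?powR_gt0//.
by apply: ge0_ler_powR; rewrite ?nnegrE ?(ltW b0) ?(ltW h0) ?(ltW h1).
Qed.

Lemma no_log_modulus (s : R -> R) (g0 : R * R -> R) w Phi (T beta M : R) (g : R -> R * R -> R) :
  smooth_on [set~ (0 : R * R)] (loglog_vortex s) ->
  continuous g0 -> measurable_fun [set: mR2] (g0 : mR2 -> R) ->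
  (forall y, 0 <= g0 y <= 1) ->
  (forall y, g0 y != 0 -> 1 <= y.1 <= 2 /\ 1 <= y.2 <= 2) ->
  0 < \int[mu2]_y g0 y ->
  0 < T -> euler_solution (fun x => loglog_vortex s x + g0 x) w Phi ->
  1 < beta -> 0 <= M ->
  (forall t : R, 0 <= t <= T ->
    {ae mu2, forall x, w t x = loglog_vortex s (x - Phi t 0) + g t x}) ->
  (forall (t : R) (x y : R * R), 0 <= t <= T -> 0 < enorm (x - y) < expR (- 1) ->
    `|g t x - g t y| <= M * log_modulus beta (enorm (x - y))) -> False.
Proof.
move=> ss cg mg gi gs gp T0 sol b1 M0 gd gm.
have [N1 [N3 [T' [KJ [KD [r1 [kappa H]]]]]]] :=
  strain_bounds ss cg mg gi gs gp T0 sol b1 M0 gd gm.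
have [/andP[T'0 T'T] [KJ0 KD0] [r10 r18 r12] k0 [wL hJ hD h1 h2]] := H => {H}.
have [C1 C10 hC1] := profile_Zf ss.
have beta0 : 0 < beta by exact: lt_trans b1.
have flow := Phi_flow sol; have inj := Phi_inj sol.
have l4 : 0 < ln 4 :> R by rewrite ln_gt0// ltr1n.
pose K9 := 32 * (30 * KD).
have K90 : 0 <= K9 by rewrite mulr_ge0// mulr_ge0.
have K9E : K9 = 32 * (30 * KD) by [].
clearbody K9.
have KD1 : 0 < K9 + 1 by rewrite ltr_wpDl.
have KJ1 : 0 < 2 * KJ + 1 by rewrite ltr_wpDl// mulr_ge0.
(* Chosen independently of r so that the time c / L meets [tsT], [tJ] and [tD]; the summands 1 only
   avoid division by 0. *)
pose c := Num.min T' (Num.min (ln 4 / (2 * KJ + 1)) (K9 + 1)^-1).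
have c0 : 0 < c by rewrite !lt_min T'0 divr_gt0//= invr_gt0.
have cT : c <= T' by rewrite ge_min lexx.
have cJ : 2 * KJ * c <= ln 4.
  have h : c <= ln 4 / (2 * KJ + 1) by rewrite !ge_min lexx !orbT.
  rewrite ler_pdivlMr// mulrC in h; apply: le_trans h; by rewrite ler_wpM2r ?(ltW c0)// lerDl.
have cD : K9 * c <= 1.
  have h : c <= (K9 + 1)^-1 by rewrite !ge_min lexx !orbT.
    apply: le_trans (ler_wpM2l K90 h) _.
  by rewrite ler_pdivrMr// mul1r lerDl.
clearbody c.
pose k := (2 * pi)^-1 * kappa.
have kp : 0 < k by rewrite mulr_gt0 ?(pi2_inv R).1.
have [l0 l01 hl] := ln_over_powR b1 (mulr_gt0 kp c0) M0 (addr_ge0 ler01 C10).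
(* With r = e^-l: [l0] serves the final contradiction, 2 ln 6 gives ln(1/(6 r)) >= l/2, 3 gives r <
   e^-2 and ln 2 + l <= 2 l, and ln(6/r1) gives 6 r <= r1. *)
pose l := Num.max l0 (Num.max (2 * ln 6) (Num.max 3 (ln (6 / r1)))).
have ll0 : l0 <= l by rewrite le_max lexx.
have l6 : 2 * ln 6 <= l by rewrite !le_max lexx !orbT.
have l3 : 3 <= l by rewrite !le_max lexx !orbT.
have lr : ln (6 / r1) <= l by rewrite !le_max lexx !orbT.
have {}hl := hl l ll0; clearbody l => {l01 ll0 l0}.
pose r := expR (- l).
have r0 : 0 < r by exact: expR_gt0.
have rl : ln r^-1 = l by rewrite /r expRN invrK expRK.
have r6 : 6 * r <= r1.
  rewrite mulrC -ler_pdivlMr// /r expRN -[r1 / 6]invrK invf_div lef_pV2 ?posrE ?expR_gt0 ?divr_gt0//.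
  by rewrite -[6 / r1]lnK ?posrE ?divr_gt0// ler_expR.
have re2 : r < expR (- 2) by rewrite /r ltr_expR ltrN2 (lt_le_trans _ l3)// ltr_nat.
clearbody r.
have lp : 0 < l by apply: lt_le_trans l3; rewrite ltr0n.
have LwU : Lw r <= 1 + C1 + ln l.
  by have := hC1 r r0; rewrite profile_lo// rl => /shift_le.
have L1 := Lw_ge1 r; have L0 : 0 < Lw r by exact: lt_le_trans L1.
(* Up to the constant c, the longest time for which the displacement bound keeps particles at scale
   r inside their cones. *)
pose ts := c / Lw r.
have tsc : ts <= c by rewrite /ts ler_pdivrMr// ler_peMr// ltW.
have ts0 : 0 < ts by exact: divr_gt0.
have tsT : 0 <= ts <= T' by rewrite (ltW ts0) (le_trans tsc).
have tsTT : 0 <= ts <= T by rewrite (ltW ts0) (le_trans tsc)// (le_trans cT).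
have tJ : 2 * KJ * ts <= ln 4.
  by apply: le_trans cJ; rewrite ler_wpM2l// mulr_ge0.
have tD : 32 * (30 * KD) * Lw r * ts <= 1.
  by rewrite -K9E /ts -mulrA [Lw r * _]mulrC divfK ?gt_eqF.
have kts : k * ts * Lw r = k * c by rewrite /ts -mulrA divfK ?gt_eqF.
clearbody ts.
set p := Phi ts 0.
have [Psi [p1 p2 hv]] := w_centered sol tsTT.
have hP : {ae mu2, forall y, g ts (y + p) =
    (profile s (enorm (Psi (y + p))) + g0 (Psi (y + p))) - profile s (enorm y)}.
  have ha := ae_mpres (mpres_add p) (gd ts tsTT).
  apply: filterS2 hv ha => y; rewrite -/p /= => -> e.
  by move: e; rewrite addrK !vortexE => ->; rewrite addrAC subrr add0r.
(* At time [ts] both the particle and its initial position lie in the disk where the vortex is ln ln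
   and [g0] vanishes, so g there is the difference of two values of ln ln. *)
have key (X : R * R) : g ts (X + p) =
      (profile s (enorm (Psi (X + p))) + g0 (Psi (X + p))) - profile s (enorm X) ->
    r <= enorm X <= 3 * r ->
    [/\ Psi (X + p) != 0, Xt Phi (Psi (X + p)) ts = X, 0 < enorm (Psi (X + p)),
        g ts (X + p) = ln (ln (enorm (Psi (X + p)))^-1) - ln (ln (enorm X)^-1) &
        [/\ ln (enorm (Psi (X + p)))^-1 <= 2 * l, 0 < ln (enorm (Psi (X + p)))^-1 & 0 < ln (enorm X)^-1]].
  move=> hX rX; set a := Psi (X + p) in hX *.
  have /andP[rX1 rX2] := rX.
  have x0 : 0 < enorm X by exact: lt_le_trans rX1.
  have Xa : Xt Phi a ts = X by rewrite /Xt /a p2 addrK.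
  have a0 : a != 0.
    by move: x0; rewrite enorm_gt0; apply: contra => /eqP ea; rewrite -Xa ea /Xt subrr.
  have rXa : r <= enorm (Xt Phi a ts) <= 3 * r by rewrite Xa.
  have u0 : 0 <= (0 : R) <= ts by rewrite lexx ltW.
  have := backward_radius flow inj wL KJ0 hJ a0 tsT rXa tJ u0.
  rewrite (Xt0 flow) => /andP[ra1 ra2].
  have r20 : 0 < r / 2 by rewrite divr_gt0.
  have ap : 0 < enorm a by exact: lt_le_trans ra1.
  have ae2 : enorm a < expR (- 2) by apply: le_lt_trans r12; exact: le_trans ra2 r6.
  have r3 : 3 * r <= 6 * r by rewrite ler_wpM2r ?(ltW r0)// ler_nat.
  have xe2 : enorm X < expR (- 2).
    by apply: le_lt_trans r12; apply: le_trans rX2 (le_trans r3 r6).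
  have ee : expR (- 2) < 1 :> R by rewrite expR_lt1 oppr_lt0.
  have g00 : g0 a = 0.
    by apply: contraTeq (lt_trans ae2 ee) => /(g0_annulus gs) /andP[+ _]; rewrite -leNgt.
  split => //; first by rewrite hX g00 addr0 !profile_lo.
  split; last 2 first.
  - by rewrite ln_gt0// invf_gt1// (lt_trans ae2).
  - by rewrite ln_gt0// invf_gt1// (lt_trans xe2).
  apply: (@le_trans _ _ (ln (2 * r^-1))).
    rewrite ler_ln ?posrE ?invr_gt0 ?mulr_gt0 ?invr_gt0//.
    by rewrite -[2 * r^-1]invrK invfM invrK lef_pV2 ?posrE ?mulr_gt0// mulrC.
  rewrite lnM ?posrE ?invr_gt0// rl.
  exact: ln_double_le.
have rr : r < 2 * r by rewrite ltr_pMl// ltr1n.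
have rp : 0 < r / 32 by exact: divr_gt0.
have rm : - (r / 32) < r / 32 by rewrite (@lt_trans _ _ 0)// oppr_lt0.
(* The formula for g holds only almost everywhere, so the two points are taken from thin boxes along
   the axes: g is large at the one being stretched and nonpositive at the other. *)
have [X1 [/andP[x1 x1'] /andP[y1 y1'] /key kX1]] := ae_witness hP rr rm.
have [X2 [/andP[x2 x2'] /andP[y2 y2'] /key kX2]] := ae_witness hP rm rr.
have n1 : `|X1.2| <= r / 32 by rewrite ler_norml; apply/andP; split; exact: ltW.
have n2 : `|X2.1| <= r / 32 by rewrite ler_norml; apply/andP; split; exact: ltW.
have rX1 : r <= enorm X1 <= 3 * r by apply: box_enorm1 => //; rewrite x1.
have rX2 : r <= enorm X2 <= 3 * r by apply: box_enorm2 => //; rewrite y2.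
have [a10 Xa1 ap1 gX1 [la1 la1p lx1]] := kX1 rX1.
have [a20 Xa2 ap2 gX2 [la2 la2p lx2]] := kX2 rX2.
move: (Psi (X1 + p)) (Psi (X2 + p)) => a1 a2 in a10 Xa1 ap1 gX1 la1 la1p a20 Xa2 ap2 gX2 la2 la2p.
have lnE (a X : R * R) : Xt Phi a ts = X -> 0 < enorm a -> 0 < enorm X ->
    ln (Nt Phi a ts) = - (2 * ln (enorm X)^-1) /\ ln (Nt Phi a 0) = - (2 * ln (enorm a)^-1).
  by move=> e p0 q0; rewrite !NtE e (Xt0 flow) !ln_sqr// !lnV ?posrE//; split; ring.
have xp1 : 0 < enorm X1 by have /andP[h _] := rX1; exact: lt_le_trans h.
have xp2 : 0 < enorm X2 by have /andP[h _] := rX2; exact: lt_le_trans h.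
have G1 : k * ts / (2 * l) <= g ts (X1 + p).
  rewrite gX1; apply: lnln_gap => //; last by rewrite mulr_ge0 ?ltW.
  have rXa : r <= enorm (Xt Phi a1 ts) <= 3 * r by rewrite Xa1.
  have := stretched_axis flow inj wL KJ0 KD0 hJ hD h1 a10 tsT r0 r6 rXa tJ tD.
  rewrite Xa1 => /(_ (ltW x1) n1); have [-> ->] := lnE _ _ Xa1 ap1 xp1.
  by rewrite -/k => /gap_le.
have G2 : g ts (X2 + p) <= 0.
  rewrite gX2 subr_le0 ler_ln ?posrE//.
  have rXa : r <= enorm (Xt Phi a2 ts) <= 3 * r by rewrite Xa2.
  have := contracted_axis flow inj wL KJ0 KD0 hJ hD h2 a20 tsT r0 r6 rXa tJ tD.
  by rewrite Xa2 => /(_ (ltW y2) n2); have [-> ->] := lnE _ _ Xa2 ap2 xp2; rewrite lerN2 ler_pM2l.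
have /andP[D0 D6] : 0 < enorm (X1 - X2) <= 6 * r.
  by have /andP[_ q1] := rX1; have /andP[_ q2] := rX2; exact: box_dist.
have ee : expR (- 1) < 1 :> R by rewrite expR_lt1 oppr_lt0.
have e21 : expR (- 2) < expR (- 1) :> R by rewrite ltr_expR ltrN2 ltr1n.
have e1 : 6 * r < expR (- 1) by apply: le_lt_trans r6 (lt_trans r12 e21).
have De := le_lt_trans D6 e1.
have := gm ts (X1 + p) (X2 + p) tsTT.
have -> : X1 + p - (X2 + p) = X1 - X2 by rewrite opprD addrACA subrr addr0.
rewrite D0 De => /(_ isT) hg.
have lm : log_modulus beta (enorm (X1 - X2)) <= (l / 2) `^ (- beta).
  apply: le_trans (log_modulus_le beta0 (ltW D0) D6 (lt_trans e1 ee)) _.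
  exact: log_modulus_6r.
have G3 : k * ts / (2 * l) <= M * (l / 2) `^ (- beta).
  apply: le_trans (ler_wpM2l M0 lm); apply: le_trans hg.
  by apply: le_trans (ler_norm _); rewrite (le_trans G1)// lerBrDl gerDr.
rewrite ler_pdivrMr ?mulr_gt0// in G3.
have P0 : 0 <= M * (l / 2) `^ (- beta) * (2 * l).
  by rewrite mulr_ge0 ?mulr_ge0 ?powR_ge0// ltW.
(* Multiplying by L turns k ts into the constant k c, while L <= 1 + C1 + ln l on the other side;
   [hl] rules this out. *)
have := ler_wpM2r (ltW L0) G3; rewrite kts => G4.
have G5 := le_trans G4 (ler_wpM2l P0 LwU).
by move: hl; rewrite mulrA ltNge G5.
Qed.

End NoModulus.

(** * The initial perturbation *)

Section FlatExp.
Variable R : realType.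

(* The functions p(1/t) exp(-1/t), extended by 0 to t <= 0, are closed under
   differentiation, since (p(1/t) exp(-1/t))' = t^-2 (p - p')(1/t) exp(-1/t). *)
Definition flat_exp (p : {poly R}) (t : R) : R :=
  if 0 < t then p.[t^-1] * expR (- t^-1) else 0.

Definition flat_deriv (p : {poly R}) : {poly R} := 'X^2 * (p - p^`()).

Lemma expr_le_expR (u : R) (n : nat) : 0 <= u -> u ^+ n <= n.+1%:R ^+ n * expR u.
Proof.
move=> u0; have h : u / n.+1%:R <= expR (u / n.+1%:R).
  by apply: le_trans (expR_ge1Dx _); rewrite lerDr.
have n0 : 0 < n.+1%:R :> R by rewrite ltr0n.
have v0 : 0 <= u / n.+1%:R by rewrite divr_ge0// ltW.
have e1 : 1 <= expR (u / n.+1%:R) by rewrite -[X in X <= _]expR0 ler_expR.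
rewrite -{1}[u](divfK (x := n.+1%:R)) ?gt_eqF// exprMn mulrC ler_wpM2l ?exprn_ge0 ?(ltW n0)//.
apply: (@le_trans _ _ (expR (u / n.+1%:R) ^+ n)); first by rewrite lerXn2r ?nnegrE ?expR_ge0.
apply: (@le_trans _ _ (expR (u / n.+1%:R) ^+ n.+1)); first by rewrite exprS ler_peMl ?exprn_ge0 ?expR_ge0.
by rewrite -expRM_natl -mulrC divfK// gt_eqF.
Qed.

Lemma horner_le_expR (p : {poly R}) : exists2 C : R, 0 <= C & forall u, 0 <= u -> `|p.[u]| <= C * expR u.
Proof.
exists (\sum_(i < size p) `|p`_i| * i.+1%:R ^+ i).
  by apply: sumr_ge0 => i _; rewrite mulr_ge0 ?exprn_ge0.
move=> u u0; rewrite horner_coef mulr_suml; apply: le_trans (ler_norm_sum _ _ _) _.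
apply: ler_sum => i _; rewrite normrM -mulrA ler_wpM2l//.
by rewrite ger0_norm ?exprn_ge0// expr_le_expR.
Qed.

(** Quadratic flatness makes the difference quotient at 0 vanish in the limit; it follows from the
    exponential dominating the polynomial X^2 p. *)
Lemma flat_exp_le (p : {poly R}) : exists2 C : R, 0 <= C & forall t : R, `|flat_exp p t| <= C * t ^+ 2.
Proof.
have [C C0 hC] := horner_le_expR ('X^2 * p).
exists C => // t; rewrite /flat_exp; case: ifPn => [t0|_]; last first.
  by rewrite normr0 mulr_ge0// sqr_ge0.
have v0 : 0 <= t^-1 by rewrite invr_ge0 ltW.
have := hC _ v0; rewrite hornerM hornerXn normrM (ger0_norm (exprn_ge0 _ v0)).
rewrite normrM (ger0_norm (expR_ge0 _)) expRN ler_pdivrMr ?expR_gt0//.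
rewrite exprVn mulrC ler_pdivrMr ?exprn_gt0// => h.
by apply: le_trans h _; rewrite mulrAC.
Qed.

Lemma flat_exp_derive (p : {poly R}) (t : R) :
  is_derive t 1 (flat_exp p) (flat_exp (flat_deriv p) t).
Proof.
have [t0|t0|->] := ltgtP t 0.
- have -> : flat_exp (flat_deriv p) t = 0 by rewrite /flat_exp ltNge ltW.
  apply: (@near_eq_is_derive _ _ _ (fun=> 0)).
  near=> u; rewrite /flat_exp ltNge; have -> // : u <= 0.
  by apply: ltW; near: u; exact: lt_nbhsl.
- have dp : is_derive t^-1 1 (horner p) (p^`()).[t^-1] by exact: is_derive_poly.
  have di : is_derive t 1 (fun u : R => u^-1) (- 1 / t ^+ 2).
    by have := dV (f := id) _ (did t); apply; rewrite gt_eqF.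
  have d := dM (dcomp dp di) (dexp (dN di)).
  apply: (@near_eq_is_derive _ _ _ (fun u : R => p.[u^-1] * expR (- u^-1))).
    near=> u; rewrite /flat_exp; have -> // : 0 < u.
    by near: u; exact: lt_nbhsr.
  apply: (deq d); rewrite /flat_exp t0 /flat_deriv hornerM hornerXn hornerD hornerN exprVn.
  by field; rewrite gt_eqF.
- have -> : flat_exp (flat_deriv p) 0 = 0 by rewrite /flat_exp ltxx.
  have [C C0 hC] := flat_exp_le p.
  have f0 : flat_exp p 0 = 0 by rewrite /flat_exp ltxx.
  have lim : h^-1 *: ((flat_exp p \o shift 0) (h *: (1 : R)) - flat_exp p 0) @[h --> 0^'] --> (0 : R).
    apply/cvgrPdist_le => e e0; near=> h.
    have h0 : h != 0 by near: h; exact: nbhs_dnbhs_neq.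
    rewrite sub0r normrN /= f0 subr0 addr0 /GRing.scale/= mulr1 normrM normfV.
    rewrite mulrC ler_pdivrMr ?normr_gt0//; apply: le_trans (hC h) _.
    rewrite -[h ^+ 2]real_normK ?num_real// expr2 mulrA ler_wpM2r//.
    apply: (@le_trans _ _ ((C + 1) * `|h|)); first by rewrite ler_wpM2r// lerDl.
    rewrite mulrC -ler_pdivlMr ?ltr_wpDl//; near: h.
    apply: (@dnbhs0_le R R (e / (C + 1))); by rewrite divr_gt0// ltr_wpDl.
  apply: DeriveDef; first by apply/cvg_ex; exists 0.
  exact: cvg_lim lim.
Unshelve. all: by end_near. Qed.

(** A class that contains the bump and is closed under directional derivatives, so that
    differentiability of all iterated derivatives follows by induction on the list of directions. *)
Inductive smooth_expr : (R * R -> R) -> Prop :=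
| smooth_flat p (a b c : R) : smooth_expr (fun x => flat_exp p (a * x.1 + b * x.2 + c))
| smooth_cst (c : R) : smooth_expr (fun=> c)
| smooth_add f h : smooth_expr f -> smooth_expr h -> smooth_expr (fun x => f x + h x)
| smooth_mul f h : smooth_expr f -> smooth_expr h -> smooth_expr (fun x => f x * h x).

Lemma affine_differentiable (a b c : R) (x : R * R) :
  differentiable (fun x : R * R => a * x.1 + b * x.2 + c) x.
Proof.
have c1 : continuous (fst : R * R -> R) by move=> y; exact: (@continuous_fst R y).
have d1 : differentiable (fun x : R * R => x.1) x.
  by have := @linear_differentiable R (R * R)%type R (fst : {linear (R * R)%type -> R}) x c1; apply.
have c2 : continuous (snd : R * R -> R) by move=> y; exact: (@continuous_snd R y).
have d2 : differentiable (fun x : R * R => x.2) x.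
  by have := @linear_differentiable R (R * R)%type R (snd : {linear (R * R)%type -> R}) x c2; apply.
apply: differentiableD => //; apply: differentiableD; exact: differentiableM.
Qed.

Lemma smooth_expr_differentiable f x : smooth_expr f -> differentiable f x.
Proof.
elim=> [p a b c|c|f1 f2 _ d1 _ d2|f1 f2 _ d1 _ d2].
- apply: (differentiable_comp (affine_differentiable a b c x)).
  by apply/derivable1_diffP; have [] := flat_exp_derive p (a * x.1 + b * x.2 + c).
- exact: differentiable_cst.
- exact: differentiableD.
- exact: differentiableM.
Qed.

Lemma smooth_expr_derive f (v : R * R) : smooth_expr f ->
  exists2 f', smooth_expr f' & forall x, 'D_v f x = f' x.
Proof.
elim=> [p a b c|c|f1 f2 s1 [f1' t1 e1] s2 [f2' t2 e2]|f1 f2 s1 [f1' t1 e1] s2 [f2' t2 e2]].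
- exists (fun x => flat_exp (flat_deriv p) (a * x.1 + b * x.2 + c) * (a * v.1 + b * v.2)).
    by apply: smooth_mul; [exact: smooth_flat|exact: smooth_cst].
  move=> x; set L := a * v.1 + b * v.2; set t := a * x.1 + b * x.2 + c.
  (* Along a line the affine argument is h L + t, so the directional derivative is literally the
     limit of a one-dimensional difference quotient. *)
  have dl : is_derive (0 : R) 1 (fun h : R => h * L + t) L.
    by eapply deq; [dauto|cbv beta; ring].
  have dt : is_derive (0 * L + t) 1 (flat_exp p) (flat_exp (flat_deriv p) t).
    by rewrite mul0r add0r; exact: flat_exp_derive.
  have [_ <-] := @dcomp R (flat_exp p) (fun h : R => h * L + t) 0 _ _ dt dl.
  rewrite /derive; set F := (X in lim (X @ _) = _); set G := (X in _ = lim (X @ _)).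
  suff -> : F = G by [].
  apply/funext => h; rewrite /F /G /= mul0r add0r; congr (_ *: (_ - _)).
  by congr flat_exp; rewrite /GRing.scale/= /t /L; ring.
- by exists (fun=> 0); [exact: smooth_cst|move=> x; exact: derive_cst].
- exists (fun x => f1' x + f2' x); first exact: smooth_add.
  move=> x; rewrite deriveD ?e1 ?e2//; apply: diff_derivable; exact: smooth_expr_differentiable.
- exists (fun x => f1 x * f2' x + f2 x * f1' x).
    by apply: smooth_add; exact: smooth_mul.
  move=> x; rewrite deriveM ?e1 ?e2//; apply: diff_derivable; exact: smooth_expr_differentiable.
Qed.

Lemma smooth_expr_smooth f : smooth_expr f -> smooth_on setT f.
Proof.
move=> sf vs x _; apply: smooth_expr_differentiable.
elim: vs => [//|v vs IH] /=.
have [f' sf' e] := smooth_expr_derive v IH.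
by have -> : 'D_v (iter_derive vs f) = f' by exact/funext.
Qed.

End FlatExp.

(** * The bump and the conclusion *)

Section Bump.
Variable R : realType.
Local Notation mR := (measurableTypeR R).
Local Notation mR2 := (mR * mR)%type.
Local Notation mu2 := (@leb2 R).

(** Positive exactly on the open square with both coordinates between 1 and 2. The coefficients 0
    and 1 are written out to match [smooth_flat]. *)
Definition bump (x : R * R) : R :=
  flat_exp 1 (1 * x.1 + 0 * x.2 + - 1) * flat_exp 1 (- 1 * x.1 + 0 * x.2 + 2) *
  (flat_exp 1 (0 * x.1 + 1 * x.2 + - 1) * flat_exp 1 (0 * x.1 + - 1 * x.2 + 2)).

Lemma flat_exp1_itv (t : R) : 0 <= flat_exp 1 t <= 1.
Proof.
rewrite /flat_exp; case: ifPn => [t0|_]; last by rewrite lexx ler01.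
by rewrite hornerC mul1r expR_ge0 -[X in _ <= X]expR0 ler_expR oppr_le0 invr_ge0 ltW.
Qed.

Lemma flat_exp1_gt0 (t : R) : 0 < t -> 0 < flat_exp 1 t.
Proof. by move=> t0; rewrite /flat_exp t0 hornerC mul1r expR_gt0. Qed.

Lemma flat_exp_neq0 (p : {poly R}) (t : R) : flat_exp p t != 0 -> 0 < t.
Proof. by rewrite /flat_exp; case: ifP => //; rewrite eqxx. Qed.

Lemma bump_smooth : smooth_on setT bump.
Proof. by apply: smooth_expr_smooth; do 2?apply: smooth_mul; exact: smooth_flat. Qed.

Lemma bump_itv x : 0 <= bump x <= 1.
Proof.
have H (u q : R) : 0 <= u <= 1 -> 0 <= q <= 1 -> 0 <= u * q <= 1.
  by move=> /andP[u0 u1] /andP[q0 q1]; rewrite mulr_ge0// mulr_ile1.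
by apply: (H); apply: (H); exact: flat_exp1_itv.
Qed.

Lemma bump_supp x : bump x != 0 -> 1 <= x.1 <= 2 /\ 1 <= x.2 <= 2.
Proof.
rewrite /bump !mulf_eq0 !negb_or => /andP[/andP[a b] /andP[c d]].
move: (flat_exp_neq0 a) (flat_exp_neq0 b) (flat_exp_neq0 c) (flat_exp_neq0 d).
by move=> *; split; apply/andP; split; lra.
Qed.

Lemma bump_gt0 x : 1 < x.1 < 2 -> 1 < x.2 < 2 -> 0 < bump x.
Proof.
by move=> /andP[? ?] /andP[? ?]; apply: mulr_gt0; apply: mulr_gt0; apply: flat_exp1_gt0; lra.
Qed.

Lemma bump_continuous : continuous bump.
Proof. by move=> x; apply: differentiable_continuous; exact: (@bump_smooth [::] x I). Qed.

Lemma measurable_bump : measurable_fun [set: mR2] (bump : mR2 -> R).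
Proof.
have mE (a b c : R) : measurable_fun [set: mR2] ((fun x => flat_exp 1 (a * x.1 + b * x.2 + c)) : mR2 -> R).
  apply: (measurableT_comp (f := flat_exp 1 : mR -> mR)).
    apply: continuous_measurable_fun => t; have [+ _] := flat_exp_derive (1 : {poly R}) t.
    by move=> /derivable1_diffP/differentiable_continuous.
  have m1 : measurable_fun [set: mR2] (fun x : mR2 => a * x.1).
    by apply: measurable_funM; [exact: measurable_cst|exact: measurable_fst2].
  have m2 : measurable_fun [set: mR2] (fun x : mR2 => b * x.2).
    by apply: measurable_funM; [exact: measurable_cst|exact: measurable_snd2].
  by apply: measurable_funD; [exact: measurable_funD|exact: measurable_cst].
by apply: measurable_funM; apply: measurable_funM; exact: mE.
Qed.

Lemma bump_compact : compactly_supported bump.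
Proof.
pose B : set (R * R) := `[1, 2]%classic `*` `[1, 2]%classic.
have cB : compact B by apply: compact_setX; exact: segment_compact.
have clB : closed B by apply: compact_closed cB; exact: norm_hausdorff.
apply: (subclosed_compact _ cB); first exact: closed_closure.
rewrite [X in _ `<=` X]((closure_id B).1 clB); apply: closure_subset => x /= /bump_supp[h1 h2].
by split; rewrite /= in_itv.
Qed.

Lemma bump_integral : 0 < \int[mu2]_y bump y.
Proof.
have L := L13_g0 measurable_bump bump_itv bump_supp.
have [_ ib1 _] := L; have [j _] := ib_norm measurable_bump ib1.
have ge0 : 0 <= \int[mu2]_y bump y.
  by apply: Rintegral_ge0 => y _; have /andP[] := bump_itv y.
rewrite lt_neqAle ge0 andbT eq_sym; apply/eqP => i0.
have fin := integrable_fin_num measurableT j.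
have e : (\int[mu2]_y (EFin \o bump) y = 0)%E by rewrite -[LHS]fineK// -/(Rintegral _ _ _) i0.
have h : (\int[mu2]_(y in setT) `|(EFin \o bump) y| = 0)%E.
  rewrite -e; apply: eq_integral => y _ /=; rewrite ger0_norm//.
  by have /andP[] := bump_itv y.
have mE : measurable_fun [set: mR2] (EFin \o bump) by apply/measurable_EFinP; exact: measurable_bump.
have := (ae_eq_integral_abs mu2 measurableT mE).1 h.
move=> z; have z' : {ae mu2, forall y, bump y = 0}.
  by apply: (@filterS _ _ (ae_filter_ringOfSetsType mu2)) z => y /(_ I) [].
have [y [y1 y2 y0]] := ae_witness z' (ltr_nat R 1 2) (ltr_nat R 1 2).
by have := bump_gt0 y1 y2; rewrite y0 ltxx.
Qed.

Lemma Cmod_norm_bound (beta K : R) (f : R * R -> R) :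
  (Cmod_norm (log_modulus beta) (expR (- 1)) f <= K%:E)%E ->
  forall x y, 0 < enorm (x - y) < expR (- 1) -> `|f x - f y| <= K * log_modulus beta (enorm (x - y)).
Proof.
move=> h x y xy; have /andP[d0 d1] := xy.
have ee : expR (- 1) < 1 :> R by rewrite expR_lt1 oppr_lt0.
have m0 : 0 < log_modulus beta (enorm (x - y)).
  by rewrite /log_modulus gt_eqF// powR_gt0// ln_gt0// invf_gt1// (lt_trans d1).
rewrite -ler_pdivrMr// -lee_fin; apply: le_trans h.
apply: (@le_trans _ _ (ereal_sup [set (`|f z.1 - f z.2| / log_modulus beta (enorm (z.1 - z.2)))%:E
             | z in [set z : (R * R) * (R * R) | (0 < enorm (z.1 - z.2) < expR (- 1))%R]])).
  by apply: ereal_sup_ubound; exists (x, y).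
by rewrite /Cmod_norm leeDr// Lnorm_ge0.
Qed.

End Bump.

Theorem theorem1p5 (R : realType) (s : R -> R)
    (s_smooth : smooth_on [set~ (0 : R * R)] (loglog_vortex s)) :
  exists g0 : R * R -> R,
    [/\ smooth_on setT g0, compactly_supported g0 &
    forall beta T : R, 1 < beta -> 0 < T ->
    forall (w : R -> R * R -> R) (Phi : R -> R * R -> R * R),
      euler_solution (fun x => loglog_vortex s x + g0 x) w Phi ->
      (exists g : R -> R * R -> R, vortex_decomposition s T w Phi g) /\
      (forall g : R -> R * R -> R, vortex_decomposition s T w Phi g ->
        ereal_sup [set Cmod_norm (log_modulus beta) (expR (- 1)) (g t)
                  | t in [set t : R | 0 <= t <= T]] = +oo%E)].
Proof.
exists (@bump R); split; [exact: bump_smooth|exact: bump_compact|].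
move=> beta T beta1 T0 w Phi sol; split.
  apply: vortex_decomposition_exists sol => //.
  - exact: g0_norm_le1 (@bump_itv R).
  - exact: g0_outside (@bump_supp R).
move=> g [g_dec _]; apply/eqP; apply: contraT; rewrite -ltey => supoo.
(* A finite supremum is a bound on the modulus constant uniform in time; the maximum with 0 makes it
   nonnegative. *)
have [M M0 hM] : exists2 M : R, 0 <= M & forall t : R, 0 <= t <= T ->
    (Cmod_norm (log_modulus beta) (expR (- 1)) (g t) <= M%:E)%E.
  move: supoo; set S := ereal_sup _ => supoo.
  exists (Num.max 0 (fine S)); first by rewrite le_max lexx.
  move=> t tT; apply: (@le_trans _ _ S); first by apply: ereal_sup_ubound; exists t.
  case: (S) supoo => [r _|//|_]; last by rewrite leNye.
  by rewrite lee_fin le_max lexx orbT.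
have [] := no_log_modulus s_smooth (@bump_continuous R) (@measurable_bump R)
  (@bump_itv R) (@bump_supp R) (bump_integral R) T0 sol beta1 M0 g_dec.
by move=> t x y tT; apply: Cmod_norm_bound; exact: hM.
Qed.
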